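(* Let $D$ be a countable digraph rooted at $r$, and let $F$ be a vertex-flame in $D$ (i.e. a subdigraph of $D$ containing $r$, rooted at $r$, which is a vertex-flame). Then there is a $D$-large vertex-flame $F^*$ in $D$ with $F \subseteq F^*$.
   Context: Digraphs have no loops or parallel edges. For a vertex $v$ of a digraph $H$, $\mathrm{in}_H(v)$ denotes the set of edges of $H$ with head $v$. An $(x,y)$-path is a directed path from $x$ to $y$; an $(x,y)$-path-system is a set of $(x,y)$-paths that are pairwise internally disjoint. For a set $\mathcal{P}$ of paths, $E^+(\mathcal{P})$ is the set of terminal edges of the paths in $\mathcal{P}$. For a rooted digraph $H$ with root $r$ and $v \neq r$, $\mathcal{G}_H(v)$ is the set of all $I \subseteq \mathrm{in}_H(v)$ such that there is an $(r,v)$-path-system $\mathcal{P}$ in $H$ with $E^+(\mathcal{P}) = I$. A rooted digraph $H$ is a vertex-flame if $\mathrm{in}_H(v) \in \mathcal{G}_H(v)$ for every vertex $v \neq r$. For distinct $x,y$ with $xy$ not an edge, an $(x,y)$-separation is a set $S \subseteq V \setminus \{x,y\}$ meeting every $(x,y)$-path. A set of paths $\mathcal{P}$ and a vertex set $S$ are orthogonal if every path in $\mathcal{P}$ meets $S$ in exactly one vertex and $S \subseteq \bigcup_{P\in\mathcal{P}} V(P)$. An $(x,y)$-path-system $\mathcal{P}$ is Erdős–Menger if some $(x,y)$-separation is orthogonal to it. For $v \neq r$, $\mathfrak{P}_D(v)$ denotes the set of Erdős–Menger $(r,v)$-path-systems in $D - rv$ (the digraph with the edge $rv$ deleted, if present).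 A spanning subdigraph $L \subseteq D$ is $v$-large (for $v \neq r$) if some $\mathcal{P} \in \mathfrak{P}_D(v)$ has all its paths contained in $L$, and $rv \in E(L)$ whenever $rv \in E(D)$. $L$ is $D$-large if it is $v$-large for every $v \in V(D) \setminus \{r\}$. *)

(* Defs.v *)
(* Digraphs on a countable vertex type V; vertex sets are
   predicates V -> Prop, edge relations V -> V -> Prop (no parallel edges by
   construction), edges are pairs (tail, head). *)
From mathcomp Require Import all_boot.
Set Implicit Arguments. Unset Strict Implicit. Unset Printing Implicit Defensive.

Section Digraphs.
Variable V : countType.

Fixpoint chain (e : V -> V -> Prop) (x : V) (s : seq V) : Prop :=
  match s with
  | [::] => True
  | y :: s' => e x y /\ chain e y s'
  end.

Definition xy_path (VS : V -> Prop) (ES : V -> V -> Prop) (x y : V) (p : seq V) : Prop :=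
  exists q, [/\ p = x :: q, last x q = y, uniq p,
                (forall z, z \in p -> VS z) & chain ES x q].

Definition path_system (VS : V -> Prop) (ES : V -> V -> Prop) (x y : V)
    (PS : seq V -> Prop) : Prop :=
  (forall p, PS p -> xy_path VS ES x y p) /\
  (forall p q, PS p -> PS q -> p <> q ->
     forall z, z \in p -> z \in q -> z = x \/ z = y).

Definition terminal_edges (PS : seq V -> Prop) (e : V * V) : Prop :=
  exists p pre, PS p /\ p = rcons (rcons pre e.1) e.2.

Definition in_edges (ES : V -> V -> Prop) (v : V) (e : V * V) : Prop :=
  ES e.1 e.2 /\ e.2 = v.

Definition in_G (VS : V -> Prop) (ES : V -> V -> Prop) (r v : V)
    (I : V * V -> Prop) : Prop :=
  (forall e, I e -> in_edges ES v e) /\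
  exists PS, path_system VS ES r v PS /\ (forall e, I e <-> terminal_edges PS e).

Definition vertex_flame (VS : V -> Prop) (ES : V -> V -> Prop) (r : V) : Prop :=
  forall v, VS v -> v <> r -> in_G VS ES r v (in_edges ES v).

Definition allV : V -> Prop := fun _ => True.

Definition del_edge (E : V -> V -> Prop) (r v : V) : V -> V -> Prop :=
  fun a b => E a b /\ ~ (a = r /\ b = v).

Definition separation (E : V -> V -> Prop) (x y : V) (S : V -> Prop) : Prop :=
  ~ S x /\ ~ S y /\
  forall p, xy_path allV E x y p -> exists2 z, z \in p & S z.

Definition orthogonal (PS : seq V -> Prop) (S : V -> Prop) : Prop :=
  (forall p, PS p -> exists! z, z \in p /\ S z) /\
  (forall s, S s -> exists p, PS p /\ s \in p).

Definition erdos_menger (E : V -> V -> Prop) (x y : V) (PS : seq V -> Prop) : Prop :=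
  path_system allV E x y PS /\ exists S, separation E x y S /\ orthogonal PS S.

Definition EM_systems (E : V -> V -> Prop) (r v : V) (PS : seq V -> Prop) : Prop :=
  erdos_menger (del_edge E r v) r v PS.

(* L spanning subdigraph of D given by edge relation L *)
Definition v_large (E L : V -> V -> Prop) (r v : V) : Prop :=
  (exists PS, EM_systems E r v PS /\ (forall p, PS p -> xy_path allV L r v p)) /\
  (E r v -> L r v).

Definition D_large (E L : V -> V -> Prop) (r : V) : Prop :=
  forall v, v <> r -> v_large E L r v.

End Digraphs.

(* Main.v *)
Require Import Defs.
From mathcomp Require Import all_boot.
From mathcomp Require Import boolp classical_sets.
Set Implicit Arguments. Unset Strict Implicit. Unset Printing Implicit Defensive.

(* For a vertex [w], removing [r] and [w] turns systems of internally disjoint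
   [(r,w)]-paths into linkages: disjoint paths from out-neighbours of [r] to
   in-neighbours of [w].  First [F] (together with all edges at the root) is
   extended to a maximal [L] between [F] and [E] such that every finite set of
   in-edges of [w] can be added to the in-edges of [F] by changing only finitely
   many paths of a fixed linkage.  By maximality an edge missing from [L] is
   blocked by a cut orthogonal to such a linkage, and uncrossing these cuts shows
   that Menger cuts of [L] are cuts of [E].

   The vertices are then frozen one at a time.  To freeze [v], delete in-edges of
   [v] so that the remaining ones are linked while the finite linkability at the
   vertices not yet frozen survives: constraints that can be met by infinitely
   many in-edges are met one by one, the others by a minimal hitting set, whose
   elements are separated by nested cuts that can be merged.  By the
   Erdos-Menger theorem (proved with waves, as for countable graphs) and the
   linkage theorem of Pym, the linkage at [v] can be chosen orthogonal to a cut
   of [E].  The intersection of all stages is the required flame. *)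

(** The obstacle is that the union of an increasing sequence of linked sets of in-edges need not be
    linked, so linked sets cannot be enlarged by Zorn's lemma directly. Finite linkability does pass
    to unions; freezing turns it into true linkages afterwards. The linkages are infinite, so ranks
    cannot be compared by cardinality. Measuring against a fixed linkage and allowing only finitely
    many changes restores counting: a cut orthogonal to the fixed linkage, enlarged by [k] vertices,
    leaves room for at most [k] additional endpoints.

    Deleting in-edges of [v] may harm another vertex [w], because linkages at [w] can pass through
    [v]. Disjoint paths use [v] at most once, so each finite constraint at [w] is kept alive by a
    single edge into [v]; this makes the choice of edges a hitting set problem. The cuts must
    separate in [E] although only the smaller [L] is under control. The finite lists that block
    missing edges serve this purpose, since blocking persists when edges elsewhere are deleted. *)

Lemma zorn_above (T : Type) (R : T -> T -> Prop) (t0 : T) :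
  (forall t, R t t) -> (forall r s t, R r s -> R s t -> R r t) ->
  (forall A : T -> Prop, (exists a, A a) ->
     (forall s t, A s -> A t -> R s t \/ R t s) ->
     exists t, forall s, A s -> R s t) ->
  exists t, R t0 t /\ forall s, R t s -> R s t.
Proof.
move=> Rxx Rtr chain.
pose T' := {t | R t0 t}; pose R' (s t : T') := `[< R (sval s) (sval t) >].
have [||A tot|[t t0t] tmax] := @ZL_preorder T' (exist _ t0 (Rxx t0)) R'.
- by move=> t; apply/asboolP.
- by move=> r s t /asboolP rs /asboolP st; apply/asboolP; apply: Rtr rs st.
- have [[a Aa]|noA] := pselect (exists a, A a); last first.
    by exists (exist _ t0 (Rxx t0)) => s As; case: noA; exists s.
  have [||t ub] := chain (fun t => exists2 s, A s & sval s = t).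
  + by exists (sval a), a.
  + move=> _ _ [s As <-] [t At <-].
    by have [/asboolP|/asboolP] := tot s t As At; [left|right].
  + have t0t : R t0 t by apply: Rtr (svalP a) (ub _ _); exists a.
    by exists (exist _ t t0t) => s As; apply/asboolP; apply: ub; exists s.
- exists t; split=> // s ts; have t0s := Rtr _ _ _ t0t ts.
  by have /asboolP := tmax (exist _ s t0s) (introT (asboolP _) ts).
Qed.

(** * Lists, and a pigeonhole principle for relations *)

Section Lists.
Variable V : eqType.
Implicit Types (x y z : V) (l s : seq V) (P : V -> Prop).

Lemma split_first P l : (exists2 z, z \in l & P z) ->
  exists s1 z s2, [/\ l = s1 ++ z :: s2, P z & forall y, y \in s1 -> ~ P y].
Proof.
elim: l => [|a l IH] [z]; first by rewrite in_nil.
rewrite inE => zal Pz; have [Pa|nPa] := pselect (P a).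
  by exists [::], a, l; split.
have [|s1 [y [s2 [-> Py s1P]]]] := IH.
  by case/orP: zal => [/eqP za|zl]; [case: nPa; rewrite -za|exists z].
exists (a :: s1), y, s2; split=> // t; rewrite inE => /orP[/eqP -> //|]; exact: s1P.
Qed.

Lemma split_last P l : (exists2 z, z \in l & P z) ->
  exists s1 z s2, [/\ l = s1 ++ z :: s2, P z & forall y, y \in s2 -> ~ P y].
Proof.
move=> [z zl Pz]; have [|s1 [y [s2 [def Py s1P]]]] := @split_first P (rev l).
  by exists z; rewrite // mem_rev.
exists (rev s2), y, (rev s1); split=> //.
  by rewrite -[l]revK def rev_cat rev_cons cat_rcons.
by move=> t; rewrite mem_rev; apply: s1P.
Qed.

Lemma in_split x l : x \in l -> exists l1 l2, l = l1 ++ x :: l2.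
Proof. by case/splitPr=> l1 l2; exists l1, l2. Qed.

(** Paths are listed backwards, so the last entry is the starting vertex; [None] arises for the
    empty list only. *)
Definition src l : option V := last None [seq Some z | z <- l].

Lemma src_cat s z l : src (s ++ z :: l) = src (z :: l).
Proof. by rewrite /src map_cat last_cat. Qed.

Lemma src_cons2 y z l : src (y :: z :: l) = src (z :: l).
Proof. by []. Qed.

Lemma src_rcons s z : src (rcons s z) = Some z.
Proof. by rewrite -cats1 src_cat. Qed.

Lemma src_mem l z : src l = Some z -> z \in l.
Proof.
by case/lastP: l => // s y; rewrite src_rcons => -[->]; rewrite mem_rcons inE eqxx.
Qed.

Lemma src_some y l : exists z, src (y :: l) = Some z.
Proof. by elim: l y => [|z l IH] y; [exists y|apply: IH]. Qed.

Lemma src_neq s l : l != [::] -> src (s ++ l) = src l.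
Proof. by case: l => // z l _; apply: src_cat. Qed.

(** An entry of [t] related to the first element of [l] serves no other element, so it can be
    removed from [t] and induction applies. Working with a relation avoids choosing a matching. *)
Lemma size_le_matching (T : eqType) (l : seq V) (f : V -> T -> Prop) (t : seq T) :
  uniq l -> (forall y, y \in l -> exists2 k, k \in t & f y k) ->
  (forall y y' k, y \in l -> y' \in l -> f y k -> f y' k -> y = y') ->
  size l <= size t.
Proof.
elim: l t => // a l IH t /= /andP[al ul] lt fi.
have [k kt fak] := lt a (mem_head _ _).
suff: size l <= size (rem k t).
  by rewrite size_rem // => le; apply: leq_ltn_trans le _; case: (t) kt.
apply: IH => //.
  move=> y yl; have [|k' k't fk'] := lt y _; first by rewrite inE yl orbT.
  exists k' => //; have [kk'|kk'] := eqVneq k' k; last first.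
    by move: k't; rewrite (perm_mem (perm_to_rem kt)) inE (negPf kk').
  case/negP: al; rewrite -(fi y a k) ?mem_head // ?inE ?yl ?orbT // -kk' //.
by move=> y y' w yl y'l; apply: fi; rewrite inE ?yl ?y'l orbT.
Qed.

End Lists.

(** * Backward walks, cuts and linkages *)

Section Graph.
Variable V : eqType.
Implicit Types (x y z : V) (l s : seq V) (e : V -> V -> Prop).
Implicit Types (A B I T U X Y : V -> Prop).

(* Paths are listed backwards: the head is the endpoint, the last element is
   the starting vertex in [A].  Families of paths are indexed by their endpoints
   ([linkage]) or by an arbitrary type ([fam]). *)
Fixpoint bw e A l : Prop :=
  match l with
  | [::] => False
  | y :: t => match t with [::] => A y | x :: _ => e x y /\ bw e A t end
  end.

Lemma bw_suffix e A s z l : bw e A (s ++ z :: l) -> bw e A (z :: l).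
Proof. by elim: s => // a s IH; case: s IH => [|b s] IH /= [_] // /IH. Qed.

Lemma bw_swap e A A' s z l l' :
  bw e A (s ++ z :: l) -> bw e A' (z :: l') -> bw e A' (s ++ z :: l').
Proof.
by elim: s => // a s IH; case: s IH => [|b s] IH /= [eab h] h'; split=> //; apply: IH.
Qed.

Lemma bw_mono e e' A A' l :
  (forall x y, x \in l -> y \in l -> e x y -> e' x y) ->
  (forall x, x \in l -> A x -> A' x) -> bw e A l -> bw e' A' l.
Proof.
elim: l => // y [|x t] IH ee AA /=; first by apply: AA; rewrite mem_head.
move=> [exy h]; split; first by apply: ee; rewrite ?inE ?eqxx ?orbT.
by apply: IH => // [a b al bl|a al]; [apply: ee|apply: AA]; rewrite inE ?al ?bl orbT.
Qed.

Lemma bw_rcons e A s z : bw e A (rcons s z) -> A z.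
Proof. by rewrite -cats1 => /bw_suffix. Qed.

Lemma bw_src e A l : bw e A l -> exists2 a, src l = Some a & A a.
Proof.
case/lastP: l => // s z /bw_rcons Az; exists z => //; exact: src_rcons.
Qed.

Lemma bw_from_src e A l a : bw e A l -> src l = Some a -> bw e (eq a) l.
Proof.
elim: l => // y [|x t] IH; first by move=> _ [].
by rewrite src_cons2 => -[exy h] sl; split=> //; apply: IH.
Qed.

Lemma bw_eq e A a l : bw e (eq a) l -> A a -> bw e A l.
Proof. by move=> h Aa; apply: bw_mono h => // x _ <-. Qed.

Lemma bw_eq_src e a l : bw e (eq a) l -> src l = Some a.
Proof. by move/bw_src => [b -> <-]. Qed.

Lemma bw_edge_in e A y l z : bw e A (y :: l) -> z \in y :: l ->
  A z \/ exists x, x \in l /\ e x z.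
Proof.
elim: l y => [|x t IH] y; first by move=> Ay; rewrite inE => /eqP ->; left.
case=> exy h; rewrite inE => /orP[/eqP ->|zt].
  by right; exists x; rewrite mem_head.
by have [|[w [wt ewz]]] := IH _ h zt; [left|right; exists w; rewrite inE wt orbT].
Qed.

Lemma bw_edge_out e A y l z : bw e A (y :: l) -> z \in l ->
  exists w, w \in y :: l /\ e z w.
Proof.
elim: l y => [|x t IH] y //= [exy h]; rewrite inE => /orP[/eqP ->|zt].
  by exists y; rewrite mem_head.
by have [w [wt ezw]] := IH _ h zt; exists w; rewrite inE wt orbT.
Qed.

Lemma bw_uniq e A y l : bw e A (y :: l) ->
  exists l', [/\ bw e A (y :: l'), uniq (y :: l') & {subset y :: l' <= y :: l}].
Proof.
elim: l y => [|x t IH] y; first by move=> Ay; exists [::]; split.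
case=> exy /IH [t' [bt ut st]].
have [yt|yt] := boolP (y \in x :: t').
  have [s1 [s2 def]] := in_split yt.
  exists s2; split.
  - by rewrite def in bt; apply: bw_suffix bt.
  - by move: ut; rewrite def cat_uniq => /and3P[].
  - move=> z; rewrite inE => /orP[/eqP ->|zs]; first exact: mem_head.
    by rewrite inE st ?orbT // def mem_cat inE zs !orbT.
exists (x :: t'); split=> //; first by rewrite /= -/(uniq (x :: t')) yt.
by move=> z; rewrite inE => /orP[/eqP ->|/st zt]; rewrite inE ?eqxx // zt orbT.
Qed.

Definition hd y l := exists t, l = y :: t.

Lemma hd_mem y l : hd y l -> y \in l. Proof. by case=> t ->; rewrite mem_head. Qed.

Lemma bw_rcons_edge e x b l : bw e (eq x) l -> e b x -> bw e (eq b) (rcons l b).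
Proof.
move=> + ebx; elim: l => // y [|z t] IH; first by move=> /= <-; split.
by move=> [ezy h]; split=> //; apply: IH.
Qed.

Lemma bw_rev e a b l : bw (fun x y => e y x) (eq a) (b :: l) ->
  hd a (rev (b :: l)) /\ bw e (eq b) (rev (b :: l)).
Proof.
elim: l b => [|x t IH] b; first by move=> /= ->; split; [exists [::]|].
case=> ebx /IH [[l' def] h]; rewrite rev_cons; split.
  by rewrite def; exists (rcons l' b).
exact: bw_rcons_edge h ebx.
Qed.

(** [I] is the side of the sources and [T] the boundary: a walk from [A] leaves [I] only through
    [T]. The sources themselves may lie on the boundary. *)
Definition cut e A I T :=
  [/\ forall a, A a -> I a \/ T a,
      forall x y, I x -> e x y -> I y \/ T y
    & forall x, I x -> ~ T x].

Lemma cut_cross e A I T y l : cut e A I T -> bw e A (y :: l) -> ~ I y ->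
  exists2 t, t \in y :: l & T t.
Proof.
move=> [cA ce _]; elim: l y => [|x t IH] y.
  by move=> /= /cA [|Ty] // _; exists y; rewrite ?mem_head.
case=> exy h nIy; have [Ix|nIx] := pselect (I x); last first.
  by have [z zt Tz] := IH _ h nIx; exists z; rewrite // inE zt orbT.
by have [|Ty] := ce _ _ Ix exy => //; exists y; rewrite ?mem_head.
Qed.

Lemma cut_avoid e A I T y l : cut e A I T -> bw e A (y :: l) ->
  (forall z, z \in y :: l -> ~ T z) -> forall z, z \in y :: l -> I z.
Proof.
move=> ct h nT z zl; apply: contrapT => nIz.
have [s1 [s2 def]] := in_split zl.
have [t tl Tt] := cut_cross ct (bw_suffix (eq_ind _ (bw e A) h _ def)) nIz.
by apply: (nT t) => //; rewrite def mem_cat tl orbT.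
Qed.

Definition reach e A T x := exists l, bw e A (x :: l) /\ forall z, z \in x :: l -> ~ T z.

Lemma reach_cut e A T : cut e A (reach e A T) T.
Proof.
split=> [a Aa|x y [l [h nT]] exy|x [l [_ nT]]].
- have [|nTa] := pselect (T a); [by right|left; exists [::]; split=> //].
  by move=> z; rewrite inE => /eqP ->.
- have [|nTy] := pselect (T y); [by right|left; exists (x :: l); split=> //].
  by move=> z; rewrite inE => /orP[/eqP ->|/nT].
- by apply: nT; rewrite mem_head.
Qed.

Definition fam e A (K : Type) (Y : K -> Prop) (p : K -> seq V) :=
  [/\ forall y : K, Y y -> bw e A (p y),
      forall y : K, Y y -> uniq (p y)
    & forall (y y' : K) z, Y y -> Y y' -> z \in p y -> z \in p y' -> y = y'].

Definition linkage e A Y p := fam e A Y p /\ forall y, Y y -> hd y (p y).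

(** This is stronger than meeting [T] exactly once: read from its start, a path stays in [I],
    crosses [T] in one vertex and never returns to [I] or [T]. *)
Definition orth I T Y (p : V -> seq V) :=
  (forall y, Y y -> exists s1 t s2, [/\ p y = s1 ++ t :: s2, T t,
      forall z, z \in s1 -> ~ I z /\ ~ T z & forall z, z \in s2 -> I z]) /\
  (forall t, T t -> exists2 y, Y y & t \in p y).

Lemma linkage_sub e A Y Y' p : (forall y, Y' y -> Y y) -> linkage e A Y p -> linkage e A Y' p.
Proof.
move=> YY [[pb pu pd] ph]; split; last by move=> y /YY; apply: ph.
by split=> [y /YY|y /YY|y y' z /YY + /YY]; [apply: pb|apply: pu|apply: pd].
Qed.

Lemma linkage_mono e e' A A' Y p :
  (forall y, Y y -> forall x z, x \in p y -> z \in p y -> e x z -> e' x z) ->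
  (forall y, Y y -> forall x, x \in p y -> A x -> A' x) ->
  linkage e A Y p -> linkage e' A' Y p.
Proof.
move=> ee AA [[pb pu pd] ph]; split=> //; split=> // y Yy.
by apply: bw_mono (pb _ Yy) => [x z|x]; [apply: ee|apply: AA].
Qed.

Lemma linkage_mem e A Y p y : linkage e A Y p -> Y y -> y \in p y.
Proof. by move=> [_ ph] /ph /hd_mem. Qed.

(** A cut of the graph without edges and sources is just a pair of disjoint sets; the hypothesis is
    put this way to be free of [e] and [A], and [cut_disj] supplies it. *)
Lemma orth_inj I T Y p y t t' : cut (fun _ _ => False) (fun _ => False) I T ->
  orth I T Y p -> Y y -> t \in p y -> t' \in p y -> T t -> T t' -> t = t'.
Proof.
move=> [_ _ IT] [op _] /op [s1 [u [s2 [-> Tu o1 o2]]]].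
have uT w : w \in s1 ++ u :: s2 -> T w -> w = u.
  by rewrite mem_cat inE => /or3P[/o1[]|/eqP|/o2/IT].
by move=> tl t'l Tt Tt'; rewrite (uT _ tl Tt) (uT _ t'l Tt').
Qed.

Lemma orth_end I T Y p y : cut (fun _ _ => False) (fun _ => False) I T ->
  orth I T Y p -> Y y -> hd y (p y) -> ~ I y.
Proof.
move=> [_ _ IT] [op _] /op [[|a s1] [u [s2 [-> Tu o1 o2]]]] [t] [<- _].
  by move/IT.
by case: (o1 a (mem_head _ _)).
Qed.

Lemma cut_disj e A I T : cut e A I T -> cut (fun _ _ => False) (fun _ => False) I T.
Proof. by case. Qed.

End Graph.

(** * Exchanging and rerouting in families of disjoint paths *)

Section Families.
Variable V : eqType.
Implicit Types (x y z : V) (l s : seq V) (e : V -> V -> Prop).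
Implicit Types (A B I T U X Y : V -> Prop).

Definition upd (S : Type) (f : V -> S) x (a : S) : V -> S :=
  fun z => if z == x then a else f z.

Lemma updE (S : Type) (f : V -> S) x (a : S) : upd f x a x = a.
Proof. by rewrite /upd eqxx. Qed.

Lemma updN (S : Type) (f : V -> S) x (a : S) z : z <> x -> upd f x a z = f z.
Proof. by rewrite /upd; case: eqP. Qed.

Lemma uniq_cat_notin s l z : uniq (s ++ l) -> z \in s -> z \in l -> False.
Proof. by rewrite cat_uniq => /and3P[_ /hasPn h _] zs /h; rewrite zs. Qed.

Lemma fam_add e A Y q x l : fam e A Y q -> bw e A l -> uniq l ->
  (forall y, Y y -> forall z, z \in l -> z \notin q y) -> ~ Y x ->
  fam e A (fun z => z = x \/ Y z) (upd q x l).
Proof.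
move=> [qb qu qd] lb lu lq nYx.
have yx y : Y y -> y <> x by move=> Yy yx; case: nYx; rewrite -yx.
split=> [y|y|y y' z].
- by case=> [->|Yy]; [rewrite updE|rewrite updN; [apply: qb|apply: yx]].
- by case=> [->|Yy]; [rewrite updE|rewrite updN; [apply: qu|apply: yx]].
- case=> [->|Yy]; case=> [->|Yy'] //; rewrite ?updE ?(updN _ _ (yx _ Yy)) ?(updN _ _ (yx _ Yy')).
  + by move=> zl /(negP (lq _ Yy' _ zl)).
  + by move=> zq zl; case/negP: (lq _ Yy _ zl).
  + exact: qd.
Qed.

(** The path given up by [y0] is disjoint from the new family, so it remains available for another
    endpoint. *)
Lemma fam_swap e A Y q y0 l : fam e A Y q -> bw e A l -> uniq l ->
  (forall y, Y y -> forall z, z \in l -> z \notin q y) -> Y y0 ->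
  fam e A Y (upd q y0 l) /\ forall y, Y y -> forall z, z \in q y0 -> z \notin upd q y0 l y.
Proof.
move=> [qb qu qd] lb lu lq Y0; split; first split=> [y|y|y y' z] Yy.
- by have [->|/eqP n] := eqVneq y y0; [rewrite updE|rewrite updN //; apply: qb].
- by have [->|/eqP n] := eqVneq y y0; [rewrite updE|rewrite updN //; apply: qu].
- move=> Yy'; have [->|/eqP n] := eqVneq y y0; have [->|/eqP n'] := eqVneq y' y0;
    rewrite ?updE ?(updN _ _ n) ?(updN _ _ n') //.
  + by move=> zl /(negP (lq _ Yy' _ zl)).
  + by move=> zq zl; case/negP: (lq _ Yy _ zl).
  + exact: qd.
move=> y Yy z zq; have [->|/eqP n] := eqVneq y y0; rewrite ?updE ?updN //.
  by apply/negP => zl; move: (lq _ Y0 _ zl); rewrite zq.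
by apply/negP => zy; apply: n; apply: qd zy zq.
Qed.

(** The end pieces [g y] lie in [B], and a path [Q y'] can meet [B] in its head only. That head is
    the vertex of [p y'] next to [g y'], so it lies on no [g y] because the paths of [p] are
    disjoint and repetition-free. *)
Lemma fam_reroute e A A' Y (p Q g : V -> seq V) B : fam e A' Y p -> fam e A Y Q ->
  (forall y, Y y -> exists h t t', [/\ p y = g y ++ h :: t, Q y = h :: t',
     forall z, z \in g y -> B z & forall z, z \in t' -> ~ B z]) ->
  fam e A Y (fun y => g y ++ Q y).
Proof.
move=> [pb pu pd] [Qb Qu Qd] fr.
have gp y z : Y y -> z \in g y -> z \in p y.
  by move=> Yy zg; have [h [t [t' [-> _ _ _]]]] := fr _ Yy; rewrite mem_cat zg.
have gQ y y' z : Y y -> Y y' -> z \in g y -> z \in Q y' -> False.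
  move=> Yy Yy' zg zQ; have [h [t [t' [pE QE gB tB]]]] := fr _ Yy'.
  have [h1 [t1 [t1' [pE1 QE1 gB1 tB1]]]] := fr _ Yy.
  move: zQ; rewrite QE inE => /orP[/eqP zh|/tB]; last by apply; apply: gB1.
  have yy : y = y'.
    by apply: (pd _ _ z Yy Yy' (gp _ _ Yy zg)); rewrite pE zh mem_cat mem_head orbT.
  move: (pu _ Yy'); rewrite pE => /uniq_cat_notin; apply; first by rewrite -yy; exact: zg.
  by rewrite zh mem_head.
split=> [y Yy|y Yy|y y' z Yy Yy'].
- have [h [t [t' [pE QE _ _]]]] := fr _ Yy.
  have := pb _ Yy; have := Qb _ Yy; rewrite pE QE => bQ bp; exact: bw_swap bp bQ.
- rewrite cat_uniq Qu // andbT; apply/andP; split.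
    by have [h [t [t' [pE _ _ _]]]] := fr _ Yy; move: (pu _ Yy); rewrite pE cat_uniq => /andP[].
  by apply/hasPn => z zQ; apply/negP => zg; apply: gQ zg zQ.
- rewrite !mem_cat => /orP[zg|zQ] /orP[zg'|zQ'].
  + by apply: (pd _ _ z) => //; apply: gp.
  + by case: (gQ _ _ _ Yy Yy' zg zQ').
  + by case: (gQ _ _ _ Yy' Yy zg' zQ).
  + by apply: Qd zQ zQ'.
Qed.

Lemma fam_suffix e A Y (p g k : V -> seq V) : fam e A Y p ->
  (forall y, Y y -> p y = g y ++ k y /\ k y != [::]) -> fam e A Y k.
Proof.
move=> [pb pu pd] gk; split=> [y Yy|y Yy|y y' z Yy Yy' zk zk'].
- have [pE] := gk _ Yy; move: (pb _ Yy); rewrite pE; by case: (k y) => // a l /bw_suffix.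
- by have [pE _] := gk _ Yy; move: (pu _ Yy); rewrite pE cat_uniq => /and3P[].
- have [pE _] := gk _ Yy; have [pE' _] := gk _ Yy'.
  by apply: (pd _ _ z) => //; rewrite ?pE ?pE' mem_cat ?zk ?zk' orbT.
Qed.

End Families.

(** * Augmenting a linkage *)

Section Augment.
Variable V : eqType.
Variables (e : V -> V -> Prop) (A Y X : V -> Prop) (p : V -> seq V).
Hypotheses (lp : linkage e A Y p) (XY : forall x, X x -> ~ Y x).
Implicit Types (x y z b : V) (l lb s : seq V) (B : V -> Prop) (g k Q : V -> seq V).

(** The list [s] keeps the change of [p] finite; both the limit argument in [chain_state] and all
    later counting rest on this. The starts are recorded because hindrances are defined through
    missed start vertices. *)
Definition augmented Q lb := exists x q' s,
  [/\ X x, linkage e A (fun z => z = x \/ Y z) q',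
      forall y, Y y -> y \notin s -> q' y = p y
    & forall y, y = x \/ Y y -> src (q' y) = src lb \/ exists2 y', Y y' & src (q' y) = src (Q y')].

Definition completable B k := forall Q lb b tb s,
  fam e A Y Q -> bw e A lb -> uniq lb ->
  (forall y, Y y -> forall z, z \in lb -> z \notin Q y) ->
  lb = b :: tb -> B b -> (forall z, z \in tb -> ~ B z) ->
  (forall y, Y y -> exists h t t', [/\ k y = h :: t, Q y = h :: t' & forall z, z \in t' -> ~ B z]) ->
  (forall y, Y y -> y \notin s -> Q y = k y) -> augmented Q lb.

(* Each path [p y] is cut as [g y ++ k y]; a path from [A] to a new vertex of
   [B], together with any paths ending like the [k y], can be completed to an
   augmentation because the completing pieces stay inside [B]. *)
Definition valid (st : (V -> Prop) * (V -> seq V) * (V -> seq V)) :=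
  let: (B, g, k) := st in
  [/\ forall y, Y y -> p y = g y ++ k y,
      forall y, Y y -> exists h t, [/\ k y = h :: t, B h & forall z, z \in t -> ~ B z],
      forall y, Y y -> forall z, z \in g y -> B z,
      forall x, X x -> B x
    & completable B k].

(** Each path is cut at its first vertex in [X], seen from its start, or at its end if it avoids
    [X]. A new path that arrives on the detached piece of [p y0] takes over the way to [y0], and the
    old path, stopped in [X], becomes the additional one. *)
Lemma initial_state : exists st, valid st.
Proof.
have [[pb pu pd] ph] := lp.
have /choice[gk gkP] y : exists gk : seq V * seq V, Y y ->
    p y = gk.1 ++ gk.2 /\ exists h t, [/\ gk.2 = h :: t, X h \/ h = y & forall z, z \in t -> ~ X z].
  have [Yy|] := pselect (Y y); last by exists ([::], [::]).
  have [|s1 [h [s2 [pE Ph nP]]]] := @split_last _ (fun z => X z \/ z = y) (p y).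
    by exists y; [apply: hd_mem; apply: ph|right].
  exists (s1, h :: s2) => _; split=> //; exists h, s2; split=> // z /nP nPz Xz.
  by apply: nPz; left.
pose g y := (gk y).1; pose k y := (gk y).2.
pose B z := X z \/ exists y, [/\ Y y, z \in p y & z \notin k y \/ hd z (k y)].
have gkE y : Y y -> p y = g y ++ k y by move/gkP => [].
have kh y : Y y -> exists h t, [/\ k y = h :: t, X h \/ h = y & forall z, z \in t -> ~ X z].
  by move/gkP => [].
have kn y : Y y -> p y = g y ++ k y /\ k y != [::].
  by move=> Yy; rewrite gkE //; have [h [t [-> _ _]]] := kh _ Yy.
have gin y z : Y y -> z \in g y -> z \in p y by move=> Yy zg; rewrite gkE // mem_cat zg.
have kin y z : Y y -> z \in k y -> z \in p y by move=> Yy zg; rewrite gkE // mem_cat zg orbT.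
have gkN y z : Y y -> z \in g y -> z \in k y -> False.
  by move=> Yy; apply: uniq_cat_notin; rewrite -gkE //; apply: pu.
have gB y : Y y -> forall z, z \in g y -> B z.
  move=> Yy z zg; right; exists y; split=> //; first exact: gin.
  by left; apply/negP; apply: gkN zg.
have tB y h t z : Y y -> k y = h :: t -> z \in t -> ~ B z.
  move=> Yy kE zt; have [h' [t' [kE' _ nX]]] := kh _ Yy.
  have [? ?] : h = h' /\ t = t' by move: kE'; rewrite kE => -[].
  subst h' t'; case=> [/(nX _ zt) //|[y' [Yy' zp' zk]]].
  have ? : y = y' by apply: (pd _ _ z) => //; apply: kin => //; rewrite kE inE zt orbT.
  subst y'; case: zk; first by rewrite kE inE zt orbT.
  rewrite kE => -[t' [hz _]]; have := pu _ Yy; rewrite gkE // kE cat_uniq => /and3P[_ _] /=.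
  by rewrite hz zt.
have hB y h t : Y y -> k y = h :: t -> B h.
  move=> Yy kE; right; exists y; split=> //; last by right; exists t.
  by apply: kin => //; rewrite kE mem_head.
exists (B, g, k); split=> //.
- move=> y Yy; have [h [t [kE _ _]]] := kh _ Yy; exists h, t; split=> //.
    exact: hB kE.
  by move=> z; apply: tB kE.
- by move=> x; left.
move=> Q lb b tb s fQ lbb lbu lbQ lbE Bb tbB kQ Qs.
have [Qb Qu Qd] := fQ.
have Qn y : Y y -> Q y != [::] by move=> /kQ [h [t [t' [_ -> _]]]].
have [[y0 [Y0 b0]]|nb] := pselect (exists y, Y y /\ b \in p y); last first.
  have Xb : X b by case: Bb => // -[y [Yy bp _]]; case: nb; exists y.
  have fr : fam e A Y (fun y => g y ++ Q y).
    apply: (fam_reroute (B := B) (And3 pb pu pd) fQ) => y Yy.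
    by have [h [t [t' [kE QE tB']]]] := kQ _ Yy; exists h, t, t'; rewrite gkE // kE; split=> //; apply: gB.
  have ybn y : Y y -> y <> b by move=> Yy yb; apply: (XY Xb); rewrite -yb.
  exists b, (upd (fun y => g y ++ Q y) b lb), s; split=> //.
  + split; last first.
      move=> y [->|Yy]; first by rewrite updE lbE; exists tb.
      rewrite updN; last exact: ybn.
      have [h [t [t' [kE QE _]]]] := kQ _ Yy; have [t0 pE] := ph _ Yy.
      rewrite QE; move: pE; rewrite gkE // kE.
      by case: (g y) => [|a gy] /= [-> _]; [exists t'|exists (gy ++ h :: t')].
    apply: fam_add => //; last exact: XY.
    move=> y Yy z zl; rewrite mem_cat negb_or lbQ // andbT; apply/negP => zg.
    move: zl; rewrite lbE inE => /orP[/eqP zb|/tbB]; last by apply; apply: gB zg.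
    by apply: nb; exists y; split=> //; rewrite -zb; apply: gin.
  + move=> y Yy ys; rewrite updN; last exact: ybn.
    by rewrite Qs // gkE.
  + move=> y [->|Yy]; first by left; rewrite updE.
    by right; exists y => //; rewrite updN ?src_neq ?Qn //; exact: ybn.
have [h0 [t0 [t0' [k0E Q0E t0B]]]] := kQ _ Y0.
have bg : b \in g y0.
  move: b0; rewrite gkE // mem_cat => /orP[] //; rewrite k0E inE => /orP[/eqP bh|/(tB _ _ _ _ Y0 k0E) //].
  by move: (lbQ _ Y0 b); rewrite lbE mem_head Q0E bh mem_head => /(_ isT).
have [u1 [u2 gE]] := in_split bg.
(* The detached piece of [p y0] contains [b], so [h0] is not the end [y0] and must belong to [X]. *)
have Xh0 : X h0.
  have [h [t [kE Xh _]]] := kh _ Y0; have ? : h = h0 by move: k0E; rewrite kE => -[].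
  subst h; case: Xh => // hy; have [t1 pE] := ph _ Y0.
  have yg : y0 \in g y0.
    by move: pE; rewrite gkE // gE; case: (u1) => [|a u] [-> _]; rewrite mem_head.
  by case: (gkN _ _ Y0 yg); rewrite -{1}hy k0E mem_head.
have [fs sQ] := fam_swap fQ lbb lbu lbQ Y0.
pose g' := upd g y0 u1; pose Q' := upd Q y0 lb.
have ynh y : Y y -> y <> h0 by move=> Yy yh; apply: (XY Xh0); rewrite -yh.
have Q'n y : Y y -> Q' y != [::].
  by move=> Yy; rewrite /Q'; have [->|/eqP n] := eqVneq y y0; rewrite ?updE ?lbE // updN // Qn.
have frm y : Y y -> exists h t t', [/\ p y = g' y ++ h :: t, Q' y = h :: t',
     forall z, z \in g' y -> B z & forall z, z \in t' -> ~ B z].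
  move=> Yy; rewrite /g' /Q'; have [->|/eqP n] := eqVneq y y0.
    rewrite !updE; exists b, (u2 ++ k y0), tb; rewrite gkE // gE -catA; split=> //.
    by move=> z zu; apply: (gB _ Y0); rewrite gE mem_cat zu.
  rewrite !updN //; have [h [t [t' [kE QE tB']]]] := kQ _ Yy.
  by exists h, t, t'; rewrite gkE // kE; split=> //; apply: gB.
have fr : fam e A Y (fun y => g' y ++ Q' y) by apply: (fam_reroute (B := B) (And3 pb pu pd) fs frm).
exists h0, (upd (fun y => g' y ++ Q' y) h0 (Q y0)), (y0 :: s); split=> //.
- split; last first.
    move=> y [->|Yy]; first by rewrite updE Q0E; exists t0'.
    rewrite updN; last exact: ynh.
    have [h [t [t' [pE QE _ _]]]] := frm _ Yy; have [t1 pE1] := ph _ Yy.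
    rewrite QE; move: pE1; rewrite pE.
    by case: (g' y) => [|a gy] /= [-> _]; [exists t'|exists (gy ++ h :: t')].
  apply: fam_add => //; [exact: Qb|exact: Qu| |exact: XY].
  move=> y Yy z zl; rewrite mem_cat negb_or (sQ _ Yy _ zl) andbT; apply/negP => zg.
  have [h [t [t' [pE QE gB' _]]]] := frm _ Yy.
  move: zl; rewrite Q0E inE => /orP[/eqP zh|/t0B]; last by apply; apply: gB' zg.
  have zp : z \in p y by rewrite pE mem_cat zg.
  have zp0 : z \in p y0 by apply: kin => //; rewrite k0E zh mem_head.
  have ? := pd _ _ _ Yy Y0 zp zp0; subst y.
  apply: (gkN y0 z) => //; last by rewrite k0E zh mem_head.
  by move: zg; rewrite /g' updE gE mem_cat => ->.
- move=> y Yy; rewrite inE negb_or => /andP[/eqP n ys]; rewrite updN; last exact: ynh.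
  by rewrite /g' /Q' !updN // Qs // gkE.
- move=> y [->|Yy]; first by right; exists y0; rewrite // updE.
  rewrite updN; last exact: ynh.
  rewrite src_neq ?Q'n // /Q'; have [->|/eqP n] := eqVneq y y0; rewrite ?updE; first by left.
  by rewrite updN //; right; exists y.
Qed.

Definition le_state (st st' : (V -> Prop) * (V -> seq V) * (V -> seq V)) :=
  (forall z, st.1.1 z -> st'.1.1 z) /\
  forall y, Y y -> exists d, st.2 y = d ++ st'.2 y.

Lemma augmented_src Q lb Q2 lb2 : augmented Q2 lb2 ->
  (src lb2 = src lb \/ exists2 y', Y y' & src lb2 = src (Q y')) ->
  (forall y, Y y -> src (Q2 y) = src lb \/ exists2 y', Y y' & src (Q2 y) = src (Q y')) ->
  augmented Q lb.
Proof.
move=> [x [q' [s' [Xx lq' fq' sq']]]] h1 h2; exists x, q', s'; split=> // y /sq'.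
by case=> [->|[y' Yy' ->]] //; apply: h2.
Qed.

(** The walk is shortened to its first vertex [b'] in [B]. If it meets no kept piece before [b'],
    the state completes it. Otherwise let [x'] be the last vertex before [b'] on a kept piece
    [k y0]: that piece is cut at [x'], and both the stretch [u] of [k y0] beyond [x'] and the
    stretch [s3] of the walk from [x'] to [b'] are added to [B]. The shortened piece shows that the
    state has grown strictly. *)
Lemma step_state B g k b l : valid (B, g, k) -> bw e A (b :: l) -> uniq (b :: l) -> B b ->
  (forall y h, Y y -> hd h (k y) -> h \notin b :: l) ->
  (exists Q lb, augmented Q lb /\ forall y, Y y -> Q y = k y) \/
  exists st, [/\ valid st, le_state (B, g, k) st & exists2 y, Y y & size (st.2 y) < size (k y)].
Proof.
move=> [pE kh gB XB compl] bl ul Bb nh.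
have [[pb pu pd] ph] := lp.
have kn y : Y y -> p y = g y ++ k y /\ k y != [::].
  by move=> Yy; split; [exact: pE|have [h [t [-> _ _]]] := kh _ Yy].
have fk : fam e A Y k := fam_suffix (And3 pb pu pd) kn.
have [kb ku kd] := fk.
have [|r1 [b' [s2 [lE Bb' s2B]]]] := @split_last _ B (b :: l); first by exists b; rewrite ?mem_head.
have {b l Bb bl ul nh lE} [bl ul nh] : [/\ bw e A (b' :: s2), uniq (b' :: s2)
    & forall y h, Y y -> hd h (k y) -> h \notin b' :: s2].
  split; first by rewrite lE in bl; apply: bw_suffix bl.
    by move: ul; rewrite lE cat_uniq => /and3P[].
  by move=> y h Yy hk; move: (nh _ _ Yy hk); rewrite lE mem_cat negb_or => /andP[].
have b'k y : Y y -> b' \notin k y.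
  move=> Yy; have [h [t [kE Bh tB]]] := kh _ Yy; apply/negP; rewrite kE inE => /orP[/eqP bh|/tB //].
  have/(nh _ _ Yy) : hd b' (k y) by rewrite kE bh; exists t.
  by rewrite mem_head.
have [[x' x's [y0 Y0 x'k]]|dis] := pselect (exists2 z, z \in s2 & exists2 y, Y y & z \in k y); last first.
  left; exists k, (b' :: s2); split=> //; apply: (compl k _ b' s2 [::]) => //.
    move=> y Yy z; rewrite inE => /orP[/eqP -> |zs]; first exact: b'k.
    by apply/negP => zk; apply: dis; exists z => //; exists y.
  by move=> y Yy; have [h [t [kE Bh tB]]] := kh _ Yy; exists h, t, t.
right.
have /split_first ex : exists2 z, z \in s2 & exists2 y, Y y & z \in k y by exists x' => //; exists y0.
case: ex => {x' y0 Y0 x's x'k} s3 [x' [s4 [s2E [y0 Y0 x'k] s3k]]].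
have {}s3k y z : Y y -> z \in s3 -> z \notin k y.
  by move=> Yy /s3k nz; apply/negP => zk; apply: nz; exists y.
have [u [w k0E]] : exists u w, k y0 = u ++ x' :: w.
  by case/splitPr: x'k => u w; exists u, w.
have nx'h : ~ hd x' (k y0).
  by move=> hx; move: (nh _ _ Y0 hx); rewrite s2E inE mem_cat mem_head !orbT.
have [h0 [t0 [k0E' Bh0 t0B]]] := kh _ Y0.
have [u0 uE] : exists u0, u = h0 :: u0.
  move: k0E; rewrite k0E'; case: (u) => [[hx _]|a u0 [-> _]]; last by exists u0.
  by case: nx'h; rewrite k0E' hx; exists t0.
have t0E : t0 = u0 ++ x' :: w by move: k0E; rewrite k0E' uE => -[].
have u0B z : z \in u0 -> ~ B z by move=> zu; apply: t0B; rewrite t0E mem_cat zu.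
have x'B : ~ B x' by apply: t0B; rewrite t0E mem_cat mem_head orbT.
have u_k0 z : z \in u -> z \in k y0 by move=> zu; rewrite k0E mem_cat zu.
pose B' z := [\/ B z, z \in u, z = x' | z \in s3].
pose k' := upd k y0 (x' :: w); pose g' := upd g y0 (g y0 ++ u).
have u_uniq : uniq (u ++ x' :: w) by rewrite -k0E; apply: ku.
have wB' z : z \in w -> ~ B' z.
  move=> zw; case.
  - by apply: t0B; rewrite t0E mem_cat inE zw !orbT.
  - by move=> zu; apply: (uniq_cat_notin u_uniq zu); rewrite inE zw orbT.
  - move=> zx; move: u_uniq; rewrite cat_uniq => /and3P[_ _] /=.
    by rewrite -zx zw.
  - by move=> zs; move: (s3k _ _ Y0 zs); rewrite k0E mem_cat inE zw !orbT.
have kB' y h t z : Y y -> y <> y0 -> k y = h :: t -> z \in t -> ~ B' z.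
  move=> Yy n kE zt; have zk : z \in k y by rewrite kE inE zt orbT.
  case.
  - by have [h' [t' [kE' _ tB]]] := kh _ Yy; apply: tB; move: kE'; rewrite kE => -[_ <-].
  - by move=> zu; apply: n; apply: (kd _ _ z) => //; apply: u_k0.
  - by move=> zx; apply: n; apply: (kd _ _ z) => //; rewrite zx k0E mem_cat mem_head orbT.
  - by move=> zs; move: (s3k _ _ Yy zs); rewrite zk.
have nb'u : b' \notin u by apply/negP => bu; move: (b'k _ Y0); rewrite u_k0.
have s3B z : z \in s3 -> ~ B z by move=> zs; apply: s2B; rewrite s2E mem_cat zs.
have nx's3 : x' \notin s3.
  apply/negP => xs; move: (ul); rewrite s2E /= cat_uniq => /and4P[_ _ /hasPn /(_ x')].
  by rewrite mem_head xs => /(_ isT).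
have us3 : uniq (b' :: s3).
  by move: ul; rewrite s2E -cat_cons cat_uniq => /andP[].
have nb'x : b' <> x' by move=> bx; apply: x'B; rewrite -bx.
exists (B', g', k'); split; last first.
- exists y0 => //=; rewrite /k' updE k0E uE size_cat /= addSn ltnS; exact: leq_addl.
- split=> /= [z|y Yy]; first by constructor 1.
  by rewrite /k'; have [->|/eqP n] := eqVneq y y0; [exists u; rewrite updE|exists [::]; rewrite updN].
have bs3 : bw e A (b' :: s3 ++ x' :: s4) by rewrite -s2E.
split.
- move=> y Yy; rewrite /g' /k'; have [->|/eqP n] := eqVneq y y0; rewrite ?updE ?updN //; last exact: pE.
  by rewrite -catA -k0E; apply: pE.
- move=> y Yy; rewrite /k'; have [->|/eqP n] := eqVneq y y0; rewrite ?updE ?updN //.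
    by exists x', w; split=> //; constructor 3.
  have [h [t [kE Bh tB]]] := kh _ Yy; exists h, t; split=> //; first by constructor 1.
  by move=> z; apply: kB' kE.
- move=> y Yy z; rewrite /g'; have [->|/eqP n] := eqVneq y y0; rewrite ?updE ?updN //.
    by rewrite mem_cat => /orP[/(gB _ Y0)|]; [constructor 1|constructor 2].
  by move=> zg; constructor 1; apply: gB zg.
- by move=> x /XB; constructor 1.
move=> Q lb b tb s fQ lbb lbu lbQ lbE B'b tbB kQ Qs.
have [Qb Qu Qd] := fQ.
have [|hh [ww [ww' [k'E Q0E wwB]]]] := kQ y0 => //.
have {hh ww k'E ww' wwB Q0E} [w' [Q0E w'B]] : exists w', Q y0 = x' :: w' /\ forall z, z \in w' -> ~ B' z.
  by move: k'E; rewrite /k' updE => -[? ?]; subst hh; exists ww'.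
have kQ' y : Y y -> y <> y0 -> exists h t t', [/\ k y = h :: t, Q y = h :: t', B h & forall z, z \in t' -> ~ B' z].
  move=> Yy n; have [h [t [t' [kE QE tB]]]] := kQ _ Yy; exists h, t, t'; split=> //.
    by move: kE; rewrite /k' updN.
  by have [h1 [t1 [kE1 Bh _]]] := kh _ Yy; move: kE; rewrite /k' updN // kE1 => -[<-].
have Qn y : Y y -> Q y != [::] by move=> /kQ [h [t [t' [_ -> _]]]].
have Q_B'u y z : Y y -> z \in Q y -> z \in u -> False.
  move=> Yy zQ zu; have [?|n] := pselect (y = y0).
    subst y; move: zQ; rewrite Q0E inE => /orP[/eqP zx|/w'B]; last by apply; constructor 2.
    by apply: (uniq_cat_notin u_uniq zu); rewrite zx mem_head.
  have [h [t [t' [kE QE Bh tB]]]] := kQ' _ Yy n.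
  move: zQ; rewrite QE inE => /orP[/eqP zh|/tB]; last by apply; constructor 2.
  by apply: n; apply: (kd _ _ z) => //; [rewrite kE zh mem_head|apply: u_k0].
have Q_s3 y z : Y y -> z \in Q y -> z \in b' :: s3 -> False.
  move=> Yy zQ zs; have [?|n] := pselect (y = y0).
    subst y; move: zQ; rewrite Q0E inE => /orP[/eqP zx|/w'B]; last first.
      by apply; move: zs; rewrite inE => /orP[/eqP ->|]; [constructor 1|constructor 4].
    by move: zs; rewrite inE zx => /orP[/eqP /esym //|]; rewrite (negPf nx's3).
  have [h [t [t' [kE QE Bh tB]]]] := kQ' _ Yy n.
  move: zQ; rewrite QE inE => /orP[/eqP zh|/tB]; last first.
    by apply; move: zs; rewrite inE => /orP[/eqP ->|]; [constructor 1|constructor 4].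
  have zk : z \in k y by rewrite kE zh mem_head.
  move: zs; rewrite inE => /orP[/eqP zb|zs]; last by move: (s3k _ _ Yy zs); rewrite zk.
  by move: (b'k _ Yy); rewrite -zb zk.
pose ga u' : V -> seq V := upd (fun _ => [::]) y0 u'.
(* The new path arrives on the detached stretch [u]: it takes over the end [y0], while the old path
   of [y0], stopped at [x'], continues along [s3] to [b'] in [B]. *)
have b_u : b \in u -> augmented Q lb.
  move=> bu; have [u1 [u2 uE']] := in_split bu.
  have u1u z : z \in u1 -> z \in u by rewrite uE' mem_cat => ->.
  have [fs sQ] := fam_swap fQ lbb lbu lbQ Y0.
  have frm y : Y y -> exists h t t', [/\ k y = ga u1 y ++ h :: t, upd Q y0 lb y = h :: t',
     forall z, z \in ga u1 y -> B' z & forall z, z \in t' -> ~ B' z].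
    move=> Yy; have [->|/eqP n] := eqVneq y y0.
      rewrite /ga !updE; exists b, (u2 ++ x' :: w), tb.
      by rewrite k0E uE' -catA; split=> // z /u1u; constructor 2.
    rewrite /ga !updN //; have [h [t [t' [kE QE Bh tB]]]] := kQ' _ Yy n.
    by exists h, t, t'.
  have fr := fam_reroute fk fs frm.
  have lbx : bw e A (b' :: s3 ++ Q y0).
    by rewrite Q0E; apply: (@bw_swap _ e A A (b' :: s3) x' s4 w' bs3); rewrite -Q0E; apply: Qb.
  apply: (augmented_src (compl _ (b' :: s3 ++ Q y0) b' (s3 ++ Q y0) (y0 :: s) fr lbx _ _ _ Bb' _ _ _)).
  - rewrite -cat_cons cat_uniq us3 Qu // andbT; apply/hasPn => z zQ; apply/negP.
    exact: Q_s3 zQ.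
  - move=> y Yy z; rewrite -cat_cons mem_cat => zz; rewrite mem_cat negb_or; apply/andP; split; apply/negP.
      rewrite /ga; have [->|/eqP n] := eqVneq y y0; rewrite ?updE ?updN // => zu1.
      case/orP: zz => [|zQ]; last by apply: (Q_B'u y0 z) => //; apply: u1u.
      rewrite inE => /orP[/eqP zb|zs]; first by move: nb'u; rewrite -zb u1u.
      by move: (s3k _ _ Y0 zs); rewrite u_k0 // u1u.
    case/orP: zz => [zs|zQ]; last by apply/negP; apply: sQ.
    have [->|/eqP n] := eqVneq y y0; rewrite ?updE ?updN //; last by move=> zQ; apply: (Q_s3 y z).
    rewrite lbE inE => /orP[/eqP zb|/tbB]; last first.
      by apply; move: zs; rewrite inE => /orP[/eqP ->|]; [constructor 1|constructor 4].
    move: zs; rewrite zb inE => /orP[/eqP bb|bs]; first by move: nb'u; rewrite -bb bu.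
    by move: (s3k _ _ Y0 bs); rewrite u_k0.
  - by [].
  - move=> z; rewrite mem_cat => /orP[/s3B //|]; rewrite Q0E inE => /orP[/eqP -> //|/w'B nz Bz].
    by apply: nz; constructor 1.
  - move=> y Yy; have [->|/eqP n] := eqVneq y y0.
      rewrite /ga !updE; move: uE'; rewrite k0E uE lbE; case: (u1) u1u => [|a u1'] u1u [hE u0E].
        by exists b, (u0 ++ x' :: w), tb; rewrite hE; split=> // z /tbB nz Bz; apply: nz; constructor 1.
      exists a, (u0 ++ x' :: w), (u1' ++ b :: tb); rewrite hE; split=> // z.
      rewrite mem_cat inE => /or3P[zu|/eqP zb|/tbB nz Bz]; last by apply: nz; constructor 1.
        by apply: u0B; rewrite u0E mem_cat zu.
      by apply: u0B; rewrite u0E mem_cat zb mem_head orbT.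
    rewrite /ga !updN //; have [h [t [t' [kE QE Bh tB]]]] := kQ' _ Yy n.
    by exists h, t, t'; split=> // z /tB nz Bz; apply: nz; constructor 1.
  - move=> y Yy; rewrite inE negb_or => /andP[/eqP n ys].
    by rewrite /ga !updN // Qs // /k' updN.
  - by right; exists y0 => //; rewrite -cat_cons src_neq // Q0E.
  - move=> y Yy; rewrite src_neq; last first.
      by have [->|/eqP n] := eqVneq y y0; rewrite ?updE ?lbE // updN // Qn.
    by have [->|/eqP n] := eqVneq y y0; rewrite ?updE; [left|rewrite updN //; right; exists y].
have [/b_u //|/negP nbu] := boolP (b \in u).
have frm y : Y y -> exists h t t', [/\ k y = ga u y ++ h :: t, Q y = h :: t',
     forall z, z \in ga u y -> B' z & forall z, z \in t' -> ~ B' z].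
  move=> Yy; have [->|/eqP n] := eqVneq y y0.
    by rewrite /ga !updE; exists x', w, w'; split=> // z; constructor 2.
  rewrite /ga !updN //; have [h [t [t' [kE QE Bh tB]]]] := kQ' _ Yy n.
  by exists h, t, t'.
have fr := fam_reroute fk fQ frm.
have headQ y : Y y -> exists h t t', [/\ k y = h :: t, ga u y ++ Q y = h :: t' & forall z, z \in t' -> ~ B z].
  move=> Yy; have [->|/eqP n] := eqVneq y y0.
    rewrite /ga !updE k0E uE Q0E; exists h0, (u0 ++ x' :: w), (u0 ++ x' :: w'); split=> // z.
    rewrite mem_cat inE => /or3P[/u0B //|/eqP -> //|/w'B nz Bz].
    by apply: nz; constructor 1.
  rewrite /ga !updN //; have [h [t [t' [kE QE Bh tB]]]] := kQ' _ Yy n.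
  by exists h, t, t'; split=> // z /tB nz Bz; apply: nz; constructor 1.
have restQ y : Y y -> y \notin y0 :: s -> ga u y ++ Q y = k y.
  by move=> Yy; rewrite inE negb_or => /andP[/eqP n ys]; rewrite /ga !updN // Qs // /k' updN.
have srcQ y : Y y -> src (ga u y ++ Q y) = src lb \/ exists2 y', Y y' & src (ga u y ++ Q y) = src (Q y').
  by move=> Yy; right; exists y => //; rewrite src_neq // Qn.
have Bbs : B b \/ b \in s3.
  case: B'b => [|//||]; [by left| |by right].
  by move=> bx; move: (lbQ _ Y0 b); rewrite lbE mem_head Q0E bx mem_head => /(_ isT).
(* In the remaining cases [y0] gets [u] back, and [lb] either ends in [B] already or is continued
   along [s3] to [b']. *)
case: Bbs => [Bb|bs3'].
  apply: (augmented_src (compl _ lb b tb (y0 :: s) fr lbb lbu _ lbE Bb _ headQ restQ) _ srcQ).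
  - move=> y Yy z zl; rewrite mem_cat negb_or (lbQ _ Yy _ zl) andbT; apply/negP.
    rewrite /ga; have [->|/eqP n] := eqVneq y y0; rewrite ?updE ?updN // => zu.
    move: zl; rewrite lbE inE => /orP[/eqP zb|/tbB]; last by apply; constructor 2.
    by apply: nbu; rewrite -zb.
  - by move=> z /tbB nz Bz; apply: nz; constructor 1.
  - by left.
have [a1 [a2 s3E]] : exists a1 a2, s3 = a1 ++ b :: a2.
  by case/splitPr: bs3' => a1 a2; exists a1, a2.
have a1s z : z \in b' :: a1 -> z \in b' :: s3.
  by rewrite s3E !inE mem_cat => /orP[->|->] //; rewrite orbT.
have lbx : bw e A (b' :: a1 ++ lb).
  rewrite lbE; apply: (@bw_swap _ e A A (b' :: a1) b (a2 ++ x' :: s4) tb); last by rewrite -lbE.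
  by move: bs3; rewrite s3E -catA.
have bnB : ~ B b by apply: s3B.
apply: (augmented_src (compl _ (b' :: a1 ++ lb) b' (a1 ++ lb) (y0 :: s) fr lbx _ _ _ Bb' _ headQ restQ) _ srcQ).
- rewrite -cat_cons cat_uniq lbu andbT; apply/andP; split.
    by move: us3; rewrite s3E -cat_cons cat_uniq => /andP[].
  apply/hasPn => z; rewrite lbE inE => /orP[/eqP ->|/tbB nz].
    apply/negP => ba; move: us3; rewrite s3E -cat_cons => /uniq_cat_notin; apply; first exact: ba.
    exact: mem_head.
  apply/negP => /a1s; rewrite inE => /orP[/eqP zb|zs]; apply: nz; first by rewrite zb; constructor 1.
  by constructor 4.
- move=> y Yy z; rewrite -cat_cons mem_cat => zz; rewrite mem_cat negb_or; apply/andP; split; apply/negP.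
    rewrite /ga; have [->|/eqP n] := eqVneq y y0; rewrite ?updE ?updN // => zu.
    case/orP: zz => [/a1s|].
      rewrite inE => /orP[/eqP zb|zs]; first by move: nb'u; rewrite -zb zu.
      by move: (s3k _ _ Y0 zs); rewrite u_k0.
    rewrite lbE inE => /orP[/eqP zb|/tbB]; last by apply; constructor 2.
    by apply: nbu; rewrite -zb.
  move=> zQ; case/orP: zz => [/a1s|zl]; first exact: Q_s3 zQ.
  by move: (lbQ _ Yy _ zl); rewrite zQ.
- by [].
- move=> z; rewrite mem_cat => /orP[za|].
    by apply: s3B; rewrite s3E mem_cat za.
  rewrite lbE inE => /orP[/eqP -> //|/tbB nz Bz]; by apply: nz; constructor 1.
- by left; rewrite -cat_cons src_neq // lbE.
Qed.

Notation state := ((V -> Prop) * (V -> seq V) * (V -> seq V))%type.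

(** Along the chain each kept piece only gets shorter, so it takes its shortest value in some state
    [m y]. Since [Q] differs from [k] on finitely many paths only, a single state of the chain is
    final for all of these and contains [b]; its completability applies once the other paths are
    prolonged by the difference [d]. *)
Lemma chain_state (C : state -> Prop) : (exists st, C st) ->
  (forall st, C st -> valid st) ->
  (forall st st', C st -> C st' -> le_state st st' \/ le_state st' st) ->
  exists st, valid st /\ forall st', C st' -> le_state st' st.
Proof.
move=> [st0 C0] Cv Ct; have [[pb pu pd] ph] := lp.
have /choice[m mP] y : exists st, C st /\ forall st', C st' -> size (st.2 y) <= size (st'.2 y).
  have ex : exists n, `[< exists2 st, C st & size (st.2 y) = n >].
    by exists (size (st0.2 y)); apply/asboolP; exists st0.
  have [n /asboolP[st Cs <-] nm] := ex_minnP ex; exists st; split=> // st' Cs'.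
  by apply: nm; apply/asboolP; exists st'.
pose B z := exists2 st, C st & st.1.1 z.
pose k y := (m y).2 y; pose g y := (m y).1.2 y.
have above st y : C st -> Y y -> le_state (m y) st -> st.2 y = k y.
  move=> Cs Yy [_ /(_ y Yy) [d]]; rewrite /k => mE; have [_ /(_ _ Cs)] := mP y.
  by rewrite mE size_cat; case: (d) => //= a d'; rewrite addSn ltnNge leq_addl.
have kk st y : C st -> Y y -> exists d, st.2 y = d ++ k y.
  move=> Cs Yy; have [Cm _] := mP y; have [[_ h]|h] := Ct _ _ Cs Cm; first exact: h.
  by exists [::]; rewrite (above st).
have vB st : C st -> forall z, st.1.1 z -> B z by move=> Cs z; exists st.
have pgk st y : C st -> Y y -> p y = st.1.2 y ++ st.2 y.
  by move=> /Cv; case: st => -[B' g'] k' [h _ _ _ _]; apply: h.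
have vh st y : C st -> Y y -> exists h t, [/\ st.2 y = h :: t, st.1.1 h & forall z, z \in t -> ~ st.1.1 z].
  by move=> /Cv; case: st => -[B' g'] k' [_ h _ _ _]; apply: h.
have vg st y : C st -> Y y -> forall z, z \in st.1.2 y -> st.1.1 z.
  by move=> /Cv; case: st => -[B' g'] k' [_ _ h _ _]; apply: h.
have pE y : Y y -> p y = g y ++ k y by apply: pgk; case: (mP y).
have kh y : Y y -> exists h t, [/\ k y = h :: t, B h & forall z, z \in t -> ~ B z].
  move=> Yy; have [Cm _] := mP y; have [h [t [kE Bh tB]]] := vh _ _ Cm Yy.
  exists h, t; split=> //; first exact: vB Bh.
  move=> z zt [st Cs Bz]; have [[h' _]|h'] := Ct _ _ Cs Cm; first by case: (tB _ zt); apply: h'.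
  have [h1 [t1 [kE1 _ tB1]]] := vh _ _ Cs Yy; move: (above _ _ Cs Yy h').
  by rewrite kE1 /k kE => -[_ ?]; subst t1; case: (tB1 _ zt).
have gB y : Y y -> forall z, z \in g y -> B z.
  by move=> Yy z zg; have [Cm _] := mP y; apply: (vB _ Cm); apply: vg zg.
exists (B, g, k); split; last first.
  by move=> st Cs; split=> /=; [apply: vB|move=> y; apply: kk].
split=> //.
  by move=> x Xx; apply: (vB _ C0); move: (Cv _ C0); case: (st0) => -[B' g'] k' [_ _ _ h _]; apply: h.
move=> Q lb b tb s fQ lbb lbu lbQ lbE [stb Cb Bb] tbB kQ Qs.
(* The path through [b], if there is one, is counted as exceptional, so that [b] cannot lie on a
   prolongation [d y]. *)
have [s' [ss' sb]] : exists s', {subset s <= s'} /\ forall y, Y y -> b \in p y -> y \in s'.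
  have [[y0 [Y0 b0]]|nb] := pselect (exists y, Y y /\ b \in p y); last first.
    by exists s; split=> // y Yy bp; case: nb; exists y.
  exists (y0 :: s); split=> [y ys|y Yy bp]; first by rewrite inE ys orbT.
  by rewrite (pd _ _ _ Yy Y0 bp b0) mem_head.
have [st [Cs lb_ ls]] : exists st, [/\ C st, le_state stb st & forall y, y \in s' -> le_state (m y) st].
  elim: s' {ss' sb} => [|a s' [st [Cs lb_ ls]]].
    by exists stb; split=> //; split=> // y Yy; exists [::].
  have tr st1 st2 st3 : le_state st1 st2 -> le_state st2 st3 -> le_state st1 st3.
    move=> [b1 k1] [b2 k2]; split=> [z /b1 /b2 //|y Yy].
    by have [d1 ->] := k1 _ Yy; have [d2 ->] := k2 _ Yy; exists (d1 ++ d2); rewrite catA.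
  have [Cm _] := mP a; have [h|h] := Ct _ _ Cs Cm.
    exists (m a); split=> //; first exact: tr h.
    move=> y; rewrite inE => /orP[/eqP ->|/ls h']; last exact: tr h' h.
    by split=> // z Yz; exists [::].
  by exists st; split=> // y; rewrite inE => /orP[/eqP ->|/ls].
have /choice[d dP] y : exists d, Y y -> st.2 y = d ++ k y.
  by have [Yy|] := pselect (Y y); [have [d] := kk _ _ Cs Yy; exists d|exists [::]].
have dN y : Y y -> y \in s' -> d y = [::].
  move=> Yy /ls h; have := above _ _ Cs Yy h; rewrite dP //.
  by move/(congr1 size)/eqP; rewrite size_cat -[X in _ == X]add0n eqn_add2r size_eq0 => /eqP.
have gE y : Y y -> g y = st.1.2 y ++ d y.
  move=> Yy; have := pgk _ _ Cs Yy; rewrite (pE _ Yy) dP // catA => /eqP.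
  by rewrite eqseq_cat ?size_cat //; [case/andP => /eqP|move/eqP: (congr1 size (pgk _ _ Cs Yy));
    rewrite (pE _ Yy) dP // !size_cat addnA eqn_add2r => /eqP].
have dB y z : Y y -> z \in d y -> B z.
  by move=> Yy zd; apply: (gB _ Yy); rewrite gE // mem_cat zd orbT.
have stn y : Y y -> p y = st.1.2 y ++ st.2 y /\ st.2 y != [::].
  by move=> Yy; split; [exact: pgk|have [h [t [-> _ _]]] := vh _ _ Cs Yy].
have fk : fam e A Y st.2 := fam_suffix (And3 pb pu pd) stn.
have fr : fam e A Y (fun y => d y ++ Q y).
  apply: (fam_reroute (B := B) fk fQ) => y Yy; have [h [t [t' [kE QE tB]]]] := kQ _ Yy.
  exists h, t, t'; rewrite dP // kE; split=> // z; exact: dB.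
have Qn y : Y y -> Q y != [::] by move=> /kQ [h [t [t' [_ -> _]]]].
have Bb' : st.1.1 b by apply: lb_.1.
have restQ y : Y y -> y \notin s' -> d y ++ Q y = st.2 y.
  by move=> Yy ys; rewrite dP // Qs //; apply/negP => /ss'; rewrite (negPf ys).
have aug : augmented (fun y => d y ++ Q y) lb.
  have [_ _ _ _ compl] : valid (st.1.1, st.1.2, st.2) by move: (Cv _ Cs); case: (st) => -[].
  apply: (compl _ lb b tb s' fr lbb lbu _ lbE) => //.
  - move=> y Yy z zl; rewrite mem_cat negb_or (lbQ _ Yy _ zl) andbT; apply/negP => zd.
    move: zl; rewrite lbE inE => /orP[/eqP zb|/tbB]; last by apply; apply: dB zd.
    have bp : b \in p y by rewrite pE // gE // -zb !mem_cat zd orbT.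
    by move: zd; rewrite dN //; apply: sb.
  - by move=> z /tbB nz Bz; apply: nz; apply: (vB _ Cs).
  - move=> y Yy; have [ys|/negP ys] := boolP (y \in s'); last first.
      rewrite restQ //; last exact/negP.
      by have [h [t [kE Bh tB]]] := vh _ _ Cs Yy; exists h, t, t.
    rewrite dP // dN //; have [h [t [t' [kE QE tB]]]] := kQ _ Yy; exists h, t, t'; split=> // z /tB nz Bz.
    by apply: nz; apply: (vB _ Cs).
apply: augmented_src aug _ _; first by left.
by move=> y Yy; right; exists y => //; rewrite src_neq // Qn.
Qed.

(** This replaces the alternating path argument for infinite linkages. For a maximal state, let [T]
    be the set of heads of the kept pieces. A walk that reaches [B] while avoiding [T] must augment
    by [step_state]; if there is none, [T] is an orthogonal cut with [X] beyond it. *)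
Lemma augment :
  (exists x q' a0 s, [/\ X x, linkage e A (fun z => z = x \/ Y z) q',
      forall y, Y y -> y \notin s -> q' y = p y
    & forall y, y = x \/ Y y -> src (q' y) = Some a0 \/ exists2 y', Y y' & src (q' y) = src (p y')]) \/
  exists T, (forall x, X x -> ~ reach e A T x) /\ orth (reach e A T) T Y p.
Proof.
have [[pb pu pd] ph] := lp; have [st0 v0] := initial_state.
pose S := {st | valid st}; pose R (s t : S) := le_state (sval s) (sval t).
have [||C [c0 Cc0] Ct|[[[B g] k] v] [_ smax]] := @zorn_above S R (exist _ st0 v0).
- by move=> t; split=> // y Yy; exists [::].
- move=> s1 s2 s3 [b1 k1] [b2 k2]; split=> [z /b1 /b2 //|y Yy].
  by have [d1 ->] := k1 _ Yy; have [d2 ->] := k2 _ Yy; exists (d1 ++ d2); rewrite catA.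
- have [|||st [vst ub]] := @chain_state (fun st => exists2 s, C s & sval s = st).
  + by exists (sval c0), c0.
  + by move=> _ [s _ <-]; apply: svalP.
  + by move=> _ _ [s1 C1 <-] [s2 C2 <-]; apply: Ct.
  + by exists (exist _ st vst) => s Cs; apply: ub; exists s.
have [pE kh gB XB compl] := v.
pose T h := exists2 y, Y y & hd h (k y).
have [[b [l [bl nT]] Bb]|nB] := pselect (exists2 b, reach e A T b & B b).
  have [l' [bl' ul' sl]] := bw_uniq bl.
  have [|[Q [lb [aug Qk]]]|[st [vst le [y Yy lt]]]] := step_state v bl' ul' Bb.
  - by move=> y h Yy hk; apply/negP => /sl hl; apply: (nT _ hl); exists y.
  - left; have [x [q' [s [Xx lq' qs sq]]]] := aug.
    have kp y : Y y -> src (Q y) = src (p y).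
      by move=> Yy; rewrite Qk // pE // src_neq //; have [h [t [-> _ _]]] := kh _ Yy.
    exists x, q', (odflt x (src lb)), s; split=> // y xy.
    have [h|[y' Yy' h]] := sq _ xy; last by right; exists y'; rewrite // h kp.
    by have [t qE] := lq'.2 _ xy; left; rewrite h; move: h; rewrite qE; case: (src lb) (src_some y t) => //= -[z ->].
  - exfalso; have [_ h] := smax (exist _ st vst) le; have [d /= kE] := h _ Yy.
    by move: lt; rewrite kE size_cat ltnNge leq_addl.
right; exists T; split=> [x Xx rx|]; first by apply: nB; exists x => //; apply: XB.
split=> [y Yy|t [y Yy [l kE]]]; last by exists y; rewrite // pE // kE mem_cat mem_head orbT.
have [h [t [kE Bh tB]]] := kh _ Yy.
have Tg z : z \in p y -> T z -> z = h.
  move=> zp [y' Yy' [l zk]]; have ? : y = y'.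
    by apply: (pd _ _ z) => //; rewrite pE // zk mem_cat mem_head orbT.
  by subst y'; move: zk; rewrite kE => -[].
have hu : [/\ h \notin g y & h \notin t].
  have := pu _ Yy; rewrite pE // kE cat_uniq => /and3P[_ /hasPn hg /= /andP[ht _]].
  by split=> //; apply: hg; rewrite mem_head.
exists (g y), h, t; split.
- by rewrite pE // kE.
- by exists y => //; exists t.
- move=> z zg; split; first by move=> rz; apply: nB; exists z => //; apply: gB zg.
  move=> Tz; have zh : z = h by apply: Tg; rewrite // pE // mem_cat zg.
  by move: zg; rewrite zh; case: hu => /negPf ->.
- move=> z zt; have [s1 [s2 def]] := in_split zt.
  exists s2; split.
    apply: (@bw_suffix _ e A (g y ++ h :: s1)); rewrite -catA /= -def -kE -pE //; exact: pb.
  move=> w wz Tw; have wt : w \in t by rewrite def mem_cat wz orbT.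
  case: hu => _; rewrite -(Tg w) ?wt //.
  by rewrite pE // kE mem_cat inE wt !orbT.
Qed.

End Augment.

(** * Regions and waves *)

Section Regions.
Variable V : eqType.
Implicit Types (x y z t u : V) (l s : seq V) (e : V -> V -> Prop).
Implicit Types (A B I T U W X Y Z : V -> Prop).

Lemma fam_glue e A A' Y X (p s : V -> seq V) (b : V -> V) : fam e A' Y p ->
  (forall x, X x -> Y (b x)) ->
  (forall x x', X x -> X x' -> b x = b x' -> x = x') ->
  (forall x, X x -> uniq (s x)) ->
  (forall x x' z, X x -> X x' -> z \in s x -> z \in s x' -> x = x') ->
  (forall x y z, X x -> Y y -> z \in s x -> z \notin p y) ->
  (forall x, X x -> bw e A (s x ++ p (b x))) ->
  fam e A X (fun x => s x ++ p (b x)).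
Proof.
move=> [pb pu pd] Yb bi su sd sp bs; split=> // [x Xx|x x' z Xx Xx'].
- rewrite cat_uniq su // pu ?andbT /=; last exact: Yb.
  by apply/hasPn => z zp; apply/negP => zs; move: (sp _ _ _ Xx (Yb _ Xx) zs); rewrite zp.
- rewrite !mem_cat => /orP[zs|zp] /orP[zs'|zp'].
  + exact: sd zs zs'.
  + by move: (sp _ _ _ Xx (Yb _ Xx') zs); rewrite zp'.
  + by move: (sp _ _ _ Xx' (Yb _ Xx) zs'); rewrite zp.
  + by apply: bi => //; apply: (pd _ _ z) => //; apply: Yb.
Qed.

Lemma split_cross e A I T y l : cut e A I T -> bw e A (y :: l) -> ~ I y ->
  exists s t l', [/\ y :: l = s ++ t :: l', T t & forall z, z \in s -> ~ I z /\ ~ T z].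
Proof.
move=> ct h nIy; have /split_first[s [t [l' [def Tt sT]]]] := cut_cross ct h nIy.
exists s, t, l'; split=> // z zs; split; last exact: sT.
have [cA ce IT] := ct; move: h nIy zs sT; rewrite def; case: s def => // a s [<- _] {l a}.
elim: s y => [|x s IH] y /=.
  by move=> _ nIy; rewrite inE => /eqP ->.
move=> [exy h] nIy; rewrite inE => /orP[/eqP -> //|zs] sT.
apply: (IH x) => //; last by move=> w ws; apply: sT; rewrite inE ws orbT.
move=> Ix; have [//|] := ce _ _ Ix exy; by apply: sT; rewrite mem_head.
Qed.

(* With empty [core] these are the waves of the proof of the Erdos-Menger
   theorem: [paths] links [front] inside [inner]; the [core] consists of
   further targets inside the region that are linked as well. *)
Record region := Region
  { inner : V -> Prop; front : V -> Prop; core : V -> Prop; paths : V -> seq V }.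
Implicit Types (o : region) (C : region -> Prop).

Section Good.
Variables (e : V -> V -> Prop) (A W Z : V -> Prop).

Definition good o :=
  [/\ cut e A (inner o) (front o),
      linkage e A (fun x => front o x \/ core o x) (paths o),
      forall t z, front o t -> z \in behead (paths o t) -> inner o z,
      forall u z, core o u -> z \in paths o u -> inner o z
    & (forall u, core o u -> Z u) /\ forall x, inner o x -> W x -> core o x].

(** Paths to the front may only be prolonged outwards. Hence a vertex that stays on the front keeps
    its path ([rle_paths]), and limits of chains have well-defined paths. *)
Definition rle o o' :=
  [/\ forall x, inner o x -> inner o' x,
      forall u, core o u -> core o' u /\ paths o' u = paths o u,
      forall t, front o t -> inner o' t \/ front o' t
    & forall t', front o' t' -> exists s t, [/\ front o t, paths o' t' = s ++ paths o t
        & forall z, z \in s -> ~ inner o z /\ ~ front o z]].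

Lemma rle_refl o : rle o o.
Proof. by split=> // [t Tt|t Tt]; [right|exists [::], t]. Qed.

Lemma rle_trans o1 o2 o3 : rle o1 o2 -> rle o2 o3 -> rle o1 o3.
Proof.
move=> [i1 u1 f1 p1] [i2 u2 f2 p2]; split.
- by move=> x /i1 /i2.
- by move=> u /u1 [/u2 [c3 ->] ->].
- by move=> t /f1 [/i2|/f2]; [left|].
- move=> t3 /p2 [s [t [/p1 [s' [t' [Tt' -> s'P]]] -> sP]]].
  exists (s ++ s'), t'; rewrite catA; split=> // z; rewrite mem_cat => /orP[/sP [n1 n2]|/s'P //].
  by split=> [/i1 //|/f1 []].
Qed.

Lemma good_head o x : good o -> front o x \/ core o x -> exists l, paths o x = x :: l.
Proof. by move=> [_ [_ h] _ _ _] /h. Qed.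

Lemma good_core o u : good o -> core o u -> inner o u.
Proof.
move=> g cu; have [l pE] := good_head g (or_intror cu); have [_ _ _ h _] := g.
by apply: (h u) => //; rewrite pE mem_head.
Qed.

Lemma rle_paths o o' x : good o -> good o' -> rle o o' ->
  front o x /\ front o' x \/ core o x -> paths o' x = paths o x.
Proof.
move=> g g' [_ u _ p]; case=> [[Tx Tx']|/u []//].
have [s [t [Tt pE sP]]] := p _ Tx'.
have [l p'E] := good_head g' (or_introl Tx'); have [l' ptE] := good_head g (or_introl Tt).
move: pE sP; rewrite p'E ptE; case: s => [[-> ->]//|a s [<- _] /(_ x)].
by rewrite mem_head => /(_ isT) [].
Qed.

Lemma good_limit C : (exists o, C o) -> (forall o, C o -> good o) ->
  (forall o o', C o -> C o' -> rle o o' \/ rle o' o) ->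
  exists o, [/\ good o, forall o', C o' -> rle o' o,
    forall x, inner o x -> exists2 o', C o' & inner o' x
    & forall x, front o x -> exists2 o', C o' & front o' x].
Proof.
move=> [o0 C0] Cg Ct.
pose I x := exists2 o, C o & inner o x.
pose T x := (exists2 o, C o & front o x) /\ ~ I x.
pose U x := exists2 o, C o & core o x.
have Tup o o' x : front o x -> ~ I x -> C o' -> rle o o' -> front o' x.
  by move=> Tx nI Co' [_ _ h _]; have [Ix|//] := h _ Tx; case: nI; exists o'.
have Uup o o' x : core o x -> rle o o' -> core o' x by move=> Ux [_ h _ _]; case: (h _ Ux).
have UI x : U x -> I x by move=> [o Co Ux]; exists o => //; apply: good_core (Cg _ Co) Ux.
have /choice[w wP] x : exists o, T x \/ U x -> C o /\ (front o x /\ ~ I x \/ core o x).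
  have [[o Co Ux]|nU] := pselect (U x); first by exists o; split=> //; right.
  have [[[o Co Tx] nI]|nT] := pselect (T x); first by exists o; split=> //; left.
  by exists o0; case.
pose p x := paths (w x) x.
have up o x : T x \/ U x -> C o -> rle (w x) o -> (front o x \/ core o x) /\ paths o x = p x.
  move=> TU Co h; have [Cw [[Tx nI]|Ux]] := wP _ TU.
    have Tox : front o x by apply: Tup h.
    by split; [left|apply: rle_paths h _; [apply: Cg|apply: Cg|left]].
  by split; [right; apply: Uup h|apply: rle_paths h _; [apply: Cg|apply: Cg|right]].
have up1 x : T x \/ U x -> exists o, [/\ C o, good o, front o x \/ core o x & paths o x = p x].
  move=> TU; have [Cw h] := wP _ TU; exists (w x); split=> //; first exact: Cg.
  by case: h => [[]|]; [left|right].
have up2 x y : T x \/ U x -> T y \/ U y -> exists o, [/\ C o, good o,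
    front o x \/ core o x, front o y \/ core o y & paths o x = p x /\ paths o y = p y].
  move=> TUx TUy; have [Cx _] := wP _ TUx; have [Cy _] := wP _ TUy.
  have [o [Co lx ly]] : exists o, [/\ C o, rle (w x) o & rle (w y) o].
    have [h|h] := Ct _ _ Cx Cy; [exists (w y)|exists (w x)]; split=> //; exact: rle_refl.
  have [h1 h2] := up _ _ TUx Co lx; have [h3 h4] := up _ _ TUy Co ly.
  by exists o; split=> //; apply: Cg.
exists (Region I T U p); split=> [||x [o Co Ix]|x [[o Co Tx] _]]; [split=> /=| |by exists o|by exists o].
- split=> [a Aa|x y [o Co Ix] exy|x Ix [_ //]].
    have [[ca _ _] _ _ _ _] := Cg _ C0; have [Ia|Ta] := ca _ Aa; first by left; exists o0.
    by have [h|h] := pselect (I a); [left|right; split=> //; exists o0].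
  have [[_ ce _] _ _ _ _] := Cg _ Co; have [Iy|Ty] := ce _ _ Ix exy; first by left; exists o.
  by have [h|h] := pselect (I y); [left|right; split=> //; exists o].
- split; [split=> [x|x|x y z]|move=> x].
  + by move=> /up1 [o [Co [_ [[pb _ _] _] _ _ _] TU <-]]; apply: pb.
  + by move=> /up1 [o [Co [_ [[_ pu _] _] _ _ _] TU <-]]; apply: pu.
  + move=> TUx TUy; have [o [Co [_ [[_ _ pd] _] _ _ _] TU TU' [<- <-]]] := up2 _ _ TUx TUy.
    exact: pd.
  + by move=> /up1 [o [Co [_ [_ ph] _ _ _] TU <-]]; apply: ph.
- move=> t z Tt zp; have [o [Co g TU pE]] := up1 _ (or_introl Tt).
  have To : front o t by case: TU => // /(good_core g) It; case: Tt => _; case; exists o.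
  by exists o => //; have [_ _ h _ _] := g; apply: (h t) => //; rewrite pE.
- move=> u z Uu zp; have [Cw h] := wP _ (or_intror Uu).
  have Uo : core (w u) u by case: h => // -[_]; case; apply: UI.
  by exists (w u) => //; have [_ _ _ h' _] := Cg _ Cw; apply: (h' u).
- split=> [u [o Co Uu]|x [o Co Ix] Wx]; have [_ _ _ _ [h1 h2]] := Cg _ Co.
    exact: h1.
  by exists o => //; apply: h2.
- move=> o Co; split=> /= [x Ix|u Uu|t Tt|t Tt]; first by exists o.
  + have U' : U u by exists o.
    split=> //; have [o' [Co' g' TU pE]] := up1 _ (or_intror U').
    have [Cw _] := wP _ (or_intror U'); have [h|h] := Ct _ _ Co Cw.
      by apply: rle_paths h _; [apply: Cg|apply: Cg|right].
    by have [_ ->] := up _ _ (or_intror U') Co h.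
  + by have [h|h] := pselect (I t); [left|right; split=> //; exists o].
  + have [Cw _] := wP _ (or_introl Tt); have [h|h] := Ct _ _ Co Cw.
      have [|Uw] : front (w t) t \/ core (w t) t by have [o' [_ _ ? _]] := up1 _ (or_introl Tt); case: (wP _ (or_introl Tt)) => _ [[]|]; [left|right].
        by have [_ _ _ hp] := h; move=> /hp.
      by case: Tt => _; case; exists (w t) => //; apply: good_core (Cg _ Cw) Uw.
    have [TU <-] := up _ _ (or_introl Tt) Co h; exists [::], t; split=> //.
    by case: TU => // Uo; case: Tt => _; case; exists o => //; apply: good_core (Cg _ Co) Uo.
Qed.

(* Outside [inner o] the paths of [o2] are followed back to their last vertex
   in [front o] and then continued along [o]. *)
Lemma good_join o o2 : good o -> good o2 -> (forall u, core o2 u -> ~ inner o u) ->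
  exists o', [/\ good o', rle o o', forall x, inner o2 x -> inner o' x, forall u, core o2 u -> core o' u
    & forall x, front o2 x -> ~ inner o x -> front o' x].
Proof.
move=> g g2 disj; have [ct [[pb pu pd] ph] pt pU [UZ IW]] := g; have [ct2 [[qb qu qd] qh] qt qU [UZ2 IW2]] := g2.
pose I x := inner o x \/ inner o2 x.
pose T x := front o x /\ ~ inner o2 x \/ front o2 x /\ ~ inner o x.
pose U x := core o x \/ core o2 x.
(* Old vertices keep their path in [o]. Every other vertex to be linked lies outside [inner o], so
   its path in [o2] has to cross [front o]. *)
pose old x := front o x /\ ~ inner o2 x \/ core o x.
have new x : T x \/ U x -> ~ old x -> (front o2 x \/ core o2 x) /\ ~ inner o x.
  case=> [[h no|[Tx nI] _]|[h no|Ux _]].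
  - by case: no; left.
  - by split=> //; left.
  - by case: no; right.
  - by split; [right|apply: disj].
have oldTU x : old x -> front o x \/ core o x by case=> [[]|]; [left|right].
have /choice[f fP] x : exists f : seq V * V * seq V, T x \/ U x ->
    [/\ front o f.1.2 \/ core o f.1.2, forall z, z \in f.1.1 -> ~ inner o z /\ ~ front o z,
       old x -> f.1.1 = [::] /\ f.1.2 = x
     & ~ old x -> front o f.1.2 /\ paths o2 x = f.1.1 ++ f.1.2 :: f.2].
  have [ox|no] := pselect (old x); first by exists ([::], x, [::]) => _; split=> //; apply: oldTU.
  have [TU|] := pselect (T x \/ U x); last by exists ([::], x, [::]).
  have [TU2 nI] := new _ TU no; have [l qE] := good_head g2 TU2.
  have [|s [t [l' [def Tt sP]]]] := split_cross ct (_ : bw e A (x :: l)) nI.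
    by rewrite -qE; apply: qb.
  by exists (s, t, l') => _; rewrite qE; split=> //; left.
pose s x := (f x).1.1; pose b x := (f x).1.2; pose r x := s x ++ paths o (b x).
have sq x z : T x \/ U x -> z \in s x -> [/\ front o2 x \/ core o2 x, z \in paths o2 x & ~ old x].
  move=> TU zs; have [_ _ h1 h2] := fP _ TU; have [ox|no] := pselect (old x).
    by have [h _] := h1 ox; move: zs; rewrite /s h.
  by have [_ ->] := h2 no; have [? _] := new _ TU no; split=> //; rewrite mem_cat zs.
have bq x : T x \/ U x -> ~ old x -> [/\ front o2 x \/ core o2 x, front o (b x),
    b x \in paths o2 x & b x = x \/ inner o2 (b x)].
  move=> TU no; have [_ _ _ /(_ no) [Tb qE]] := fP _ TU; have [TU2 _] := new _ TU no.
  split=> //; first by rewrite qE mem_cat mem_head orbT.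
  case: TU2 => [Tx|Ux]; last by right; apply: (qU x) => //; rewrite qE mem_cat mem_head orbT.
  have [l] := good_head g2 (or_introl Tx); rewrite qE.
  case sE: (f x).1.1 => [|a s'] [xE _]; first by left.
  by right; apply: (qt x) => //; rewrite qE sE /= mem_cat mem_head orbT.
have bI x : T x \/ U x -> ~ old x -> ~ old (b x) \/ b x = x.
  move=> TU no; have [_ Tb _ [|h]] := bq _ TU no; first by right.
  by left; case=> [[]//|/(good_core g) Ib]; case: ct => _ _ /(_ _ Ib).
have oldx x : T x \/ U x -> old x -> s x = [::] /\ b x = x.
  by move=> TU ox; have [_ _ h _] := fP _ TU; apply: h.
have lr : fam e A (fun x => T x \/ U x) r.
  apply: (@fam_glue e A A (fun x => front o x \/ core o x)) => //.
  - by move=> x /fP [].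
  - move=> x x' TU TU' bb; have [ox|no] := pselect (old x); have [ox'|no'] := pselect (old x').
    + by have [_ <-] := oldx _ TU ox; have [_ <-] := oldx _ TU' ox'.
    + have [_ bx] := oldx _ TU ox; have [nob|b'x] := bI _ TU' no'; last by rewrite -b'x -bb bx.
      by case: nob; rewrite -bb bx.
    + have [_ bx] := oldx _ TU' ox'; have [nob|b'x] := bI _ TU no; last by rewrite -b'x bb bx.
      by case: nob; rewrite bb bx.
    + have [h1 _ h2 _] := bq _ TU no; have [h1' _ h2' _] := bq _ TU' no'.
      by apply: (qd _ _ (b x)) => //; rewrite bb.
  - move=> x TU; have [ox|no] := pselect (old x); first by have [-> _] := oldx _ TU ox.
    have [_ _ _ /(_ no) [_ qE]] := fP _ TU; have [TU2 _] := new _ TU no.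
    by have := qu _ TU2; rewrite qE cat_uniq => /andP[].
  - move=> x x' z TU TU' /(sq _ _ TU) [h1 h2 _] /(sq _ _ TU') [h1' h2' _]; exact: (qd _ _ z).
  - move=> x y z TU TU' zs; have [_ h _ _] := fP _ TU; have [nI nT] := h _ zs.
    apply/negP => zp; case: TU' => [Ty|Uy]; last by apply: nI; apply: (pU y).
    have [l pE] := good_head g (or_introl Ty); move: zp; rewrite pE inE => /orP[/eqP zy|zl].
      by apply: nT; rewrite zy.
    by apply: nI; apply: (pt y) => //; rewrite pE.
  - move=> x TU; have [ox|no] := pselect (old x).
      by have [-> ->] := oldx _ TU ox; apply: pb; apply: oldTU.
    have [TUb _ _ /(_ no) [_ qE]] := fP _ TU; have [TU2 _] := new _ TU no.
    have := qb _ TU2; rewrite qE => bq1; have [l bE] := good_head g TUb; rewrite -/(b x) in bE *.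
    by rewrite bE; apply: bw_swap bq1 _; rewrite -bE; apply: pb.
have rold x : T x \/ U x -> old x -> r x = paths o x.
  by move=> TU ox; rewrite /r; have [-> ->] := oldx _ TU ox.
have rin x z : T x \/ U x -> ~ old x -> z \in r x ->
    [\/ z \in s x, z = b x | I z].
  move=> TU no; rewrite mem_cat => /orP[|zp]; first by constructor 1.
  have [_ Tb _ _] := bq _ TU no; have [l bE] := good_head g (or_introl Tb).
  move: zp; rewrite bE inE => /orP[/eqP|zl]; first by constructor 2.
  by constructor 3; left; apply: (pt (b x)) => //; rewrite bE.
exists (Region I T U r); split=> //=; [split=> //=|split=> //=| | |].
- split.
  + move=> a Aa; have [c1 _ _] := ct; have [c2 _ _] := ct2.
    have [h|h] := pselect (I a); [by left|right].
    have [?|T1] := c1 _ Aa; first by case: h; left.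
    by left; split=> // ?; case: h; right.
  + have [_ c1 _] := ct; have [_ c2 _] := ct2; move=> x y Ix exy.
    have [h|h] := pselect (I y); [by left|right].
    case: Ix => [/c1 /(_ exy)|/c2 /(_ exy)] [h'|h'].
    - by case: h; left.
    - by left; split=> // ?; case: h; right.
    - by case: h; right.
    - by right; split=> // ?; case: h; left.
  + have [_ _ d1] := ct; have [_ _ d2] := ct2.
    by move=> x [Ix|Ix] [[Tx n]|[Tx n]] //; [apply: d1 Tx|apply: d2 Tx].
- split=> // x TU; have [ox|no] := pselect (old x).
    by rewrite rold //; apply: ph; apply: oldTU.
  have [TUb _ _ /(_ no) [_ qE]] := fP _ TU; have [TU2 _] := new _ TU no.
  have [l bE] := good_head g TUb; have [l' qE'] := good_head g2 TU2; rewrite /r bE.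
  by move: qE'; rewrite qE /s /b; case: (f x).1.1 => [|a s'] /= [-> _]; [exists l|exists (s' ++ (f x).1.2 :: l)].
- move=> t z Tt; have TU : T t \/ U t by left.
  have [ot|no] := pselect (old t).
    rewrite rold // => zp; left; case: ot => [[Tt' _]|Ut]; first exact: pt zp.
    by apply: (pU t) => //; apply: mem_behead.
  have [TU2 nI] := new _ TU no.
  have T2 : front o2 t by case: TU2 => // U2; case: Tt => [[Tt n]|[]//]; case: n; apply: good_core g2 U2.
  have [TUb _ _ /(_ no) [Tb qE]] := fP _ TU; rewrite -/(b t) -/(s t) in TUb Tb qE.
  rewrite /r => zr; case sE: (s t) zr qE => [|a s'] /=.
    by move=> zp _; left; apply: (pt (b t)).
  rewrite mem_cat => + qE; case/orP=> [zs|zp]; first by right; apply: (qt t); rewrite ?qE //= mem_cat zs.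
  have [l bE] := good_head g TUb; move: zp; rewrite bE inE => /orP[/eqP ->|zl].
    by right; apply: (qt t); rewrite // qE /= mem_cat mem_head orbT.
  by left; apply: (pt (b t)) => //; rewrite bE.
- move=> u z Uu; have TU : T u \/ U u by right.
  have [ou|no] := pselect (old u).
    rewrite rold //; case: ou => [[Tu n] zp|Uu' zp]; last by left; apply: pU zp.
    by case: Uu => [/(good_core g) Iu|/(good_core g2) //]; case: ct => _ _ /(_ _ Iu).
  have U2 : core o2 u by case: Uu => // h; case: no; right.
  move=> /(rin _ _ TU no) [zs| -> |//].
    by have [_ zq _] := sq _ _ TU zs; right; apply: qU zq.
  by have [_ _ h _] := bq _ TU no; right; apply: qU h.
- split=> [u [/UZ|/UZ2] //|x [Ix|Ix] Wx]; first by left; apply: IW.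
  by right; apply: IW2.
- by move=> x; left.
- by move=> u Uu; split; [left|apply: rold; [right; left|right]].
- by move=> t Tt; have [h|h] := pselect (inner o2 t); [left; right|right; left].
- move=> t Tt; have TU : T t \/ U t by left.
  have [ot|no] := pselect (old t); last first.
    by have [_ h _ /(_ no) [Tb _]] := fP _ TU; exists (s t), (b t).
  rewrite rold //; exists [::], t; split=> //; case: ot => [[]//|Ut].
  by case: Tt => [[]//|[_ n]]; case: n; apply: good_core g Ut.
- by move=> x Ix; right.
- by move=> u Uu; right.
- by move=> x Tx n; right.
Qed.

(** Joining [o2] to a maximal region gives nothing larger, so [o2] already lies inside; its core
    vertices, lying inside it, would then contradict the hypothesis. *)
Lemma good_max o0 : good o0 -> exists o, [/\ good o, rle o0 o
  & forall o2, good o2 -> (forall u, core o2 u -> ~ inner o u) ->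
     (forall u, ~ core o2 u) /\ forall x, inner o2 x -> inner o x].
Proof.
move=> g0; pose S := {o | good o}; pose R (s t : S) := rle (sval s) (sval t).
have [||C [c0 Cc0] Ct|[o g] [le mx]] := @zorn_above S R (exist _ o0 g0).
- by move=> t; apply: rle_refl.
- by move=> s1 s2 s3; apply: rle_trans.
- have [|||o [g ub _ _]] := @good_limit (fun o => exists2 s, C s & sval s = o).
  + by exists (sval c0), c0.
  + by move=> _ [s _ <-]; apply: svalP.
  + by move=> _ _ [s1 C1 <-] [s2 C2 <-]; apply: Ct.
  + by exists (exist _ o g) => s Cs; apply: ub; exists s.
exists o; split=> // o2 g2 disj; have [o' [g' le' i2 u2 _]] := good_join g g2 disj.
have [h _ _ _] := mx (exist _ o' g') le'.
by split=> [u Uu|x /i2 /h //]; apply: (disj _ Uu); apply: h; apply: i2; apply: good_core g2 Uu.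
Qed.

End Good.
End Regions.

(** * Waves and unhindered webs *)

Section Waves.
Variable V : eqType.
Implicit Types (x y z t u v a : V) (l s : seq V) (e : V -> V -> Prop).
Implicit Types (A B I T U W X Y Z : V -> Prop) (o : region V).

Lemma bw_restrict e A I y l : bw e A (y :: l) -> (forall z, z \in l -> I z) ->
  bw (fun x z => e x z /\ I x) A (y :: l).
Proof.
elim: l y => [|x l IH] y //= [exy h] lI; split; first by split=> //; apply: lI; rewrite mem_head.
by apply: IH => // z zl; apply: lI; rewrite inE zl orbT.
Qed.

Lemma bw_restrict_in e A I y l : bw (fun x z => e x z /\ I x) A (y :: l) ->
  forall z, z \in l -> I z.
Proof. by move=> h z /(bw_edge_out h) [w [_ []]]. Qed.

Lemma orth_trunc e A I T Y q : cut (fun _ _ => False) (fun _ => False) I T ->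
  orth I T Y q -> linkage e A Y q ->
  exists q', [/\ linkage e A T q', forall t z, T t -> z \in behead (q' t) -> I z
    & forall t, T t -> exists y s, Y y /\ q y = s ++ q' t].
Proof.
move=> IT oq [[qb qu qd] qh].
have /choice[f fP] t : exists f : V * seq V * seq V, T t ->
    [/\ Y f.1.1, q f.1.1 = f.1.2 ++ t :: f.2 & forall z, z \in f.2 -> I z].
  have [Tt|] := pselect (T t); last by exists (t, [::], [::]).
  have [op /(_ _ Tt) [y Yy tq]] := oq; have [s1 [t' [s2 [qE Tt' o1 o2]]]] := op _ Yy.
  have -> : t = t' by apply: (orth_inj IT oq Yy) => //; rewrite qE mem_cat mem_head orbT.
  by exists (y, s1, s2).
exists (fun t => t :: (f t).2); split.
- split; last by move=> t Tt; exists (f t).2.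
  split=> [t /fP [Yy qE _]|t /fP [Yy qE _]|t t' z Tt Tt' zt zt'].
  + by have := qb _ Yy; rewrite qE => /bw_suffix.
  + by have := qu _ Yy; rewrite qE cat_uniq => /and3P[].
  + have [Yy qE _] := fP _ Tt; have [Yy' qE' _] := fP _ Tt'.
    have yy : (f t).1.1 = (f t').1.1.
      by apply: (qd _ _ z) => //; rewrite ?qE ?qE' mem_cat ?zt ?zt' orbT.
    apply: (orth_inj IT oq Yy) => //; first by rewrite qE mem_cat mem_head orbT.
    by rewrite yy qE' mem_cat mem_head orbT.
- by move=> t z /fP [_ _ h] /h.
- by move=> t /fP [Yy qE _]; exists (f t).1.1, (f t).1.2.
Qed.

Definition wave e A B o := good e A B (fun _ => False) o.

Lemma wave_core e A B o u : wave e A B o -> ~ core o u.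
Proof. by move=> [_ _ _ _ [h _]] /h. Qed.

Lemma wave_intro e A B I T p : cut e A I T -> linkage e A T p ->
  (forall t z, T t -> z \in behead (p t) -> I z) -> (forall x, I x -> ~ B x) ->
  wave e A B (Region I T (fun _ => False) p).
Proof.
move=> ct lp pt IB; split=> //=.
by apply: (linkage_sub _ lp) => y [].
Qed.

Lemma wave_elim e A B o : wave e A B o ->
  [/\ cut e A (inner o) (front o), linkage e A (front o) (paths o),
     forall t z, front o t -> z \in behead (paths o t) -> inner o z
   & forall x, inner o x -> ~ B x].
Proof.
move=> w; have [ct lp pt _ [_ IB]] := w; split=> //; first by apply: (linkage_sub _ lp) => y Ty; left.
by move=> x Ix /(IB _ Ix) /(wave_core w).
Qed.

Lemma wave_mem e A B o t z : wave e A B o -> front o t -> z \in paths o t -> z = t \/ inner o z.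
Proof.
move=> /wave_elim [_ [_ lh] pt _] Tt; have [l pE] := lh _ Tt.
by rewrite pE inE => /orP[/eqP|zl]; [left|right; apply: (pt t); rewrite ?pE].
Qed.

Lemma wave_max e A B o0 : wave e A B o0 ->
  exists o, [/\ wave e A B o, rle o0 o & forall o2, wave e A B o2 -> forall x, inner o2 x -> inner o x].
Proof.
move=> /good_max [o [w le mx]]; exists o; split=> // o2 w2; have [] // := mx _ w2.
by move=> u /(wave_core w2).
Qed.

Definition trivial_wave A : region V := Region (fun _ => False) A (fun _ => False) (fun x => [:: x]).

Lemma trivial_waveP e A B : wave e A B (trivial_wave A).
Proof.
apply: wave_intro => //; first by split=> // a Aa; right.
split=> [|x Ax]; last by exists [::].
by split=> // x y z _ _; rewrite !inE => /eqP <- /eqP.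
Qed.

(** Augment towards [y] using only edges with tail in [I]. Success gives a wave with the whole
    boundary and at most one new start [a0]; failure gives an orthogonal cut nearer to the sources,
    whose paths are initial pieces of paths [q t]. Either way the set of starts is under control. *)
Lemma boundary_point e A B I T q y : cut e A I (fun z => z = y \/ T z) ->
  linkage e A T q -> (forall t z, T t -> z \in behead (q t) -> I z) ->
  (forall x, I x -> ~ B x) -> ~ T y ->
  exists o, wave e A B o /\
  ([/\ inner o = I, front o = (fun z => z = y \/ T z) & exists a0, forall t, front o t ->
     src (paths o t) = Some a0 \/ exists2 t', T t' & src (paths o t) = src (q t')] \/
   (forall t, front o t -> exists2 t', T t' & src (paths o t) = src (q t'))).
Proof.
move=> ct lq qI IB nTy; pose e1 x z := e x z /\ I x.
have lq1 : linkage e1 A T q.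
  have [[qb qu qd] qh] := lq; split=> //; split=> // t Tt; have [l qE] := qh _ Tt.
  by rewrite qE; apply: bw_restrict; [rewrite -qE; apply: qb|move=> z zl; apply: (qI t); rewrite ?qE].
have [|[x [q' [a0 [s [<- lq' _ sq']]]]]|[T3 [nr oq]]] := @augment _ e1 A T (eq y) q lq1; first by move=> x <-.
  exists (Region I (fun z => z = y \/ T z) (fun _ => False) q'); split; last by left; split=> //; exists a0.
  apply: wave_intro => //; first by apply: linkage_mono lq' => // t _ z w _ _ [].
  move=> t z Tt; have [l qE] := lq'.2 _ Tt; have [[qb _ _] _] := lq'.
  by have := qb _ Tt; rewrite qE => /bw_restrict_in; apply.
have ct3 := reach_cut e1 A T3; have IT := cut_disj ct3.
have [q3 [lq3 q3I q3E]] := orth_trunc IT oq lq.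
have nry : ~ reach e1 A T3 y by apply: nr.
have rI z : I z \/ z = y \/ T z -> reach e1 A T3 z -> I z.
  case=> [//|[-> //|Tz rz]]; case: (orth_end IT oq Tz) => //; exact: lq.2.
exists (Region (fun x => I x /\ reach e1 A T3 x) T3 (fun _ => False) q3); split; last first.
  by right=> t Tt; have [t' [s [Tt' qE]]] := q3E _ Tt; exists t' => //; rewrite qE src_neq //=;
    have [l ->] := lq3.2 _ Tt.
have [cA ce _] := ct; have [cA3 ce3 d3] := ct3.
apply: wave_intro => //.
- split.
  + move=> a Aa; have [ra|] := cA3 _ Aa; [left|by right].
    by split=> //; apply: rI => //; apply: cA.
  + move=> x z [Ix rx] exz; have [rz|] := ce3 _ _ rx (conj exz Ix); [left|by right].
    by split=> //; apply: rI => //; apply: ce Ix exz.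
  + by move=> x [_]; apply: d3.
- move=> t z Tt zq; split; last exact: q3I zq.
  have [t' [s [Tt' qE]]] := q3E _ Tt; apply: (qI t') => //.
  by rewrite qE; case: s qE => //= a s _; rewrite mem_cat (mem_behead zq) orbT.
- by move=> x [/IB].
Qed.

Definition misses o a := forall t, front o t -> src (paths o t) <> Some a.

Definition delv e X x y := [/\ e x y, ~ X x & ~ X y].

Lemma delv_linkage e A X X' T p : (forall z, X z -> X' z) ->
  linkage (delv e X') (fun a => A a /\ ~ X' a) T p -> linkage (delv e X) (fun a => A a /\ ~ X a) T p.
Proof.
move=> XX; apply: linkage_mono => [t Tt x z _ _ [exz n1 n2]|t Tt x _ [Ax n1]]; split=> // /XX; by [].
Qed.

Section Web.
Variables (e : V -> V -> Prop) (A B : V -> Prop).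

(** Counting the deleted vertices as targets keeps them out of [inner]. *)
Definition wv X o := wave (delv e X) (fun a => A a /\ ~ X a) (fun x => B x \/ X x) o.

(** A wave that misses a source is a hindrance; this says that the web with [X] deleted is
    unhindered. *)
Definition unh X := forall o a, wv X o -> A a -> ~ X a -> misses o a -> False.

Lemma wv_notX X o x : wv X o -> front o x \/ inner o x -> ~ X x.
Proof.
move=> /wave_elim [_ [[pb _ _] ph] _ IB] [Tx|/IB n] Xx; last by apply: n; right.
by have := pb _ Tx; have [l ->] := ph _ Tx; case: l => [[]|z l [[]]].
Qed.

Lemma wv_path X o t z : wv X o -> front o t -> z \in paths o t -> front o z \/ inner o z.
Proof. by move=> w Tt /(wave_mem w Tt) [->|]; [left|right]. Qed.

Lemma wv_up X X' o : wv X o -> (forall z, X z -> X' z) ->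
  (forall z, X' z -> front o z \/ inner o z -> X z) -> wv X' o.
Proof.
move=> w XX X'X; have [[cA ce d] lp pt IB] := wave_elim w.
have n z : front o z \/ inner o z -> ~ X' z by move=> h X'z; apply: (wv_notX w h); apply: X'X.
split=> //.
- split=> // [a [Aa n']|x y Ix [exy n1 n2]]; first by apply: cA; split=> // /XX.
  by apply: ce Ix _; split=> // /XX.
- have [_ lp' _ _ _] := w; apply: linkage_mono lp'.
  + move=> y [Ty|/(wave_core w)//] x z xp zp [exz _ _]; split=> //; apply: n; exact: (wv_path w Ty).
  + by move=> y [Ty|/(wave_core w)//] x xp [Ax _]; split=> //; apply: n; exact: (wv_path w Ty).
- by have [_ _ _ h _] := w.
- split=> [u|x Ix [Bx|X'x]]; first exact: wave_core w.
  + by case: (IB _ Ix); left.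
  + by case: (n x) => //; right.
Qed.

Lemma wv_readd X o y : wv (fun z => z = y \/ X z) o ->
  [/\ cut (delv e X) (fun a => A a /\ ~ X a) (inner o) (fun z => z = y \/ front o z),
    linkage (delv e X) (fun a => A a /\ ~ X a) (front o) (paths o),
    forall x, inner o x -> ~ (B x \/ X x) & ~ inner o y /\ ~ front o y].
Proof.
move=> w; have [[cA ce d] lp pt IB] := wave_elim w; have nX := wv_notX w.
have nIy : ~ inner o y by move=> h; apply: (nX y); [right|left].
split; first split.
- move=> b [Ab nXb]; have [->|/eqP nby] := eqVneq b y; first by right; left.
  by have [|?|?] := cA b; [split=> // -[]|left|right; right].
- move=> x z Ix [exz n1 n2]; have [->|/eqP nzy] := eqVneq z y; first by right; left.
  have [||] := ce x z Ix; [|by left|by right; right].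
  by split=> //; [apply: nX; right|case].
- by move=> x Ix [xy|/d //]; apply: nIy; rewrite -xy.
- by apply: delv_linkage lp; right.
- by move=> x Ix [Bx|Xx]; case: (IB _ Ix); [left|right; right].
- by split=> // h; apply: (nX y); left.
Qed.

(** Put [y] back on the boundary of a hindrance of the smaller web. If [boundary_point] links [y],
    the last edge of the path to [y] starts inside a wave, hence inside the maximal wave [o], and
    then [y] is in [inner o] or [front o]. Otherwise it returns a hindrance of the web without
    [X]. *)
Lemma unh_add X o y : unh X -> wv X o -> (forall o2, wv X o2 -> forall x, inner o2 x -> inner o x) ->
  ~ inner o y -> ~ front o y -> unh (fun z => z = y \/ X z).
Proof.
move=> uX w mx nIy nTy o2 a w2 Aa na ms.
have [[cA ce _] _ _ _] := wave_elim w.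
have [_ _ pt2 _] := wave_elim w2; have [ct2 lp2 IB2 [_ nT2y]] := wv_readd w2.
have [o3 [w3 h3]] := boundary_point ct2 lp2 pt2 IB2 nT2y.
case: h3 => [[I3E T3E _]|h3]; last first.
  apply: (uX o3 a) => // [Xa|t Tt]; first by apply: na; right.
  by have [t' Tt' ->] := h3 _ Tt; apply: ms.
have [_ [[pb _ _] ph] pt3 _] := wave_elim w3.
have T3y : front o3 y by rewrite T3E; left.
have := pb _ T3y; have [l pE] := ph _ T3y; rewrite pE; case: l pE => [|x l] pE.
  by move=> /cA [].
case=> exy _; have Ix : inner o x by apply: (mx _ w3); apply: (pt3 y) => //; rewrite pE mem_head.
by case: (ce _ _ Ix exy).
Qed.

(** A deleted source is restored to any wave as a path with one vertex. *)
Lemma unh_source X a : unh X -> A a -> unh (fun z => z = a \/ X z).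
Proof.
move=> uX Aa o a' w Aa' na' ms.
have [Xa|nXa] := pselect (X a).
  apply: (uX o a') => //; last by move=> h; apply: na'; right.
  by rewrite (_ : X = fun z => z = a \/ X z) //; apply: funext => z; apply: propext; split; [right|case=> [->|]].
have [_ lp _ _] := wave_elim w; have [ct [lp1 _] IB [_ nTa]] := wv_readd w; have [_ _ pt _] := wave_elim w.
have nT t : front o t -> t <> a by move=> Tt ta; apply: nTa; rewrite -ta.
apply: (uX (Region (inner o) (fun z => z = a \/ front o z) (fun _ => False) (upd (paths o) a [:: a])) a') => //.
- apply: wave_intro => //.
  + split; last by move=> x [->|Tx]; [rewrite updE; exists [::]|rewrite updN; [apply: lp.2|apply: nT]].
    apply: fam_add => // y Ty z; rewrite inE => /eqP ->; apply/negP => /(wv_path w Ty) /(wv_notX w); by apply; left.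
  + by move=> t z [->|Tt]; [rewrite updE|rewrite updN; [apply: pt|apply: nT]].
- by move=> h; apply: na'; right.
- move=> t [->|Tt] /=; first by rewrite updE => -[aa']; apply: na'; left.
  by rewrite updN; [apply: ms|apply: nT].
Qed.

(** The hard case is a hindrance with a path through [v] in its inside: deleting [v] destroys the
    path to [t0]. Relinking [t0] by [boundary_point] brings at most one new start, which cannot be
    both the missed source [a] and the start [a'] of the destroyed path. So one of the two is
    missed. *)
Lemma unh_remove X v : ~ A v -> unh (fun z => z = v \/ X z) -> unh X.
Proof.
move=> nAv uv o a w Aa na ms; have [[cA ce d] lp pt IB] := wave_elim w; have nX := wv_notX w.
have nav : ~ (a = v \/ X a) by case=> [av|//]; apply: nAv; rewrite -av.
have mono T' : (forall t, T' t -> front o t /\ v \notin paths o t) ->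
    linkage (delv e (fun z => z = v \/ X z)) (fun a => A a /\ ~ (a = v \/ X a)) T' (paths o).
  move=> h; apply: linkage_mono (linkage_sub _ lp); last by move=> t /h [].
    move=> t /h [_ vt] x z xp zp [exz n1 n2]; split=> // -[E|//]; move: vt; by rewrite -E ?xp ?zp.
  move=> t /h [_ vt] x xp [Ax n1]; split=> // -[E|//]; move: vt; by rewrite -E xp.
have [Iv|nIv] := pselect (inner o v); last first.
  apply: (uv (Region (inner o) (fun t => front o t /\ t <> v) (fun _ => False) (paths o)) a) => //.
  + apply: wave_intro.
    * split.
      - move=> b [Ab nb]; have [|?|?] := cA b; [by split=> // Xb; apply: nb; right|by left|right; split=> //].
        by move=> bv; apply: nb; left.
      - move=> x z Ix [exz n1 n2]; have [||] := ce x z Ix; [|by left|right; split=> //].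
          by split=> // Xb; [apply: n1|apply: n2]; right.
        by move=> bv; apply: n2; left.
      - by move=> x Ix [/(d _ Ix)].
    * apply: mono => t [Tt nt]; split=> //; apply/negP => /(wave_mem w Tt) [vt|//].
      by apply: nt.
    * by move=> t z [Tt _]; apply: pt.
    * by move=> x Ix [Bx|[xv|Xx]]; [apply: (IB _ Ix); left|apply: nIv; rewrite -xv|apply: (IB _ Ix); right].
  + by move=> t [Tt _]; apply: ms.
have cut' : cut (delv e (fun z => z = v \/ X z)) (fun a => A a /\ ~ (a = v \/ X a))
    (fun x => inner o x /\ x <> v) (front o).
  split.
  - move=> b [Ab nb]; have [|?|?] := cA b; [by split=> // Xb; apply: nb; right|left; split=> //|by right].
    by move=> bv; apply: nb; left.
  - move=> x z [Ix _] [exz n1 n2]; have [||] := ce x z Ix; [|left; split=> //|by right].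
      by split=> // Xb; [apply: n1|apply: n2]; right.
    by move=> bv; apply: n2; left.
  - by move=> x [Ix _]; apply: d.
have IB' x : inner o x /\ x <> v -> ~ (B x \/ (x = v \/ X x)).
  by move=> [Ix nx] [Bx|[xv //|Xx]]; apply: (IB _ Ix); [left|right].
have beh t z : front o t -> v \notin paths o t -> z \in behead (paths o t) -> inner o z /\ z <> v.
  move=> Tt vt zp; split; first exact: pt zp.
  by move=> zv; move: vt; rewrite -zv mem_behead.
have [[t0 T0 v0]|nv] := pselect (exists2 t0, front o t0 & v \in paths o t0); last first.
  have nv' t : front o t -> v \notin paths o t by move=> Tt; apply/negP => vt; apply: nv; exists t.
  apply: (uv (Region (fun x => inner o x /\ x <> v) (front o) (fun _ => False) (paths o)) a) => //.
  apply: wave_intro => //; first by apply: mono => t Tt; split=> //; apply: nv'.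
  by move=> t z Tt; apply: beh => //; apply: nv'.
have [[pb pu pd] ph] := lp.
have vT t : front o t /\ t <> t0 -> front o t /\ v \notin paths o t.
  move=> [Tt nt]; split=> //; apply/negP => vt; apply: nt; exact: pd vt v0.
have [||||[]//|o3 [w3 h3]] := @boundary_point (delv e (fun z => z = v \/ X z)) (fun a => A a /\ ~ (a = v \/ X a))
   (fun x => B x \/ (x = v \/ X x)) (fun x => inner o x /\ x <> v) (fun t => front o t /\ t <> t0) (paths o) t0.
- have [c1 c2 c3] := cut'; have dec t : front o t -> t = t0 \/ front o t /\ t <> t0.
    by have [->|/eqP nt] := eqVneq t t0; [left|right].
  split.
  + by move=> b /c1 [|/dec]; [left|right].
  + by move=> x y Ix /(c2 _ _ Ix) [|/dec]; [left|right].
  + by move=> x Ix [xt|[Tx _]]; apply: (c3 _ Ix) => //; rewrite xt.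
- exact: mono.
- by move=> t z /[dup] /vT [_ vt] [Tt _]; apply: beh.
- exact: IB'.
case: h3 => [[_ T3E [a0 a0P]]|h3]; last first.
  apply: (uv o3 a) => // t /h3 [t' [Tt' _] ->]; exact: ms.
have [a' sa' [Aa' na']] := bw_src (pb _ T0).
have [a0a|a0a] := pselect (a0 = a); last first.
  apply: (uv o3 a) => // t /a0P [-> [//]|[t' [Tt' _] ->]]; exact: ms.
have aa' : a' <> a by move=> h; apply: (ms _ T0); rewrite sa' h.
apply: (uv o3 a') => //.
- by case=> // h; apply: nAv; rewrite -h.
- move=> t /a0P [-> [h]|[t' [Tt' nt'] -> h]]; first by apply: aa'; rewrite -h a0a.
  by apply: nt'; apply: (pd _ _ a') => //; apply: src_mem.
Qed.

Lemma unh_removes X s : (forall v, v \in s -> A v -> X v) ->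
  unh (fun z => z \in s \/ X z) -> unh X.
Proof.
elim: s => [|v s IH] sX.
  rewrite (_ : (fun z => _) = X) //; apply: funext => z; apply: propext; split; last by right.
  by case.
move=> h; apply: IH => [w ws|]; first by apply: sX; rewrite inE ws orbT.
have [Av|nAv] := pselect (A v); last first.
  apply: (unh_remove nAv); move: h; congr unh; apply: funext => z; apply: propext; rewrite inE.
  split=> [[/orP[/eqP|zs]|Xz]|[->|[->|Xz]]]; rewrite ?eqxx ?orbT; by [left|right; left|right; right|right].
move: h; congr unh; apply: funext => z; apply: propext; rewrite inE; split=> [[/orP[/eqP ->|]|]|[]].
- by right; apply: sX; rewrite ?mem_head.
- by left.
- by right.
- by left; apply/orP; right.
- by right.
Qed.

End Web.
End Waves.

(** The dummy counter makes an enumeration return to every [z] after any given stage. *)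
Lemma unbounded_code (V : countType) (z : V) n :
  exists2 k, n <= k & exists m : nat, unpickle k = Some (m, z).
Proof.
have [[m le]|h] := pselect (exists m : nat, n <= pickle (m, z)).
  by exists (pickle (m, z)) => //; exists m; rewrite pickleK.
have : size [seq pickle (i, z) | i <- iota 0 n.+1] <= size (iota 0 n).
  apply: uniq_leq_size.
    rewrite map_inj_uniq ?iota_uniq // => i j /(pcan_inj pickleK) [] //.
  move=> _ /mapP[i _ ->]; rewrite mem_iota /= ltnNge; apply/negP => le.
  by apply: h; exists i.
by rewrite size_map !size_iota ltnn.
Qed.

(** * The Erdos-Menger theorem for countable graphs *)

Section SafeLink.
Variables (V : countType) (e : V -> V -> Prop) (A B : V -> Prop).
Hypothesis noA : forall x y, e x y -> ~ A y.
Implicit Types (x y z a g : V) (X : V -> Prop) (G : seq V) (o : region V).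

Let unhe := unh e A B.
Let wve := wv e A B.

Definition safe_path X a l := [/\ bw (delv e X) (eq a) l, uniq l,
  exists2 b, B b & hd b l & unhe (fun z => z \in l \/ X z)].

Definition growth X a (st : seq V * region V) := let: (G, o) := st in
  [/\ a \in G,
      forall g, g \in G -> [/\ ~ X g, ~ B g, A g -> g = a
        & exists l, bw (delv e X) (eq a) (g :: l) /\ {subset l <= G}],
      unhe (fun z => z \in G \/ X z), wve (fun z => z \in G \/ X z) o
    & forall o2, wve (fun z => z \in G \/ X z) o2 -> forall x, inner o2 x -> inner o x].

(** If the new vertex were a target, the walk to it inside [G] would contain a safe path, after
    giving back the explored vertices off that path. *)
Lemma grow X a st n : unhe X -> A a -> ~ X a -> ~ (exists l, safe_path X a l) ->
  growth X a st -> exists st', [/\ growth X a st', {subset st.1 <= st'.1}, rle st.2 st'.2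
    & forall (m : nat) x y, unpickle n = Some (m, y) -> x \in st.1 -> e x y -> ~ X y ->
       [\/ y \in st'.1, inner st.2 y | front st.2 y]].
Proof.
case: st => G o uX Aa nXa nsafe gr.
have [[m [x [y [ny [xG exy nXy] [nG nI nT]]]]]|h] := pselect (exists (m : nat) x y, [/\ unpickle n = Some (m, y),
    [/\ x \in G, e x y & ~ X y] & [/\ ~ y \in G, ~ inner o y & ~ front o y]]); last first.
  exists (G, o); split=> //=; first exact: rle_refl.
  move=> m x y ny xG exy nXy; apply: contrapT => nor; apply: h; exists m, x, y; split=> //.
  by split=> h; apply: nor; [constructor 1|constructor 2|constructor 3].
have [aG GP uG wG mG] := gr; have nAy := noA exy.
have XGE : (fun z => z = y \/ (z \in G \/ X z)) = (fun z => z \in y :: G \/ X z).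
  apply: funext => z; apply: propext; rewrite inE.
  split=> [[->|[->|Xz]]|[/orP[/eqP|zs]|Xz]]; rewrite ?eqxx ?orbT; by [left|right; left|right; right|right].
have uyG : unhe (fun z => z \in y :: G \/ X z) by rewrite -XGE; apply: unh_add nI nT.
have [nXx nBx _ [l [bl lG]]] := GP _ xG.
have byx : bw (delv e X) (eq a) (y :: x :: l) by split.
have yxG : {subset y :: x :: l <= y :: G}.
  by move=> z; rewrite !inE => /or3P[->|/eqP ->|/lG ->] //; rewrite ?xG ?orbT.
have [By|nBy] := pselect (B y).
  case: nsafe; have [l' [bl' ul' sl']] := bw_uniq byx; exists (y :: l'); split=> //.
    by exists y => //; exists l'.
  apply: (@unh_removes _ _ _ _ _ (y :: G)).
    move=> v; rewrite inE => /orP[/eqP -> //|/GP [_ _ h _] /h ->].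
    by left; apply: src_mem; apply: bw_eq_src bl'.
  move: uyG; congr unh; apply: funext => z; apply: propext.
  by split=> [[zG|Xz]|[zG|[/sl' /yxG zG|Xz]]]; [left|right; right|left|left|right].
have wyG : wve (fun z => z \in y :: G \/ X z) o.
  apply: wv_up wG _ _ => z; first by case=> [zG|Xz]; [left; rewrite inE zG orbT|right].
  by case=> [|Xz]; [rewrite inE => /orP[/eqP -> []//|zG]; left|right].
have [o' [w' le mx]] := wave_max wyG.
exists (y :: G, o'); split=> //=.
- split=> //; first by rewrite inE aG orbT.
  move=> g; rewrite inE => /orP[/eqP ->|gG].
    split=> //; exists (x :: l); split=> // z; rewrite inE => /orP[/eqP ->|/lG zG]; by rewrite inE ?xG ?zG orbT.
  have [h1 h2 h3 [lg [h4 h5]]] := GP _ gG; split=> //; exists lg; split=> // z /h5 zG.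
  by rewrite inE zG orbT.
- by move=> z zG; rewrite inE zG orbT.
- move=> m' x' y'; rewrite ny => -[_ <-] _ _ _; constructor 1; exact: mem_head.
Qed.

(* If the vertices reachable from [a] never reach [B], they form together with
   the limit of the waves a wave that misses [a]. *)
Lemma safe_link X a : unhe X -> A a -> ~ X a -> exists l, safe_path X a l.
Proof.
move=> uX Aa nXa; apply: contrapT => nsafe.
have ua : unhe (fun z => z \in [:: a] \/ X z).
  have := unh_source uX Aa; congr unh; apply: funext => z; apply: propext; rewrite inE.
  by split=> [[->|]|[/eqP|]]; rewrite ?eqxx; [left|right|left|right].
have [Ba|nBa] := pselect (B a).
  by apply: nsafe; exists [:: a]; split=> //; exists a => //; exists [::].
have [o0 [w0 _ mx0]] := wave_max (trivial_waveP (delv e (fun z => z \in [:: a] \/ X z))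
  (fun b => A b /\ ~ (b \in [:: a] \/ X b)) (fun x => B x \/ (x \in [:: a] \/ X x))).
have g0 : growth X a ([:: a], o0).
  split=> //; first exact: mem_head.
  by move=> g; rewrite inE => /eqP ->; split=> //; exists [::].
pose S := {st | growth X a st}.
have /choice[next nextP] (ns : nat * S) : exists s' : S, [/\ {subset (sval ns.2).1 <= (sval s').1},
     rle (sval ns.2).2 (sval s').2
    & forall (m : nat) x y, unpickle ns.1 = Some (m, y) -> x \in (sval ns.2).1 -> e x y -> ~ X y ->
       [\/ y \in (sval s').1, inner (sval ns.2).2 y | front (sval ns.2).2 y]].
  case: ns => n [st g]; have [st' [g' h1 h2 h3]] := grow n uX Aa nXa nsafe g.
  by exists (exist _ st' g').
pose f := fix f n : S := if n is n'.+1 then next (n', f n') else exist _ _ g0.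
pose G n := (sval (f n)).1; pose o n := (sval (f n)).2.
have fG n : growth X a (G n, o n) by move: (svalP (f n)); rewrite /G /o; case: (sval (f n)).
have stepP n : [/\ {subset G n <= G n.+1}, rle (o n) (o n.+1)
    & forall (m : nat) x y, unpickle n = Some (m, y) -> x \in G n -> e x y -> ~ X y ->
       [\/ y \in G n.+1, inner (o n) y | front (o n) y]] by apply: (nextP (n, f n)).
have mono n m : n <= m -> {subset G n <= G m} /\ rle (o n) (o m).
  move=> /subnK <-; elim: (m - n) => [|k [h1 h2]]; first by split=> //; exact: rle_refl.
  have [h3 h4 _] := stepP (k + n); split; first by move=> z /h1 /h3.
  exact: rle_trans h4.
pose Gw z := exists n, z \in G n; pose XG z := Gw z \/ X z.
have wn n : wve (fun z => z \in G n \/ X z) (o n) by have [] := fG n.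
have wXG n : wve XG (o n).
  apply: wv_up (wn n) _ _ => z; first by case=> [zG|Xz]; [left; exists n|right].
  case=> [[m zm]|Xz] oz; last by right.
  have [le|lt] := leqP m n; first by left; have [h _] := mono _ _ le; apply: h.
  have [_ [i1 _ f1 _]] := mono _ _ (ltnW lt).
  case: (wv_notX (wn m) (x := z)); last by left.
  by case: oz => [/f1 []|/i1]; [right|left|right].
have [||_ _ [n1 _ <-] [n2 _ <-]|ow [ww ub iw fw]] := @good_limit _ (delv e XG) (fun b => A b /\ ~ XG b)
    (fun x => B x \/ XG x) (fun _ => False) (fun o' => exists2 n, True & o n = o').
- by exists (o 0), 0.
- by move=> _ [n _ <-]; apply: wXG.
- by have [le|/ltnW le] := leqP n1 n2; [left|right]; have [_] := mono _ _ le.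
have {}ww : wve XG ow by [].
have nXG := wv_notX ww.
have [[cA ce d] lp pt IB] := wave_elim ww.
have GP z : Gw z -> [/\ ~ X z, ~ B z & A z -> z = a].
  by case=> n zn; have [_ h _ _ _] := fG n; have [? ? ? _] := h _ zn.
have Ga : Gw a by exists 0; rewrite mem_head.
apply: (uX (Region (fun x => inner ow x \/ Gw x) (front ow) (fun _ => False) (paths ow)) a) => //; last first.
  move=> t Tt /src_mem ta; apply: (nXG a); last by left.
  exact: (wv_path ww Tt).
apply: wave_intro.
- split.
  + move=> b [Ab nXb]; have [Gb|nGb] := pselect (Gw b); first by left; right.
    by case: (cA b) => [|?|?]; [split=> // -[]|left; left|right].
  + move=> x z xI [exz nXx nXz]; have [Gz|nGz] := pselect (Gw z); first by left; right.
    have nXGz : ~ XG z by case.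
    case: xI => [Ix|[n xn]].
      have nXGx : ~ XG x by apply: nXG; right.
      by have [||] := ce x z Ix; [|left; left|right].
    (* Some later stage treats [z]; by then it is inside or on the front of the wave, or it is added
       to [G]. *)
    have [k nk [m km]] := unbounded_code z n.
    have [h1 _] := mono _ _ nk; have [_ _ h2] := stepP k.
    have [i1 _ f1 _] := ub (o k) (ex_intro2 _ _ k I erefl).
    case: (h2 m x z km (h1 _ xn) exz nXz) => [zk|/i1|/f1 []].
    * by case: nGz; exists k.+1.
    * by left; left.
    * by left; left.
    * by right.
  + move=> x [/d //|Gx] Tx; apply: (nXG x); [by left|by left].
- by apply: delv_linkage lp; right.
- by move=> t z Tt /(pt _ _ Tt); left.
- move=> x [Ix|/GP [nX nB _]] [Bx|Xx] //; first by apply: (IB _ Ix); left.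
  by apply: (IB _ Ix); right; right.
Qed.

Lemma src_source P z : bw e A P -> z \in P -> A z -> src P = Some z.
Proof.
move=> bP zP; case/splitPr: zP bP => s1 [|y s2] bP Az; first by rewrite src_cat.
by have [/noA] := bw_suffix bP.
Qed.

Lemma flatten_inj (ps : seq (seq V)) P P' z : uniq (flatten ps) -> P \in ps -> P' \in ps ->
  z \in P -> z \in P' -> P = P'.
Proof.
elim: ps => // Q ps IH /=; rewrite cat_uniq => /and3P[_ /hasPn h u].
have dis R : R \in ps -> z \in R -> z \in Q -> False.
  by move=> Rp zR; apply/negP; apply: h; apply/flattenP; exists R.
rewrite !inE => /orP[/eqP ->|Pp] /orP[/eqP ->|Pp'] // zP zP'.
- by case: (dis _ Pp').
- by case: (dis _ Pp).
- exact: IH.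
Qed.

(** A safe path leaves the web unhindered after its deletion, so the sources are linked one after
    another along an enumeration, and each path is final once chosen. *)
Lemma all_links : unhe (fun _ => False) -> exists s, fam e A A s /\
  forall a, A a -> src (s a) = Some a /\ exists2 b, B b & hd b (s a).
Proof.
move=> u0.
pose inv (ps : seq (seq V)) := [/\ uniq (flatten ps), forall P, P \in ps -> bw e A P /\ exists2 b, B b & hd b P
  & unhe (fun z => z \in flatten ps)].
have i0 : inv [::] by split=> //; move: u0; congr unh; apply: funext => z; apply: propext.
pose S := {ps | inv ps}.
have /choice[next nextP] (ns : nat * S) : exists s' : S, {subset sval ns.2 <= sval s'} /\
    forall a, unpickle ns.1 = Some a -> A a -> exists2 P, P \in sval s' & src P = Some a.
  case: ns => n [ps i]; have [[a [na Aa nin]]|h] := pselect (exists a, [/\ unpickle n = Some a, A a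
      & ~ exists2 P, P \in ps & src P = Some a]); last first.
    exists (exist _ ps i); split=> // a na Aa; apply: contrapT => nex.
    by apply: h; exists a.
  have [u b uh] := i.
  have naf : ~ a \in flatten ps.
    move=> /flattenP [P Pp aP]; apply: nin; exists P => //; apply: src_source aP Aa.
    by have [] := b _ Pp.
  have [l [bl ul hl ul']] := safe_link uh Aa naf.
  have bl1 : bw e A l by apply: bw_eq Aa; apply: bw_mono bl => // x y _ _ [].
  have il : inv (l :: ps).
    split=> /=; last by move: ul'; congr unh; apply: funext => z; apply: propext; rewrite mem_cat;
      split=> [[->|->]|/orP]; rewrite ?orbT.
      rewrite cat_uniq ul u andbT /=; apply/hasPn => z zp; apply/negP => zl.
      case: l bl zl {ul hl ul' bl1} => // y l bl zl.
      have [zl0|zl0] := boolP (z \in l); first by have [w [_ []]] := bw_edge_out bl zl0.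
      move: zl; rewrite inE (negPf zl0) orbF => /eqP zy.
      by case: l bl {zl0} => [/= ay|x l /= [[_ _]]]; [apply: naf; rewrite ay -zy|rewrite -zy].
    by move=> P; rewrite inE => /orP[/eqP ->|/b].
  exists (exist _ (l :: ps) il); split=> /= [P Pp|a']; first by rewrite inE Pp orbT.
  by rewrite na => -[<-] _; exists l; rewrite ?mem_head //; apply: bw_eq_src bl.
pose f := fix f n : S := if n is n'.+1 then next (n', f n') else exist _ _ i0.
pose ps n := sval (f n).
have mono n m : n <= m -> {subset ps n <= ps m}.
  move=> /subnK <-; elim: (m - n) => // k IH P /IH; have [h _] := nextP (k + n, f (k + n)); exact: h.
have /choice[s sP] a : exists P, A a -> src P = Some a /\ exists n, P \in ps n.
  have [Aa|] := pselect (A a); last by exists [::].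
  have [_ /(_ a)] := nextP (pickle a, f (pickle a)); rewrite /= pickleK => /(_ erefl Aa) [P Pp sP].
  by exists P => _; split=> //; exists (pickle a).+1.
have psP n : inv (ps n) by apply: svalP.
exists s; split; last first.
  move=> a /sP [sa [n sn]]; split=> //; have [_ b _] := psP n; by have [] := b _ sn.
split=> [a /sP [sa [n sn]]|a /sP [sa [n sn]]|a a' z /sP [sa [n sn]] /sP [sa' [n' sn']] za za'].
- have [_ b _] := psP n; by have [] := b _ sn.
- have [u _ _] := psP n; elim: (ps n) u sn => //= P qs IH; rewrite cat_uniq inE => /and3P[uP _ uq].
  by case/orP=> [/eqP ->|/IH]; [|apply].
- have h : s a \in ps (maxn n n') by apply: mono sn; rewrite leq_maxl.
  have h' : s a' \in ps (maxn n n') by apply: mono sn'; rewrite leq_maxr.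
  have [u _ _] := psP (maxn n n'); have := flatten_inj u h h' za za'.
  by move=> E; move: sa; rewrite E sa' => -[].
Qed.

End SafeLink.

Section Menger.
Variables (V : countType) (e : V -> V -> Prop) (A B : V -> Prop).
Implicit Types (x y z t : V).

(** Outside a maximal wave, the web that starts at its front is unhindered: a wave there can be
    appended to [o], so its inside lies in [inner o] and contains no front vertex. Hence every front
    vertex is on its boundary, and as edges into the front have been removed, each is linked by the
    path consisting of itself. *)
Lemma menger : exists o s, [/\ wave e A B o, forall o2, wave e A B o2 -> forall x, inner o2 x -> inner o x,
    fam e (front o) (front o) s,
    forall t, front o t -> src (s t) = Some t /\ exists2 b, B b & hd b (s t)
  & forall t z, front o t -> z \in s t -> ~ inner o z /\ (front o z -> z = t)].
Proof.
have [o [w _ mx]] := wave_max (trivial_waveP e A B).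
have [[cA ce d] lp pt IB] := wave_elim w.
pose e' x y := [/\ e x y, ~ inner o x, ~ inner o y & ~ front o y].
have noT x y : e' x y -> ~ front o y by case.
have u : unh e' (front o) B (fun _ => False).
  move=> o2 a w2 Ta _ ms; have [[cA2 ce2 d2] lp2 pt2 IB2] := wave_elim w2.
  have [[qb qu qd] qh] := lp2; have [[pb pu pd] ph] := lp.
  have out t z : front o2 t -> z \in paths o2 t -> ~ inner o z.
    move=> Tt zq; have := qb _ Tt; have [l qE] := qh _ Tt; move: zq; rewrite qE => zq bq.
    by have [[Tz _]|[x [_ [[]]]]] // := bw_edge_in bq zq; move=> Iz; apply: d Iz Tz.
  have noT2 x y : delv e' (fun _ => False) x y -> ~ (front o y /\ ~ False) by move=> [/noT h _ _] [].
  have /choice[f fP] t : exists f : seq V * V, front o2 t -> paths o2 t = rcons f.1 f.2.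
    have [Tt|] := pselect (front o2 t); last by exists ([::], t).
    by have [l ->] := qh _ Tt; exists (belast t l, last t l) => _; rewrite -lastI.
  have fT t : front o2 t -> front o (f t).2.
    by move=> Tt; have := qb _ Tt; rewrite fP // => /bw_rcons [].
  have fS t z : front o2 t -> z \in (f t).1 -> ~ front o z.
    move=> Tt zf Tz; have zq : z \in paths o2 t by rewrite fP // mem_rcons inE zf orbT.
    have := src_source noT2 (qb _ Tt) zq (conj Tz id); rewrite fP // src_rcons => -[zE].
    by have := qu _ Tt; rewrite fP // rcons_uniq zE zf.
  have f1q t z : front o2 t -> z \in (f t).1 -> z \in paths o2 t.
    by move=> Tt zf; rewrite fP // mem_rcons inE zf orbT.
  have f2q t : front o2 t -> (f t).2 \in paths o2 t by move=> Tt; rewrite fP // mem_rcons mem_head.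
  have pin t z : front o t -> z \in paths o t -> inner o z \/ z = t.
    by move=> Tt /(wave_mem w Tt) []; [right|left].
  have bqe t : front o2 t -> bw e (front o) (rcons (f t).1 (f t).2).
    by move=> Tt; rewrite -fP //; apply: bw_mono (qb _ Tt) => [x y _ _ [[]]|x _ []].
  have fr : fam e A (front o2) (fun t => (f t).1 ++ paths o (f t).2).
    apply: (fam_glue (And3 pb pu pd)) => //.
    - move=> x x' Tx Tx' E; apply: (qd _ _ (f x).2) => //; first exact: f2q.
      by rewrite E; apply: f2q.
    - by move=> x Tx; have := qu _ Tx; rewrite fP // rcons_uniq => /andP[].
    - by move=> x x' z Tx Tx' zx zx'; apply: (qd _ _ z) => //; apply: f1q.
    - move=> x y z Tx Ty zf; apply/negP => /(pin _ _ Ty) [|zy].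
        by apply: (out _ _ Tx); apply: f1q.
      by apply: (fS _ _ Tx zf); rewrite zy.
    - move=> x Tx; have [l pE] := ph _ (fT _ Tx); rewrite pE.
      by apply: (@bw_swap _ _ (front o) _ _ _ [::]); [rewrite cats1; apply: bqe|rewrite -pE; apply: pb; apply: fT].
  pose o3 := Region (fun x => inner o x \/ inner o2 x) (front o2) (fun _ => False)
    (fun t => (f t).1 ++ paths o (f t).2).
  have T12 x : front o x -> (inner o x \/ inner o2 x) \/ front o2 x.
    by move=> Tx; have [||] := cA2 x; [split=> //|left; right|right].
  have w3 : wave e A B o3.
    apply: wave_intro.
    - split.
      + by move=> b /cA [|/T12]; [left; left|].
      + move=> x y Ix exy; have [Ix1|nIx] := pselect (inner o x).
          by have [|/T12] := ce _ _ Ix1 exy; [left; left|].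
        case: Ix => // Ix.
        have [Iy|nIy] := pselect (inner o y); first by left; left.
        have [/T12//|nTy] := pselect (front o y).
        have exy' : delv e' (fun _ => False) x y by split.
        by have [|] := ce2 x y Ix exy'; [left; right|right].
      + by move=> x [Ix|/d2 //] Tx; have [l qE] := qh _ Tx; apply: (out _ _ Tx _ Ix); rewrite qE mem_head.
    - split=> // t Tt; have [l qE] := qh _ Tt; have [l' pE] := ph _ (fT _ Tt).
      move: qE; rewrite fP // pE; case: (f t).1 => [[-> _]|z l1 [-> _]]; by [exists l'|exists (l1 ++ (f t).2 :: l')].
    - move=> t z Tt; case fE: (f t).1 => [|y l] /=; first by move=> /(pt _ _ (fT _ Tt)); left.
      have q2 u : u \in rcons l (f t).2 -> inner o2 u by move=> ul; apply: (pt2 t) => //; rewrite fP // fE.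
      rewrite mem_cat => /orP[zl|/(pin _ _ (fT _ Tt)) [|->]]; first by right; apply: q2; rewrite mem_rcons inE zl orbT.
        by left.
      by right; apply: q2; rewrite mem_rcons mem_head.
    - by move=> x [/IB //|Ix] Bx; apply: (IB2 _ Ix); left.
  have I2 x : inner o2 x -> inner o x by move=> Ix; apply: (mx _ w3); right.
  have [/I2 Ia|Ta2] := cA2 a (conj Ta id); first by apply: d Ia Ta.
  have := qb _ Ta2; have [l qE] := qh _ Ta2; have := ms _ Ta2; rewrite qE; case: l {qE} => [//|x l] _.
  by case=> -[[_ _ _ /(_ Ta)]].
have [s [fs sP]] := all_links noT u.
exists o, s; split=> // [|t z Tt zs].
  have [sb su sd] := fs; split=> // t Tt; apply: bw_mono (sb _ Tt) => // x y _ _ [] //.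
have [sb _ _] := fs; have bt := sb _ Tt; have [st _] := sP _ Tt.
split; last by move=> Tz; have := src_source noT bt zs Tz; rewrite st => -[].
case: (s t) bt zs => // y l bt zl.
have [Tz|[x [_ []//]]] := bw_edge_in bt zl.
by move=> Iz; apply: d Iz Tz.
Qed.

End Menger.

(** * Uncrossing with a maximal converse wave *)

Section Converse.
Variable V : eqType.
Implicit Types (x y z t b : V) (l s : seq V) (e : V -> V -> Prop).
Implicit Types (A B I T X Y S : V -> Prop) (o : region V).

Definition op e x y : Prop := e y x.

Lemma op_rev e a b l : bw e (eq a) (b :: l) ->
  hd a (rev (b :: l)) /\ bw (op e) (eq b) (rev (b :: l)).
Proof. exact: (@bw_rev _ (op e)). Qed.

Lemma rev_op e a b l : bw (op e) (eq a) (b :: l) ->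
  hd a (rev (b :: l)) /\ bw e (eq b) (rev (b :: l)).
Proof. exact: bw_rev. Qed.

Lemma src_rev y l : src (rev (y :: l)) = Some y.
Proof. by rewrite rev_cons src_rcons. Qed.

Lemma wave_unreachable e B Y o x : wave (op e) Y B o ->
  reach e B (front o) x -> ~ inner o x /\ ~ front o x.
Proof.
move=> /wave_elim [[_ ce _] _ _ IB] [l [bl nT]]; split; last by apply: nT; rewrite mem_head.
elim: l x bl nT => [|y l IH] x; first by move=> /= Bx _ /IB.
move=> [eyx bl] nT Ix; have [Iy|Ty] := ce _ _ Ix eyx; last by apply: (nT y) => //; rewrite inE mem_head orbT.
by apply: (IH y) => // z zl; apply: nT; rewrite inE zl orbT.
Qed.

(* Otherwise [S'], obtained from the front of the maximal wave by moving it
   towards [B] inside [I], is the front of a larger converse wave. *)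
Lemma uncross e B Y o I T (n : V -> seq V) : wave (op e) Y B o ->
  (forall o2, wave (op e) Y B o2 -> forall x, inner o2 x -> inner o x) ->
  (forall b, B b -> I b \/ T b) ->
  (forall x y, I x -> reach e B (front o) x -> e x y -> I y \/ T y) ->
  (forall x, I x -> ~ T x) ->
  fam e T T n -> (forall t, T t -> src (n t) = Some t) ->
  (forall t, T t -> exists h, hd h (n t) /\ ~ reach e B (front o) h) ->
  (forall t z, T t -> z \in n t -> z <> t -> ~ I z /\ ~ T z) ->
  forall x, reach e B (front o) x -> I x.
Proof.
move=> w mx BIT ce IT [nb nu nd] ns nh nI.
have [[cY cJ JS] [[pb pu pd] ph] pJ JB] := wave_elim w.
set S := front o in ce nh *; set J := inner o in cY cJ JS pJ JB mx *; set R := reach e B S in ce nh *.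
have RJ x : R x -> ~ J x /\ ~ S x := @wave_unreachable e B Y o x w.
have [RB Re _] := reach_cut e B S.
(* This is the boundary of the corner that the two cuts have in common; [J'] is everything beyond
   that corner. *)
pose S' x := S x /\ (I x \/ T x) \/ T x /\ R x.
pose J' x := ~ (I x /\ R x) /\ ~ S' x.
have JJ' x : J x -> J' x.
  by move=> Jx; split=> [[_ /RJ []]|[[Sx _]|[_ /RJ []]]] //; apply: JS Jx Sx.
have bwt t : T t -> bw e (eq t) (n t) by move=> Tt; apply: bw_from_src (nb _ Tt) (ns _ Tt).
(* The path [n x] of a vertex of [T] in [R] has to cross [S]; at its first vertex in [S] it is
   continued by a path of the wave. That vertex lies outside [I] and [T], so it is not one of the
   vertices of [S] that remain in [S']. *)
have /choice[f fP] x : exists f : seq V * V * seq V, S' x ->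
    [/\ S f.1.2, S x -> f.1.1 = [::] /\ f.1.2 = x
     & ~ S x -> [/\ rev (n x) = f.1.1 ++ f.1.2 :: f.2, forall z, z \in f.1.1 -> R z & exists l, f.1.1 = x :: l]].
  have [Sx|nSx] := pselect (S x); first by exists ([::], x, [::]).
  have [[Tx Rx]|nTR] := pselect (T x /\ R x); last by exists ([::], x, [::]); case=> [[]|].
  have [h [[l nE] nRh]] := nh _ Tx; have bx := bwt _ Tx.
  have ctx : cut e (eq x) R S by split=> // [a <-|y /RJ []//]; left.
  have [s sn Ss] : exists2 s, s \in n x & S s.
    by rewrite nE in bx *; apply: (cut_cross ctx bx).
  have /split_first [m [s1 [rest [def Ss1 mS]]]] : exists2 z, z \in rev (n x) & S z.
    by exists s; rewrite ?mem_rev.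
  have [l' revE] : hd x (rev (n x)) by rewrite nE in bx *; have [] := op_rev bx.
  exists (m, s1, rest) => _; split=> // _; split=> //=; last first.
    move: revE; rewrite def; case: (m) => [[xs _]|y m' [-> _]]; last by exists m'.
    by case: nSx; rewrite -xs.
  move=> z zm; have [m1 [m2 mE]] := in_split zm.
  have bz : bw e (eq x) (z :: rev m1).
    have E : n x = rev (m2 ++ s1 :: rest) ++ z :: rev m1.
      by rewrite -[n x]revK def mE -!catA rev_cat /= rev_cons cat_rcons.
    by rewrite E in bx; apply: bw_suffix bx.
  apply: (cut_avoid ctx bz); last exact: mem_head.
  move=> u; rewrite inE mem_rev => /orP[/eqP ->|um]; first exact: mS.
  by apply: mS; rewrite mE mem_cat um.
pose k x := (f x).1.1; pose b x := (f x).1.2.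
have kn x z : S' x -> z \in k x -> [/\ R z, z \in n x & T x].
  move=> S'x zk; have [_ h1 h2] := fP _ S'x; have [Sx|nSx] := pselect (S x).
    by have [h _] := h1 Sx; move: zk; rewrite /k h.
  have [def kR _] := h2 nSx; split; first exact: kR.
    by rewrite -mem_rev def mem_cat zk.
  by case: S'x => [[]|[]].
have bn x : S' x -> ~ S x -> [/\ T x, R x & b x \in n x /\ ~ I (b x) /\ ~ T (b x)].
  move=> S'x nSx; have [Sb _ /(_ nSx) [def _ _]] := fP _ S'x.
  have [Tx Rx] : T x /\ R x by case: S'x => [[]|].
  have bx : b x \in n x by rewrite -mem_rev def mem_cat mem_head orbT.
  by split=> //; split=> //; apply: (nI x) => // bE; apply: nSx; rewrite -bE.
have bS x : S' x -> S (b x) by case/fP.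
have bid x : S' x -> S x -> b x = x by move=> S'x Sx; have [_ /(_ Sx) [] ] := fP _ S'x.
have fr : fam (op e) Y S' (fun x => k x ++ paths o (b x)).
  apply: (fam_glue (And3 pb pu pd)) => //.
  - move=> x x' S'x S'x'; have [Sx|nSx] := pselect (S x); have [Sx'|nSx'] := pselect (S x').
    + by rewrite !bid.
    + rewrite bid // => xE; have [_ _ [_ [nIb nTb]]] := bn _ S'x' nSx'.
      by rewrite -xE in nIb nTb; case: S'x => [[_ [/nIb|/nTb]]|[_ /RJ []]].
    + rewrite (bid x') // => xE; have [_ _ [_ [nIb nTb]]] := bn _ S'x nSx.
      by rewrite xE in nIb nTb; case: S'x' => [[_ [/nIb|/nTb]]|[_ /RJ []]].
    + have [Tx _ [bx _]] := bn _ S'x nSx; have [Tx' _ [bx' _]] := bn _ S'x' nSx'.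
      by move=> E; apply: (nd _ _ (b x)) => //; rewrite E.
  - move=> x S'x; have [_ h1 h2] := fP _ S'x; have [Sx|nSx] := pselect (S x).
      by have [h _] := h1 Sx; rewrite /k h.
    have [def _ _] := h2 nSx; have Tx : T x by case: S'x => [[]|[]].
    by have := nu _ Tx; rewrite -rev_uniq def cat_uniq => /andP[].
  - move=> x x' z S'x S'x' /(kn _ _ S'x) [_ zn Tx] /(kn _ _ S'x') [_ zn' Tx']; exact: nd zn zn'.
  - move=> x y z S'x Sy /(kn _ _ S'x) [Rz _ _]; apply/negP => /(wave_mem w Sy) [zy|Jz].
      by have [_] := RJ _ Rz; rewrite zy.
    by have [] := RJ _ Rz.
  - move=> x S'x; have [_ h1 h2] := fP _ S'x; have [Sx|nSx] := pselect (S x).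
      by rewrite /k /b; have [-> ->] := h1 Sx; apply: pb.
    have [def _ _] := h2 nSx; have Tx : T x by case: S'x => [[]|[]].
    have [h [[l nE] _]] := nh _ Tx; have bx := bwt _ Tx.
    have brev : bw (op e) (eq h) (rev (n x)) by rewrite nE in bx *; have [] := op_rev bx.
    have [l' pE] := ph _ (bS _ S'x); rewrite pE; rewrite def in brev.
    by apply: bw_swap brev _; rewrite -pE; apply: pb; apply: bS.
have kJ' x z : S' x -> z \in k x -> z <> x -> J' z.
  move=> S'x zk zx; have [Rz zn Tx] := kn _ _ S'x zk; have [nIz nTz] := nI _ _ Tx zn zx.
  by split=> [[]|[[_ []]|[]]].
have w' : wave (op e) Y B (Region J' S' (fun _ => False) (fun x => k x ++ paths o (b x))).
  apply: wave_intro.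
  - split.
    + move=> y Yy; have [S'y|nS'y] := pselect (S' y); [by right|left; split=> //].
      by move=> [_ /RJ [nJ nS]]; case: (cY _ Yy).
    + move=> x y [nIRx nS'x] eyx; have [S'y|nS'y] := pselect (S' y); [by right|left; split=> //].
      move=> [Iy Ry]; have ITx := ce _ _ Iy Ry eyx.
      have [Rx|Sx] := Re _ _ Ry eyx; last by apply: nS'x; left.
      by case: ITx => [Ix|Tx]; [apply: nIRx|apply: nS'x; right].
    + by move=> x [].
  - split=> // x S'x; have [_ h1 h2] := fP _ S'x; have [Sx|nSx] := pselect (S x).
      by rewrite /k /b; have [-> ->] := h1 Sx; apply: ph.
    by have [_ _ [l kE]] := h2 nSx; rewrite /k kE; exists (l ++ paths o (b x)).
  - move=> x z S'x; have [_ h1 h2] := fP _ S'x; have [Sx|nSx] := pselect (S x).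
      by rewrite /k /b; have [-> ->] := h1 Sx; move=> /(pJ _ _ Sx) /JJ'.
    have [def kR [l kE]] := h2 nSx; rewrite -/(k x) -/(b x) in def kR kE.
    have [Tx Rx [bx [nIb nTb]]] := bn _ S'x nSx.
    rewrite kE /= mem_cat => /orP[zl|/(wave_mem w (bS _ S'x)) [->|/JJ' //]].
      apply: (kJ' x) => //; first by rewrite kE inE zl orbT.
      move=> zx; have := nu _ Tx; rewrite -rev_uniq def kE /= mem_cat -zx zl //.
    by split=> [[]|[[_ []]|[]]].
  - move=> x [nIR nS'] Bx; have := BIT _ Bx; have := RB _ Bx.
    case=> [Rx [Ix|Tx]|Sx h]; [by apply: nIR|by apply: nS'; right|by apply: nS'; left].
have J'J x : J' x -> J x by apply: (mx _ w').
have RIT x : R x -> I x \/ T x.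
  move=> Rx; apply: contrapT => nIT; have [nJ nS] := RJ _ Rx; apply: nJ; apply: J'J.
  by split=> [[Ix _]|[[//]|[Tx _]]]; apply: nIT; [left|right].
(* A vertex of [T] in [R] has a next vertex on its path, outside [I] and [T]. By what has been shown
   it is not in [R], so it is in [S]; but it is also in [J'], hence in [J], which is disjoint from
   [S]. *)
move=> x Rx; have [//|Tx] := RIT _ Rx; exfalso.
have [h [[l nE] nRh]] := nh _ Tx; have bx := bwt _ Tx.
have [l' revE] : hd x (rev (n x)) by rewrite nE in bx *; have [] := op_rev bx.
have : bw (op e) (eq h) (rev (n x)) by rewrite nE in bx *; have [] := op_rev bx.
have := nu _ Tx; rewrite -rev_uniq revE; case: l' revE => [|y l'] revE.
  by move=> _ /= hx; apply: nRh; rewrite hx.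
move=> /= /andP[xl _] [exy _].
have yn : y \in n x by rewrite -mem_rev revE !inE eqxx orbT.
have yx : y <> x by move=> E; move: xl; rewrite E mem_head.
have [nIy nTy] := nI _ _ Tx yn yx.
have [/RIT []//|Sy] := Re _ _ Rx exy.
apply: (JS y) => //; apply: J'J; split=> [[]//|[[_ []]//|[]]//].
Qed.

End Converse.

(** * Pym's linkage theorem *)

Section Splits.
Variable V : eqType.
Implicit Types (x y : V) (c d m l : seq V).

Lemma uniq_split x c d c' d' : uniq (c ++ x :: d) -> c ++ x :: d = c' ++ x :: d' -> d = d'.
Proof.
elim: c c' => [|a c IH] [|b c'] /=.
- by move=> _ [].
- by case/andP=> xd _ [xb dE]; move: xd; rewrite dE mem_cat mem_head orbT.
- by case/andP=> ac _ [ax _]; move: ac; rewrite ax mem_cat mem_head orbT.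
- by case/andP=> _ u [_]; apply: IH.
Qed.

Lemma first_split x y m l m' l' : m ++ x :: l = m' ++ y :: l' ->
  x \notin m' -> y \notin m -> x = y.
Proof.
elim: m m' => [|a m IH] [|b m'] /= [].
- by [].
- by move=> -> _; rewrite mem_head.
- by move=> -> _ _; rewrite mem_head.
- by move=> _ /IH h; rewrite !inE !negb_or => /andP[_ h1] /andP[_ h2]; apply: h.
Qed.

End Splits.

Section Pym.
Variable V : eqType.
Variables (e : V -> V -> Prop) (A S : V -> Prop) (K : eqType) (E1 : K -> Prop) (p : V -> seq V) (q : K -> seq V).
Hypotheses (lp : linkage e A S p) (fq : fam e A E1 q).
Hypothesis (qh : forall y, E1 y -> exists2 s, S s & hd s (q y)).
Implicit Types (x z s : V) (y : K).

Definition crossing x := exists2 y, E1 y & x \in q y.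

(* Every [p s] proposes to the paths [q y] it meets, in order; [q y] rejects a
   proposal when it receives another one further along. *)
Inductive rejected : V -> Prop :=
  Rejected x y c d z s m r of E1 y & q y = c ++ x :: d & z \in d & S s & p s = m ++ z :: r
    & (forall w, w \in m -> crossing w -> rejected w) : rejected x.

Definition proposed x := exists s m r, [/\ S s, p s = m ++ x :: r
  & forall w, w \in m -> crossing w -> rejected w].

(** This is stable matching in the manner of Gale and Shapley: [s] follows [p s] up to its first
    crossing that is not rejected and changes to the other family there. As a least fixed point,
    rejection makes sense for infinite families without rounds. Every [q y] receives a proposal at
    its head, and the proposal furthest along [q y] is never rejected, so the start of [q y] gets
    used. *)
Lemma pym : exists r, [/\ linkage e A S r,
  forall s z, S s -> z \in r s -> z \in p s \/ exists2 y, E1 y & z \in q y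
  & forall y, E1 y -> exists2 s, S s & src (r s) = src (q y)].
Proof.
have [[pb pu pd] ph] := lp; have [qb qu qd] := fq.
have rejI x y c d z : E1 y -> q y = c ++ x :: d -> z \in d -> proposed z -> rejected x.
  by move=> Ey qE zd [s [m [r [Ss pE mr]]]]; apply: (Rejected Ey qE zd Ss pE mr).
(* The tuple [f] is [(m, x, (r, c), d)], where [p s = m ++ x :: r] and [q y = c ++ x :: d]. *)
pose ok f s := [/\ p s = f.1.1.1 ++ f.1.1.2 :: f.1.2.1, exists2 y, E1 y & q y = f.1.2.2 ++ f.1.1.2 :: f.2,
     ~ rejected f.1.1.2 & forall w, w \in f.1.1.1 -> crossing w -> rejected w].
have /choice[g gP] s : exists g : option ((seq V * V) * (seq V * seq V) * seq V), S s ->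
    if g is Some f then ok f s else forall w, w \in p s -> crossing w -> rejected w.
  have [Ss|] := pselect (S s); last by exists None.
  have [/split_first [m [x [r [pE [[y Ey xq] nr] mr]]]]|nex] :=
    pselect (exists2 x, x \in p s & crossing x /\ ~ rejected x).
    have [c [d qE]] := in_split xq.
    exists (Some (m, x, (r, c), d)) => _; split=> //=; first by exists y.
    by move=> w /mr nw cw; apply: contrapT => nrw; apply: nw.
  by exists None => _ w wp cw; apply: contrapT => nrw; apply: nex; exists w.
pose mp s := if g s is Some f then f.1.1.1 else p s.
pose tl s := if g s is Some f then f.1.1.2 :: f.2 else [::].
pose r s := mp s ++ tl s.
have mpp s z : S s -> z \in mp s -> z \in p s.
  by move=> /gP; rewrite /mp; case: (g s) => // f [-> _ _ _] zm; rewrite mem_cat zm.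
have mrej s z : S s -> z \in mp s -> crossing z -> rejected z /\ proposed z.
  move=> Ss zm cz; have := gP _ Ss; move: zm; rewrite /mp; case: (g s) => [f|] zm.
    move=> [pE _ _ mr]; split; first exact: mr.
    have [m1 [m2 mE]] := in_split zm.
    exists s, m1, (m2 ++ f.1.1.2 :: f.1.2.1); split=> //; first by rewrite pE mE -catA.
    by move=> w wm; apply: mr; rewrite mE mem_cat wm.
  move=> mr; split; first exact: mr.
  have [m1 [m2 mE]] := in_split zm.
  by exists s, m1, m2; split=> // w wm; apply: mr; rewrite mE mem_cat wm.
have tlP s z : S s -> z \in tl s -> exists x y c d, [/\ tl s = x :: d, E1 y, q y = c ++ x :: d & ~ rejected x]
    /\ [/\ x \in p s & proposed x].
  move=> /[dup] Ss /gP; rewrite /tl; case: (g s) => // f [pE [y Ey qE] nr mr] _.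
  exists f.1.1.2, y, f.1.2.2, f.2; split; split=> //; first by rewrite pE mem_cat mem_head orbT.
  by exists s, f.1.1.1, f.1.2.1.
have mtl s s' z : S s -> S s' -> z \in mp s -> z \in tl s' -> False.
  move=> Ss Ss' zm zt; have [x [y [c [d [[tE Ey qE nr] _]]]]] := tlP _ _ Ss' zt.
  have cz : crossing z by exists y; rewrite // qE mem_cat -tE zt orbT.
  have [rz pz] := mrej _ _ Ss zm cz; move: zt; rewrite tE inE => /orP[/eqP zx|zd].
    by apply: nr; rewrite -zx.
  by apply: nr; apply: rejI zd pz; [exact: Ey|exact: qE].
have tltl s s' z : S s -> S s' -> z \in tl s -> z \in tl s' -> s = s'.
  move=> Ss Ss' zt zt'; have [x [y [c [d [[tE Ey qE nr] [xp px]]]]]] := tlP _ _ Ss zt.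
  have [x' [y' [c' [d' [[tE' Ey' qE' nr'] [xp' px']]]]]] := tlP _ _ Ss' zt'.
  have ? : y = y' by apply: (qd _ _ z) => //; rewrite ?qE ?qE' mem_cat -?tE -?tE' ?zt ?zt' orbT.
  subst y'; have [xx|xx] := eqVneq x x'; first by apply: (pd _ _ x) => //; rewrite xx.
  exfalso; have xq' : x' \in c ++ x :: d by rewrite -qE qE' mem_cat mem_head orbT.
  move: xq'; rewrite mem_cat inE eq_sym (negPf xx) /= => /orP[x'c|x'd]; last first.
    by apply: nr; apply: rejI Ey qE x'd px'.
  have [c1 [c2 cE]] : exists c1 c2, c = c1 ++ x' :: c2 by case/splitPr: x'c => a b; exists a, b.
  apply: nr'; apply: (rejI _ y c1 (c2 ++ x :: d)) px => //; first by rewrite qE cE -catA.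
  by rewrite mem_cat mem_head orbT.
have tlu s : S s -> uniq (tl s).
  move=> Ss; case tE: (tl s) => [//|a l]; have [|x [y [c [d [[tE' Ey qE nr] _]]]]] := tlP s a Ss.
    by rewrite tE mem_head.
  by have := qu _ Ey; rewrite qE -tE' tE cat_uniq => /and3P[].
have mpu s : S s -> uniq (mp s).
  move=> Ss; have := pu _ Ss; have := gP _ Ss; rewrite /mp; case: (g s) => // f [-> _ _ _].
  by rewrite cat_uniq => /andP[].
exists r; split.
- split; first split.
  + move=> s Ss; have := pb _ Ss; have := gP _ Ss; rewrite /r /mp /tl; case: (g s) => [f|_]; last by rewrite cats0.
    by move=> [-> [y Ey qE] _ _] bp; apply: bw_swap bp _; have := qb _ Ey; rewrite qE => /bw_suffix.
  + move=> s Ss; rewrite cat_uniq mpu // tlu // andbT; apply/hasPn => z zt; apply/negP => zm.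
    exact: mtl zm zt.
  + move=> s s' z Ss Ss'; rewrite !mem_cat => /orP[zm|zt] /orP[zm'|zt'].
    * by apply: (pd _ _ z) => //; apply: mpp.
    * by case: (mtl s s' z).
    * by case: (mtl s' s z).
    * exact: tltl zt zt'.
  + move=> s Ss; have [l pE] := ph _ Ss; have := gP _ Ss; rewrite /r /mp /tl; case: (g s) => [f|_]; last first.
      by rewrite cats0 pE; exists l.
    by rewrite /ok pE => -[E _ _ _]; case: f.1.1.1 E => [|a m] [-> _]; [exists f.2|exists (m ++ f.1.1.2 :: f.2)].
- move=> s z Ss; rewrite mem_cat => /orP[/(mpp _ _ Ss)|zt]; first by left.
  by have [x [y [c [d [[tE Ey qE nr] _]]]]] := tlP _ _ Ss zt; right; exists y; rewrite // qE mem_cat -tE zt orbT.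
- move=> y Ey; have [s0 Ss0 [l0 qE0]] := qh Ey; have [l1 pE1] := ph _ Ss0.
  have /split_last [c [x [d [qE [s [m [rr [Ss pE mr]]]] dn]]]] : exists2 x, x \in q y & proposed x.
    by exists s0; rewrite ?qE0 ?mem_head //; exists s0, [::], l1.
  have nr : ~ rejected x.
    move=> rx; case: rx qE pE => x' y' c' d' z s' m' r' Ey' qE' zd' Ss' pE' mr' qE pE.
    have ? : y = y' by apply: (qd _ _ x') => //; rewrite ?qE ?qE' mem_cat mem_head orbT.
    subst y'; have dd : d = d' by apply: (@uniq_split _ x' c d c' d'); rewrite -?qE //; apply: qu.
    by apply: (dn z); [rewrite dd|exists s', m', r'].
  exists s => //; have cx : crossing x by exists y; rewrite // qE mem_cat mem_head orbT.
  have xps : x \in p s by rewrite pE mem_cat mem_head orbT.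
  have [xm|xm] := boolP (x \in mp s); first by have [] := mrej _ _ Ss xm cx.
  have := gP _ Ss; move: xm; rewrite /r /mp /tl; case: (g s) => [f|]; last by rewrite xps.
  move=> xm [pE' [y' Ey' qE'] nr' mr'].
  have xE : x = f.1.1.2.
    apply: (@first_split _ x f.1.1.2 m rr f.1.1.1 f.1.2.1) => //; first by rewrite -pE.
    apply/negP => fm; apply: nr'; apply: mr fm _; exists y'; rewrite // qE' mem_cat mem_head orbT //.
  have ? : y = y' by apply: (qd _ _ x) => //; rewrite ?qE ?qE' ?xE mem_cat mem_head orbT.
  by subst y'; rewrite qE' !src_cat.
Qed.

End Pym.

(** * Orthogonal linkages that cover prescribed endpoints *)

Section EM.
Variables (V : countType) (e : V -> V -> Prop) (B Y : V -> Prop).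
Implicit Types (x y z t s : V) (E : V -> Prop).

(** Reversal exchanges heads and starts, so the reversed family is indexed by the old starts. *)
Lemma fam_op S w : fam (op e) Y S w -> (forall s, S s -> exists2 b, B b & hd b (w s)) ->
  exists P, linkage e B (fun y => exists2 s, S s & src (w s) = Some y) P /\
  forall y, (exists2 s, S s & src (w s) = Some y) ->
    exists s, [/\ S s, src (w s) = Some y & P y = rev (w s)].
Proof.
move=> [wb wu wd] wh; pose E y := exists2 s, S s & src (w s) = Some y.
have /choice[c cP] y : exists s, E y -> S s /\ src (w s) = Some y.
  by have [[s Ss sy]|] := pselect (E y); [exists s|exists y].
exists (fun y => rev (w (c y))); split; last by move=> y /cP [Sc cy]; exists (c y).
split; first split=> [y|y|y y' z] /=.
- move=> /cP [Sc cy]; have [b Bb [l wE]] := wh _ Sc.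
  have := bw_from_src (wb _ Sc) cy; rewrite wE => /rev_op [_ h]; exact: bw_eq h Bb.
- by move=> /cP [Sc _]; rewrite rev_uniq; apply: wu.
- move=> /cP [Sc cy] /cP [Sc' cy']; rewrite !mem_rev => zc zc'.
  by have cc := wd _ _ _ Sc Sc' zc zc'; move: cy; rewrite cc cy' => -[].
- move=> y /cP [Sc cy]; have [b Bb [l wE]] := wh _ Sc.
  by have := bw_from_src (wb _ Sc) cy; rewrite wE => /rev_op [].
Qed.

(** In the reversed graph with sources [Y], [menger] yields a maximal wave and disjoint paths from
    its front to [B]. Pym's theorem, applied to the paths of this wave and to the pieces of the
    [q y] between [y] and the front, lets the front be linked so that every endpoint in [E1] is
    used. Gluing both parts and reversing them gives paths that cross the front exactly once. *)
Lemma em_paths E1 q : (forall y, E1 y -> Y y) -> linkage e B E1 q ->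
  exists o E P, [/\ wave (op e) Y B o, forall o2, wave (op e) Y B o2 -> forall x, inner o2 x -> inner o x,
    forall y, E1 y -> E y, forall y, E y -> Y y
  & linkage e B E P /\ orth (reach e B (front o)) (front o) E P].
Proof.
move=> EY [[qb qu qd] qh].
have [o [st [w mx fst sP sI]]] := menger (op e) Y B.
have [[cY cJ JS] lp pJ JB] := wave_elim w; have [[pb pu pd] ph] := lp.
set S := front o in cY cJ JS pJ lp pb pu pd ph fst sP sI.
set J := inner o in cY cJ JS pJ JB sI.
have RJ x : reach e B S x -> ~ J x /\ ~ S x := @wave_unreachable _ e B Y o x w.
have [RB Re _] := reach_cut e B S.
have /choice[f fP] y : exists f : seq V * V * seq V, E1 y ->
    [/\ q y = f.1.1 ++ f.1.2 :: f.2, S f.1.2 & forall z, z \in f.1.1 -> ~ S z].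
  have [Ey|] := pselect (E1 y); last by exists ([::], y, [::]).
  suff /split_first [m [s [l [qE Ss mS]]]] : exists2 z, z \in q y & S z by exists (m, s, l).
  apply: contrapT => nS; have [l qE] := qh _ Ey; have := qb _ Ey; rewrite qE => bq.
  have Ry : reach e B S y.
    by exists l; split=> // z zl Sz; apply: nS; exists z; rewrite ?qE.
  by have [nJ nSy] := RJ _ Ry; case: (cY y (EY _ Ey)).
pose Q y := (f y).1.2 :: rev (f y).1.1.
have revQ y : E1 y -> exists2 l, rev (rcons (f y).1.1 (f y).1.2) = Q y & q y = rcons (f y).1.1 (f y).1.2 ++ l.
  by move=> /fP [qE _ _]; exists (f y).2; rewrite ?rev_rcons // cat_rcons.
have Qq y z : E1 y -> z \in Q y -> z \in q y.
  by move=> Ey; have [l <- ->] := revQ _ Ey; rewrite mem_rev mem_cat => ->.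
have srcQ y : E1 y -> src (Q y) = Some y.
  move=> Ey; have [l <- qE] := revQ _ Ey; have [l' qE'] := qh _ Ey; move: qE; rewrite qE'.
  by case: (rcons _ _) (size_rcons (f y).1.1 (f y).1.2) => //= a l0 _ [<- _]; apply: src_rev.
have fQ : fam (op e) Y E1 Q.
  split=> [y Ey|y Ey|y y' z Ey Ey'].
  - have [qE Ss mS] := fP _ Ey; have [l rE qE'] := revQ _ Ey; have [l' qE''] := qh _ Ey.
    have bs : bw e (eq (f y).1.2) (rcons (f y).1.1 (f y).1.2).
      by have := qb _ Ey; rewrite qE -cats1 => bq; apply: (bw_swap bq).
    have [l1 rcE] : exists l1, rcons (f y).1.1 (f y).1.2 = y :: l1.
      by case: (rcons _ _) (size_rcons (f y).1.1 (f y).1.2) qE' => //= a l0 _; rewrite qE'' => -[<- _]; exists l0.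
    by move: bs; rewrite rcE => /op_rev [_]; rewrite -rcE rE => /bw_eq; apply; apply: EY.
  - by have [l <- qE] := revQ _ Ey; rewrite rev_uniq; have := qu _ Ey; rewrite qE cat_uniq => /andP[].
  - by move=> /(Qq _ _ Ey) zq /(Qq _ _ Ey') zq'; apply: (qd _ _ z).
have QJ y z : E1 y -> z \in Q y -> J z \/ S z.
  move=> Ey; have [qE Ss mS] := fP _ Ey; rewrite inE mem_rev => /orP[/eqP ->|zm]; first by right.
  have := fQ; move=> [/(_ _ Ey) + _ _]; rewrite /Q.
  have [m1 [m2 mE]] := in_split zm.
  rewrite mE rev_cat rev_cons cat_rcons -cat_cons => /bw_suffix bz.
  have cJS : cut (op e) Y J S by [].
  left; apply: (cut_avoid cJS bz); last exact: mem_head.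
  move=> u; rewrite inE mem_rev => /orP[/eqP ->|um]; apply: mS; first exact: zm.
  by rewrite mE mem_cat um.
have [|r [[[rb ru rd] rh] rin rE1]] := pym lp fQ; first by move=> y /fP [_ Ss _]; exists (f y).1.2 => //; exists (rev (f y).1.1).
have rJS t z : S t -> z \in r t -> J z \/ S z.
  move=> St /(rin _ _ St) [/(wave_mem w St) [->|]|[y Ey /(QJ _ _ Ey)]] //; by [right|left].
have rS t z : S t -> z \in r t -> S z -> z = t.
  by move=> St zr Sz; apply: (rd _ _ z) => //; apply: hd_mem; apply: rh.
have [sb su sd] := fst.
have /choice[c cP] t : exists c, S t -> st t = rcons c t.
  have [St|] := pselect (S t); last by exists [::].
  have [+ _] := sP _ St; case/lastP: (st t) => // c z; rewrite src_rcons => -[->]; by exists c.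
have cst t z : S t -> z \in c t -> z \in st t by move=> St zc; rewrite cP // mem_rcons inE zc orbT.
have cJ' t z : S t -> z \in c t -> ~ J z /\ ~ S z.
  move=> St zc; have [nI nS] := sI _ _ St (cst _ _ St zc); split=> // Sz.
  by have := su _ St; move: zc; rewrite (nS Sz) cP // rcons_uniq => ->.
have fW : fam (op e) Y S (fun t => c t ++ r t).
  apply: (@fam_glue _ _ _ Y S S r c id) => //.
  - by move=> t St; have := su _ St; rewrite cP // rcons_uniq => /andP[].
  - by move=> t t' z St St' zc zc'; apply: (sd _ _ z) => //; apply: cst.
  - move=> t t' z St St' zc; apply/negP => /(rJS _ _ St') zJ; by have [? ?] := cJ' _ _ St zc; case: zJ.
  - move=> t St; have [l rE] := rh _ St; rewrite rE.
    apply: (@bw_swap _ _ S Y (c t) t [::]); last by rewrite -rE; apply: rb.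
    by rewrite cats1 -(cP _ St); apply: sb.
have hW t : S t -> exists2 b, B b & hd b (c t ++ r t).
  move=> St; have [_ [b Bb [l sE]]] := sP _ St; exists b => //; have [l' ->] := rh _ St.
  move: sE; rewrite cP //; case: (c t) => [|a c'] [-> _]; by [exists l'|exists (c' ++ t :: l')].
have srcW t : S t -> src (c t ++ r t) = src (r t) by move=> St; have [l ->] := rh _ St; rewrite src_cat.
have [P [lP PE]] := fam_op fW hW.
exists o, (fun y => exists2 s, S s & src (c s ++ r s) = Some y), P; split=> //.
- by move=> y Ey; have [s Ss sE] := rE1 _ Ey; exists s; rewrite // srcW // sE srcQ.
- by move=> y [s Ss]; rewrite srcW // => sy; have [y' ] := bw_src (rb _ Ss); rewrite sy => -[<-].
split=> //.
have revE t : S t -> exists l, r t = t :: l /\ rev (c t ++ r t) = rev l ++ t :: rev (c t).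
  by move=> St; have [l ->] := rh _ St; exists l; rewrite rev_cat rev_cons cat_rcons.
split=> [y Ey|t St].
  have [t [St sy ->]] := PE _ Ey; have [l [rE ->]] := revE _ St.
  exists (rev l), t, (rev (c t)); split=> // z; rewrite mem_rev => zl.
    have zr : z \in r t by rewrite rE inE zl orbT.
    have nS : ~ S z.
      by move=> Sz; have := ru _ St; move: zl; rewrite (rS _ _ St zr Sz) rE /= => ->.
    split=> // /RJ [nJ _]; by case: (rJS _ _ St zr).
  have [_ [b Bb [l' sE]]] := sP _ St; have [sr _] := sP _ St.
  have bs := bw_from_src (sb _ St) sr; rewrite sE in bs; have [_] := rev_op bs; rewrite -sE cP // rev_rcons => bt.
  have /in_split [c1 [c2 cE]] : z \in rev (c t) by rewrite mem_rev.
  exists c2; split.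
    by move: bt; rewrite cE -cat_cons => /bw_suffix /bw_eq; apply.
  move=> u uz Su; have uc : u \in c t by rewrite -mem_rev cE mem_cat uz orbT.
  by have [] := cJ' _ _ St uc.
have [l [rE vE]] := revE _ St.
have [y sy] : exists y, src (r t) = Some y by rewrite rE; apply: src_some.
have Ey : exists2 s, S s & src (c s ++ r s) = Some y by exists t; rewrite ?srcW.
exists y => //; have [t' [St' sy' ->]] := PE _ Ey.
have tt : t = t'.
  move: sy'; rewrite srcW // => sy'; apply: (rd _ _ y) => //; exact: src_mem.
by rewrite -tt mem_rev mem_cat rE mem_head orbT.
Qed.

End EM.

(** * Counting modulo finite changes *)

Section Counting.
Variable V : eqType.
Implicit Types (x y z t u v : V) (l s : seq V) (e : V -> V -> Prop).
Implicit Types (A I T X Y : V -> Prop).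

(* The infinitely many paths that are not modified keep their labels, so only
   finitely many paths have to be matched with labels. *)
Lemma count (K : eqType) Y Y2 T (q : V -> seq V) (lab : V -> V + K -> Prop) s (Kl : seq K) (X' : seq V) :
  (forall y y' z, Y2 y -> Y2 y' -> z \in q y -> z \in q y' -> y = y') ->
  (forall y, Y y -> Y2 y) -> uniq X' -> (forall x, x \in X' -> Y2 x /\ ~ Y x) ->
  (forall y, Y2 y -> exists2 t, t \in q y & T t) ->
  (forall t, T t -> exists k, lab t k) ->
  (forall t t' k, T t -> T t' -> lab t k -> lab t' k -> t = t') ->
  (forall t y, T t -> lab t (inl y) -> Y y /\ (y \notin s -> t \in q y)) ->
  (forall t i, T t -> lab t (inr i) -> i \in Kl) ->
  size X' <= size Kl.
Proof.
move=> qd YY uX XY qT labE labI labY labK.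
pose s' := [seq y <- undup s | `[< Y y >]].
have s'P y : y \in s' = (y \in s) && `[< Y y >] by rewrite mem_filter mem_undup andbC.
have : size (X' ++ s') <= size ([seq inr i | i <- Kl] ++ [seq inl y | y <- s'] : seq (V + K)).
  apply: (@size_le_matching _ _ _ (fun y k => exists t, [/\ t \in q y, T t & lab t k])).
  - rewrite cat_uniq uX filter_uniq ?undup_uniq // andbT /=; apply/hasPn => y.
    by rewrite s'P => /andP[_ /asboolP Yy]; apply/negP => /XY [].
  - move=> y; rewrite mem_cat => yl.
    have Y2y : Y2 y by case/orP: yl => [/XY []//|]; rewrite s'P => /andP[_ /asboolP /YY].
    have [t tq Tt] := qT _ Y2y; have [[y'|i] lk] := labE _ Tt; last first.
      exists (inr i); last by exists t.
      by rewrite mem_cat map_f //; apply: labK lk.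
    exists (inl y'); last by exists t.
    have [Yy' h] := labY _ _ Tt lk; rewrite mem_cat map_f ?orbT // s'P; apply/andP; split; last exact/asboolP.
    apply: contraT => ns; have tq' := h ns; have yy := qd _ _ _ Y2y (YY _ Yy') tq tq'.
    subst y'; case/orP: yl => [/XY []//|]; by rewrite s'P (negPf ns).
  - move=> y y' k yl y'l [t [tq Tt lk]] [t' [tq' Tt' lk']].
    have YX z : z \in X' ++ s' -> Y2 z.
      by rewrite mem_cat => /orP[/XY []//|]; rewrite s'P => /andP[_ /asboolP /YY].
    have tt := labI _ _ _ Tt Tt' lk lk'; subst t'; by apply: qd tq tq'; apply: YX.
by rewrite !size_cat !size_map leq_add2r.
Qed.

Lemma bw_steps e e' A l :
  (forall s1 z x s2, l = s1 ++ z :: x :: s2 -> e x z -> e' x z) -> bw e A l -> bw e' A l.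
Proof.
elim: l => // y [|x l] IH ee //= [exy h]; split; first exact: (ee [::]) exy.
by apply: IH h => s1 z x' s2 lE; apply: (ee (y :: s1) _ _ s2); rewrite lE.
Qed.

(* Disjoint paths use at most one edge into [v]. *)
Lemma one_pred e A Y q v : linkage e A Y q -> exists c : seq V,
  [/\ size c <= 1, forall x, x \in c -> e x v
    & linkage (fun x y => e x y /\ (y = v -> x \in c)) A Y q].
Proof.
move=> [[qb qu qd] qh].
have step s1 z x s2 y : Y y -> q y = s1 ++ z :: x :: s2 -> e x z.
  by move=> Yy qE; have := qb _ Yy; rewrite qE => /bw_suffix [].
have [[y [s1 [x [s2 [Yy qE]]]]]|nex] := pselect (exists y s1 x s2, Y y /\ q y = s1 ++ v :: x :: s2).
  exists [:: x]; split=> // [x'|]; first by rewrite inE => /eqP ->; apply: step qE.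
  split=> //; split=> // y' Yy'; apply: bw_steps (qb _ Yy') => s1' z x' s2' qE' exz; split=> // zv.
  have yy : y' = y by apply: (qd _ _ v) => //; rewrite ?qE ?qE' ?zv mem_cat mem_head orbT.
  have := qu _ Yy; rewrite qE => u; have E : s1 ++ v :: x :: s2 = s1' ++ v :: x' :: s2'.
    by rewrite -qE -yy qE' zv.
  by have [-> _] := uniq_split u E; rewrite mem_head.
exists [::]; split=> //; split=> //; split=> // y' Yy'; apply: bw_steps (qb _ Yy') => s1' z x' s2' qE' exz.
by split=> // zv; case: nex; exists y', s1', x', s2'; rewrite qE' zv.
Qed.

Lemma linkage_tail_in e A X Y p : linkage (delv e X) (fun a => A a /\ ~ X a) Y p ->
  forall y z, Y y -> z \in p y -> ~ X z.
Proof.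
move=> [[pb _ _] ph] y z Yy; have [l pE] := ph _ Yy; have := pb _ Yy; rewrite pE => bp zp.
by have [[]|[x [_ []]]] := bw_edge_in bp zp.
Qed.

Lemma infinite_list X n : (forall l, exists u, X u /\ u \notin l) ->
  exists c, [/\ size c = n, uniq c & forall x, x \in c -> X x].
Proof.
move=> inf; elim: n => [|n [c [sc uc cX]]]; first by exists [::].
have [u [Xu uc']] := inf c; exists (u :: c); rewrite /= sc uc uc'; split=> // x.
by rewrite inE => /orP[/eqP ->|/cX].
Qed.

(** Delete the finite set [D] of vertices on the paths to be kept. A cut that blocks augmentation in
    the rest becomes, together with [D], a cut of the whole graph that has room for at most
    [size Kv] additional endpoints. But by assumption a larger finite part of [X] can be added at
    once. *)
Lemma augment_fixing e A Y X p (K : seq V) : linkage e A Y p -> (forall y, y \in K -> Y y) ->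
  (forall l, exists u, X u /\ u \notin l) ->
  (forall c : seq V, (forall x, x \in c -> X x) -> exists q s, linkage e A (fun z => Y z \/ z \in c) q /\
     forall y, Y y -> y \notin s -> q y = p y) ->
  exists u q s, [/\ X u, linkage e A (fun z => Y z \/ z = u) q,
     forall y, y \in K -> q y = p y & forall y, Y y -> y \notin s -> q y = p y].
Proof.
move=> lp KY inf ext.
have [[u [Xu Yu]]|XY] := pselect (exists u, X u /\ Y u).
  by exists u, p, [::]; split=> //; apply: (linkage_sub _ lp) => z [|->].
pose Kv := flatten [seq p y | y <- K]; pose D z := z \in Kv.
have KvP z : D z <-> exists2 y, y \in K & z \in p y.
  split=> [/flattenP [l /mapP[y yK ->] zp]|[y yK zp]]; first by exists y.
  by apply/flattenP; exists (p y) => //; apply: map_f.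
pose Y' y := Y y /\ y \notin K; pose X1 x := X x /\ ~ D x.
have [[pb pu pd] ph] := lp.
have dis y z : Y' y -> z \in p y -> ~ D z.
  move=> [Yy yK] zp /KvP [y' y'K zp']; have yy := pd _ _ _ Yy (KY _ y'K) zp zp'.
  by move: yK; rewrite yy y'K.
have lp' : linkage (delv e D) (fun a => A a /\ ~ D a) Y' p.
  apply: linkage_mono (linkage_sub _ lp); last by move=> y [].
  - by move=> y Yy x z xp zp exz; split=> //; apply: (dis y).
  - by move=> y Yy x xp Ax; split=> //; apply: (dis y).
have [x [Xx _] [Yx _]|[x [q' [a0 [s [[Xx nDx] lq' q's _]]]]]|[T [nr oT]]] := @augment _ _ _ _ X1 _ lp'.
- by apply: XY; exists x.
- pose q z := if z \in K then p z else q' z.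
  have nKx : x \notin K by apply/negP => /KY Yx; apply: XY; exists x.
  have sub z : Y z \/ z = x -> z \notin K -> z = x \/ Y' z.
    by move=> [Yz|->] nK; [right|left].
  have [[qb qu qd] qh] := lq'; have nD := linkage_tail_in lq'.
  exists x, q, s; split=> //; last first.
  + by move=> y Yy ys; rewrite /q; case: ifP => // /negbT nK; rewrite q's.
  + by move=> y yK; rewrite /q yK.
  split; last first.
    by move=> y; rewrite /q; case: ifP => [yK _|/negbT nK /sub h]; [apply: ph; apply: KY|apply: qh; apply: h].
  split=> [y|y|y y' z]; rewrite /q.
  + case: ifP => [yK _|/negbT nK /sub h]; first by apply: pb; apply: KY.
    by apply: bw_mono (qb _ (h nK)) => [? ? _ _ []|? _ []].
  + by case: ifP => [yK _|/negbT nK /sub h]; [apply: pu; apply: KY|apply: qu; apply: h].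
  + case: ifP => [yK _|/negbT nK /sub h]; case: ifP => [yK' _|/negbT nK' /sub h'] zp zp'.
    * by apply: (pd _ _ z) => //; apply: KY.
    * by case: (nD _ _ (h' nK') zp'); apply/KvP; exists y.
    * by case: (nD _ _ (h nK) zp); apply/KvP; exists y'.
    * by apply: (qd _ _ z) => //; [apply: h|apply: h'].
have inf' l : exists u, X1 u /\ u \notin l.
  by have [u [Xu]] := inf (l ++ Kv); rewrite mem_cat negb_or => /andP[ul /negP uD]; exists u.
have [c [sc uc cX]] := infinite_list (size Kv).+1 inf'.
have [|q [s [lq qs]]] := ext c; first by move=> x /cX [].
have [[qb qu qd] qh] := lq; have ct := reach_cut (delv e D) (fun a => A a /\ ~ D a) T.
suff : size c <= size Kv by rewrite sc ltnn.
(* A cut vertex is labelled by the old path through it, or by itself if it lies in [D]. *)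
pose lab t (k : V + V) := match k with inl y => [/\ ~ D t, Y' y & t \in p y] | inr i => i = t /\ D t end.
apply: (@count _ Y' (fun z => Y' z \/ z \in c) (fun z => T z \/ D z) q lab s) => //.
- have sub z : Y' z \/ z \in c -> Y z \/ z \in c by case=> [[]|]; [left|right].
  by move=> y y' z /sub h /sub h'; apply: qd.
- by move=> y; left.
- by move=> x xc; split; [right|move=> [Yx _]; have [Xx _] := cX _ xc; apply: XY; exists x].
- move=> y Yc; have Yc' : Y y \/ y \in c by case: Yc => [[]|]; [left|right].
  apply: contrapT => nT; have [l qE] := qh _ Yc'; have bq := qb _ Yc'.
  have nD z : z \in q y -> ~ D z by move=> zq Dz; apply: nT; exists z => //; right.
  have bq' : bw (delv e D) (fun a => A a /\ ~ D a) (q y).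
    by apply: bw_mono bq => [a b aq bq eab|a aq Aa]; split=> //; apply: nD.
  have ry : reach (delv e D) (fun a => A a /\ ~ D a) T y.
    exists l; rewrite -qE; split=> // z zq Tz; apply: nT; exists z => //; by left.
  case: Yc => [Yy|/cX Xy]; last exact: nr ry.
  by apply: (orth_end (cut_disj ct) oT Yy) ry; apply: lp'.2.
- move=> t TD; have [Dt|nD] := pselect (D t); first by exists (inr t).
  have [_ oT2] := oT; case: TD => // /oT2 [y Yy ty]; by exists (inl y).
- move=> t t' [y|i] TD TD' /=; last by move=> [-> _] [].
  move=> [nD Yy tp] [nD' _ tp']; case: TD => // Tt; case: TD' => // Tt'.
  exact: (orth_inj (cut_disj ct) oT Yy).
- by move=> t y TD [nD Yy tp]; split=> // ys; rewrite qs //; case: Yy.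
- by move=> t i _ [-> ].
Qed.

End Counting.

(** * Orthogonal cuts that are crossed by one additional edge *)

Section Barrier.
Variable V : eqType.
Variables (e : V -> V -> Prop) (A Y T0 : V -> Prop) (p : V -> seq V) (u v x0 : V).
Hypothesis lp : linkage e A Y p.
Let I0 := reach e A T0.
Hypothesis o0 : orth I0 T0 Y p.
Hypotheses (nYx0 : ~ Y x0) (nIx0 : ~ I0 x0).
Let ep x y := e x y \/ x = u /\ y = v.
Let e1 x y := e x y /\ I0 x.
Implicit Types (x y z t : V) (s : seq V).

Definition extends (X2 : seq V) := exists q s, linkage ep A (fun z => Y z \/ z \in X2) q /\
  forall y, Y y -> y \notin s -> q y = p y.

Let ct0 : cut e A I0 T0 := reach_cut e A T0.

Let Yout y : Y y -> ~ I0 y.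
Proof. by move=> Yy; apply: (orth_end (cut_disj ct0) o0 Yy); apply: lp.2. Qed.

(** Otherwise [T0] is still a cut after the edge from [u] to [v] is added, and by [count] there is
    no room for the endpoint [x0]. *)
Lemma barrier_edge : extends [:: x0] -> [/\ I0 u, ~ I0 v & ~ T0 v].
Proof.
move=> [q [s [lq qs]]]; have [[qb qu qd] qh] := lq.
apply: contrapT => nb.
have ctp : cut ep A I0 T0.
  have [c1 c2 c3] := ct0; split=> // x y Ix [/(c2 _ _ Ix) //|[xu yv]].
  apply: contrapT => nIT; apply: nb; rewrite -xu -yv; split=> // h; apply: nIT; by [left|right].
suff : size [:: x0] <= size ([::] : seq V) by [].
pose lab t (k : V + V) := if k is inl y then Y y /\ t \in p y else False.
apply: (@count _ _ Y (fun z => Y z \/ z \in [:: x0]) T0 q lab s) => //.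
- by move=> y; left.
- by move=> x xx; split; [right|move: xx; rewrite inE => /eqP ->].
- move=> y Yx; have [l qE] := qh _ Yx; rewrite qE; apply: (cut_cross ctp); first by rewrite -qE; apply: qb.
  by case: Yx => [/Yout //|]; rewrite inE => /eqP ->.
- by move=> t Tt; have [_ /(_ _ Tt) [y Yy ty]] := o0; exists (inl y).
- by move=> t t' [y|//] Tt Tt' [Yy ty] [_ ty']; apply: (orth_inj (cut_disj ct0) o0 Yy).
- by move=> t y Tt [Yy ty]; split=> // ys; rewrite qs.
Qed.

Hypotheses (Iu : I0 u).

(** If [x1] were [u], then [T0] together with [u] would be a cut of [ep], with room for one
    additional endpoint but not for two. *)
Lemma barrier_neq x1 : extends [:: x1; x0] -> ~ Y x1 -> x1 <> x0 -> x1 <> u.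
Proof.
move=> [q [s [lq qs]]] nY1 n10 x1u; have [[qb qu qd] qh] := lq; have [c1 c2 c3] := ct0.
have ctp : cut ep A (fun x => I0 x /\ x <> u) (fun x => T0 x \/ x = u).
  have IT z : I0 z \/ T0 z -> (I0 z /\ z <> u) \/ T0 z \/ z = u.
    by move=> h; have [->|/eqP zu] := eqVneq z u; [right; right|case: h; [left|right; left]].
  split=> [a /c1|x y [Ix xu] [/(c2 _ _ Ix)|[]//]|x [Ix xu] [/(c3 _ Ix)|]] //; exact: IT.
suff : size [:: x1; x0] <= size [:: u] by [].
pose lab t (k : V + V) := if k is inl y then [/\ T0 t, Y y & t \in p y] else t = u /\ k = inr u.
apply: (@count _ _ Y (fun z => Y z \/ z \in [:: x1; x0]) (fun t => T0 t \/ t = u) q lab s) => //.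
- by move=> y; left.
- by rewrite /= inE andbT; apply/eqP.
- by move=> x xx; split; [right|move: xx; rewrite !inE => /orP[]/eqP ->].
- move=> y Yx; have [l qE] := qh _ Yx; rewrite qE; apply: (cut_cross ctp); first by rewrite -qE; apply: qb.
  by case: Yx => [/Yout ny []//|]; rewrite !inE => /orP[]/eqP -> [].
- move=> t [Tt|->]; last by exists (inr u).
  by have [_ /(_ _ Tt) [y Yy ty]] := o0; exists (inl y).
- move=> t t' [y|i] _ _ /=; last by move=> [-> _] [-> _].
  by move=> [Tt Yy ty] [Tt' _ ty']; apply: (orth_inj (cut_disj ct0) o0 Yy).
- by move=> t y Tt [_ Yy ty]; split=> // ys; rewrite qs.
- by move=> t i Tt [_ [->]]; rewrite mem_head.
Qed.

Variables (q0 : V -> seq V) (ysel : V -> V).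
Hypothesis q0P : forall t, T0 t -> Y (ysel t) /\ {subset q0 t <= p (ysel t)}.
Hypothesis q0h : forall t, T0 t -> t \in q0 t.

(** Suppose that [x] cannot be linked in addition. Then [u], which is [x] or belongs to [us], is
    outside the inner side of the blocking cut [T3], so the edge from [u] to [v] does not leave that
    side and [T3] is also a cut of [ep]. Its vertices are labelled by old paths through [T0] or by
    elements of [us], which leaves too little room for [X2]. *)
Lemma barrier_extend (us : seq V) x q s (X2 : seq V) :
  linkage e1 A (fun z => z \in us \/ T0 z) q -> (forall t, T0 t -> t \notin s -> q t = q0 t) ->
  I0 x -> x \notin us -> (forall z, z \in us -> I0 z) -> x = u \/ u \in us ->
  extends X2 -> uniq X2 -> size us < size X2 -> (forall y, y \in X2 -> ~ Y y /\ (~ I0 y \/ y = x)) ->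
  exists q' s', linkage e1 A (fun z => z = x \/ (z \in us \/ T0 z)) q' /\
    forall t, T0 t -> t \notin s' -> q' t = q0 t.
Proof.
move=> lq qs Ix xus usI xu [q2 [s2 [lq2 q2s]]] u2 lt2 X2P; have [c1 c2 c3] := ct0.
have [z <- [|/(c3 _ Ix)]|[z [q' [a0 [s' [<- lq' q's _]]]]]|[T3 [nr o3]]] := @augment _ e1 A _ (eq x) _ lq.
- by apply/negP.
- by [].
- exists q', (s ++ s'); split=> // t Tt; rewrite mem_cat negb_or => /andP[ts ts'].
  by rewrite q's ?qs //; right.
exfalso; set I3 := reach e1 A T3 in nr o3.
have ct3 := reach_cut e1 A T3; have [d1 d2 d3] := ct3; have IT3 := cut_disj ct3.
have [[qb2 _ qd2] qh2] := lq2; have [[qb _ qd] qh] := lq.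
have end3 z : z \in us \/ T0 z -> ~ I3 z by move=> h; apply: (orth_end IT3 o3 h); apply: qh.
have nI3u : ~ I3 u by case: xu => [<-|uu]; [apply: nr|apply: end3; left].
have ctp : cut ep A (fun z => I3 z /\ I0 z) T3.
  have I30 z : I3 z \/ T3 z -> I0 z \/ T0 z -> (I3 z /\ I0 z) \/ T3 z.
    by move=> [Iz|]; [move=> [|Tz]; [left|case: (end3 z) => //; right]|right].
  split=> [a Aa|y z [I3y Iy] [eyz|[yu]]|z [/d3]//].
  - by apply: I30; [apply: d1|apply: c1].
  - by apply: I30; [apply: d2 I3y _|apply: c2 eyz].
  - by case: nI3u; rewrite -yu.
suff : size X2 <= size us by rewrite leqNgt lt2.
pose lab t (k : V + V) := match k with
  | inl y => exists t0, [/\ T0 t0, y = ysel t0 & t \in q t0]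
  | inr i => i \in us /\ t \in q i end.
apply: (@count _ _ Y (fun z => Y z \/ z \in X2) T3 q2 lab (s2 ++ [seq ysel t | t <- s])) => //.
- by move=> y; left.
- by move=> y yX; split; [right|case: (X2P _ yX)].
- move=> y Yx; have [l qE] := qh2 _ Yx; rewrite qE; apply: (cut_cross ctp); first by rewrite -qE; apply: qb2.
  move=> [I3y Iy]; case: Yx => [/Yout //|/X2P [_ [//|yx]]].
  by apply: (nr x) => //; rewrite -yx.
- move=> t Tt; have [_ /(_ _ Tt) [y [yus|Ty] ty]] := o3; first by exists (inr y).
  by exists (inl (ysel y)), y.
- move=> t t' [y|i] Tt Tt' /=.
    move=> [t1 [T1 yE tq]] [t2 [T2 yE' tq']].
    have [Y1 h1] := q0P T1; have [_ h2] := q0P T2.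
    have t12 : t1 = t2.
      apply: (orth_inj (cut_disj ct0) o0 Y1) => //; first by apply: h1; apply: q0h.
      by rewrite -yE yE'; apply: h2; apply: q0h.
    by subst t2; apply: (orth_inj IT3 o3 (or_intror T1)).
  by move=> [ius ti] [_ ti']; apply: (orth_inj IT3 o3 (or_introl ius)).
- move=> t y Tt [t0 [T1 -> tq]]; have [Y1 h1] := q0P T1; split=> //.
  rewrite mem_cat negb_or => /andP[n1 n2]; rewrite q2s //; apply: h1.
  rewrite -qs //; apply/negP => ts; move: n2; by rewrite map_f.
- by move=> t i _ [].
Qed.

End Barrier.

(** The sets to be hit are finite, so the intersection of a chain of hitting sets still hits all of
    them and a minimal hitting set exists. An element without a private set could be dropped. *)
Lemma minimal_hitting (V : eqType) (M : Type) (bad : M -> Prop) (U : M -> V -> Prop) :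
  (forall m, bad m -> exists l : seq V, forall u, U m u -> u \in l) ->
  (forall m, bad m -> exists u, U m u) ->
  exists H : V -> Prop, (forall m, bad m -> exists2 u, H u & U m u) /\
    forall u, H u -> exists2 m, bad m & U m u /\ forall u', H u' -> U m u' -> u' = u.
Proof.
move=> fin ne; pose hit (H : V -> Prop) := forall m, bad m -> exists2 u, H u & U m u.
pose S := {H | hit H}; pose R (H H' : S) := forall u, sval H' u -> sval H u.
have h0 : hit (fun _ => True) by move=> m /ne [u Uu]; exists u.
have [||C [H0 CH0] Ct|[H hH] [_ mn]] := @zorn_above S R (exist _ _ h0).
- by move=> H u.
- by move=> H1 H2 H3 h1 h2 u /h2 /h1.
- have hI : hit (fun u => forall H, C H -> sval H u).
    move=> m bm; apply: contrapT => nex; have [l lP] := fin _ bm.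
    have [H1 C1 h1] : exists2 H1, C H1 & forall u, u \in l -> U m u -> ~ sval H1 u.
      elim: (l) => [|a l' [H1 C1 h1]]; first by exists H0.
      have [[H2 C2 n2]|na] := pselect (exists2 H2, C H2 & ~ sval H2 a); last first.
        exists H1 => // u; rewrite inE => /orP[/eqP ->|]; last exact: h1.
        move=> Ua; case: nex; exists a => // H2 C2; apply: contrapT => n2.
        by apply: na; exists H2.
      have [le|le] := Ct _ _ C1 C2; [exists H2|exists H1] => // u; rewrite inE => /orP[/eqP -> //|ul] Uu.
      + by move=> /le; apply: h1.
      + by move=> /le.
      + exact: h1.
    have [u Hu Uu] := svalP H1 m bm; exact: h1 (lP _ Uu) Uu Hu.
  by exists (exist _ _ hI) => H1 C1 u; apply.
exists H; split=> // u Hu; apply: contrapT => npriv.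
have h' : hit (fun x => H x /\ x <> u).
  move=> m bm; have [u' Hu' Uu'] := hH _ bm; have [uu|uu] := eqVneq u' u; last by exists u' => //; split=> //; apply/eqP.
  apply: contrapT => nex; apply: npriv; exists m => //; split; first by rewrite -uu.
  move=> u2 H2 U2; apply: contrapT => n2; apply: nex; by exists u2.
by have [] := mn (exist _ _ h') _ u Hu => // x [].
Qed.

(** * The extended flame and its cuts *)

Section Main.
Variables (V : countType) (E F : V -> V -> Prop) (r : V) (N : V -> V -> seq V).
Implicit Types (x y z w v t u : V) (L : V -> V -> Prop) (C : seq V) (unf : V -> Prop).

Definition inside L w x y := [/\ L x y, x <> r, x <> w, y <> r & y <> w].
Definition sources w x := [/\ E r x, x <> r & x <> w].
Definition tails L w x := L x w /\ x <> r.

(** The reference linkage [N w] makes additional endpoints countable although the linkages are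
    infinite. The paths stop at in-neighbours of [w], so the edges of [L] into [w] have no
    influence; this is the source of the restriction in [finlink_mono]. *)
Definition finlink L w C := exists q (s : seq V),
  linkage (inside L w) (sources w) (fun z => tails F w z \/ z \in C) q /\
  forall y, tails F w y -> y \notin s -> q y = N w y.

Definition between L := (forall x y, F x y -> L x y) /\ forall x y, L x y -> E x y.
Definition all_linked L unf := forall w, unf w -> forall C, (forall x, x \in C -> tails L w x) -> finlink L w C.
(** This is the trace of maximality that survives deletions: as long as the in-edges of [y] stay,
    shrinking [L] can only make [finlink] fail more often. *)
Definition blocked L unf := forall x y, unf y -> E x y -> ~ L x y ->
  exists C, (forall c, c \in C -> tails L y c) /\ ~ finlink L y (x :: C).

Hypotheses (FE : forall x y, F x y -> E x y) (rF : forall x, E r x -> F r x).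
Hypothesis FN : forall w, w <> r -> linkage (inside F w) (sources w) (tails F w) (N w).

Lemma inside_mono L L' w x y : (L x y -> L' x y) -> inside L w x y -> inside L' w x y.
Proof. by move=> LL [/LL ? ? ? ? ?]; split. Qed.

Lemma finlink_mono L L' w C C' : (forall x y, y <> w -> L x y -> L' x y) -> {subset C' <= C} ->
  finlink L w C -> finlink L' w C'.
Proof.
move=> LL CC [q [s [lq qs]]]; exists q, s; split=> //.
apply: linkage_mono (linkage_sub _ lq) => [y _ x z _ _|//|y [Fy|/CC yC]]; [|by left|by right].
by move=> [/LL h h1 h2 h3 h4]; split=> //; apply: h.
Qed.

Lemma finlink_nil L w : w <> r -> (forall x y, F x y -> L x y) -> finlink L w [::].
Proof.
move=> wr FL; exists (N w), [::]; split=> //.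
apply: linkage_mono (linkage_sub _ (FN wr)) => [y _ x z _ _|//|y []//].
exact/inside_mono/FL.
Qed.

Lemma reach_ne L w T x : reach (inside L w) (sources w) T x -> x <> r /\ x <> w.
Proof. by case=> [[|y l]] [] => [[]|[[]]]. Qed.

(** Each constraint involves a finite list of in-edges, so the constraints pass to unions of chains.
    Adding a missing edge into [y] creates new constraints at [y] only, hence a violated one yields
    the blocking list. *)
Lemma max_sub : exists L, [/\ between L, all_linked L (fun w => w <> r) & blocked L (fun w => w <> r)].
Proof.
pose good L := between L /\ all_linked L (fun w => w <> r).
pose S := {L | good L}; pose R (L L' : S) := forall x y, sval L x y -> sval L' x y.
have gF : good F.
  split=> // w wr C CF; have := finlink_nil wr (fun x y h => h : F x y) => -[q [s [lq qs]]].
  exists q, s; split=> //; apply: (linkage_sub _ lq) => z [|/CF]; by left.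
have [||C [L0 CL0] Ct|[L [[FL LE] lk]] [_ mx]] := @zorn_above S R (exist _ F gF).
- by move=> L1 x y.
- by move=> L1 L2 L3 h1 h2 x y /h1 /h2.
- pose L x y := exists2 L1 : S, C L1 & sval L1 x y.
  have gL : good L.
    split; first split=> x y; first by exists L0 => //; case: (svalP L0) => -[h _] _; apply: h.
      by case=> L1 _; case: (svalP L1) => -[_ h] _; apply: h.
    move=> w wr D; elim: D => [|d D IH] DL; first by apply: finlink_nil => // x y Fxy;
      exists L0 => //; case: (svalP L0) => -[h _] _; apply: h.
    have [L1 CL1 h1] : exists2 L1 : S, C L1 & forall x, x \in d :: D -> tails (sval L1) w x.
      elim: (d :: D) DL {IH} => [|a l IH] al; first by exists L0.
      have [|L1 C1 h1] := IH; first by move=> x xl; apply: al; rewrite inE xl orbT.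
      have [[L2 C2 h2] ar] := al a (mem_head _ _).
      have [h|h] := Ct _ _ C1 C2; [exists L2|exists L1] => // x; rewrite inE => /orP[/eqP ->|/h1 []] //.
        by move=> /h; split.
      by split=> //; apply: h.
    have := (svalP L1).2 w wr _ h1; apply: finlink_mono => // x y _ Lxy; by exists L1.
  by exists (exist _ L gL) => L1 CL1 x y Lxy; exists L1.
exists L; split=> // x y yr Exy nL; apply: contrapT => nC.
have xr : x <> r by move=> xr; apply: nL; apply: (FL); move: Exy; rewrite xr; apply: rF.
pose L' a b := L a b \/ a = x /\ b = y.
have gL' : good L'.
  split; first by split=> a b; [move=> /FL; left|case=> [/LE //|[-> ->]]].
  move=> w wr C CL'; have [wy|wy] := eqVneq w y; last first.
    apply: finlink_mono (lk w wr C _) => // [a b _|c /CL' [[Lc|[_ ww]] cr]]; [by left|by split|].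
    by move: wy; rewrite ww eqxx.
  subst w; apply: contrapT => nf; apply: nC; exists [seq c <- C | c != x]; split.
    by move=> c; rewrite mem_filter => /andP[/eqP cx /CL' [[Lc|[//]] cr]].
  move=> f; apply: nf; apply: finlink_mono f => [a b by_ Lab|c cC]; first by left.
  by rewrite inE mem_filter cC andbT; case: eqP.
by apply: nL; apply: (mx (exist _ L' gL')) => [a b|]; [left|right].
Qed.

(** The cut at [y] is uncrossed with the maximal converse wave at [w]. Paths for [y] may run through
    [w], which is absent from the graph for [w]; such a path is cut off just before [w], at an
    in-neighbour of [w], which is not in [R]. The other paths end at in-neighbours of [y], not in
    [R] by hypothesis. *)
Lemma sep_step L w y o Y' p I T : let R := reach (inside L w) (sources w) (front o) in
  wave (op (inside L w)) (tails L w) (sources w) o ->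
  (forall o2, wave (op (inside L w)) (tails L w) (sources w) o2 -> forall x, inner o2 x -> inner o x) ->
  (forall z, tails L y z -> ~ R z) -> ~ sources w y ->
  (forall z, Y' z -> tails L y z) -> linkage (inside L y) (sources y) Y' p ->
  cut (inside L y) (sources y) I T -> orth I T Y' p -> ~ I y ->
  forall x, R x -> I x.
Proof.
move=> R wv mx tR nSy Yt lp ct oT nIy; have [c1 c2 c3] := ct.
have [[pb pu pd] ph] := lp; have [oT1 oT2] := oT.
have RJ x : R x -> ~ inner o x /\ ~ front o x := @wave_unreachable _ _ _ _ _ x wv.
have Yw x : tails L w x -> ~ R x.
  by move=> /[swap] /RJ [nJ nS] tx; have [[cY _ _] _ _ _] := wave_elim wv; case: (cY _ tx).
have /choice[n nP] t : exists n, T t /\ t <> w ->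
    [/\ bw (inside L w) (eq t) n, uniq n, exists h, hd h n /\ ~ R h,
        forall z, z \in n -> z <> t -> ~ I z /\ ~ T z
      & exists y', [/\ Y' y', t \in p y' & {subset n <= p y'}]].
  have [[Tt tw]|] := pselect (T t /\ t <> w); last by exists [::].
  have [y' Yy' ty'] := oT2 _ Tt; have [s1 [t' [s2 [pE Tt' s1O s2I]]]] := oT1 _ Yy'.
  have tt' : t' = t by apply: (orth_inj (cut_disj ct) oT Yy') => //; rewrite pE mem_cat mem_head orbT.
  subst t'; have bs1 : bw (inside L y) (eq t) (s1 ++ [:: t]).
    by have := pb _ Yy'; rewrite pE => bp; apply: (bw_swap bp).
  have [d [n [nE nw [h [[l hE] nRh]]]]] : exists d n, [/\ s1 ++ [:: t] = d ++ n, w \notin n & exists h, hd h n /\ ~ R h].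
    have [ws|ws] := boolP (w \in s1); last first.
      exists [::], (s1 ++ [:: t]); split=> //.
        by rewrite mem_cat inE negb_or ws; apply/eqP => wt; apply: tw.
      exists y'; split; last by apply: tR; apply: Yt.
      have [l pE'] := ph _ Yy'; move: pE; rewrite pE'.
      by case: (s1) => [|a s] [-> _]; [exists [::]|exists (s ++ [:: t])].
    have /split_last [a [w' [b [sE ww bw']]]] : exists2 z, z \in s1 & z = w by exists w.
    subst w'; exists (rcons a w), (b ++ [:: t]); rewrite sE cat_rcons -catA; split=> //.
      rewrite mem_cat inE negb_or; apply/andP; split; last by apply/eqP => wt; apply: tw.
      by apply/negP => wb; apply: (bw' w).
    have := bs1; rewrite sE -catA => /bw_suffix; case: b sE {bw'} => [|c b] sE /= [[h1 h2 h3 h4 h5] _].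
      by exists t; split; [exists [::]|apply: Yw].
    by exists c; split; [exists (b ++ [:: t])|apply: Yw].
  have bn : bw (inside L y) (eq t) n by move: bs1; rewrite nE hE => /bw_suffix.
  have ns1 z : z \in n -> z \in s1 ++ [:: t] by rewrite nE mem_cat => ->; rewrite orbT.
  exists n => _; split.
  - apply: bw_mono bn => // a b an bn [h1 h2 h3 h4 h5]; split=> // E1; move: nw; by rewrite -E1 ?an ?bn.
  - have := pu _ Yy'; rewrite pE -cat_rcons -cats1 nE -catA cat_uniq => /and3P[_ _].
    by rewrite cat_uniq => /andP[].
  - by exists h; split=> //; exists l.
  - by move=> z /ns1; rewrite mem_cat inE => /orP[/s1O //|/eqP].
  - exists y'; split=> // z /ns1; rewrite pE !mem_cat !inE => /orP[->//|->]; by rewrite orbT.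
have tn t : T t /\ t <> w -> src (n t) = Some t by move=> /nP [/bw_eq_src].
have RE x z : I x -> R x -> inside L w x z -> inside L y x z.
  move=> Ix Rx [Lxz xr xw zr zw]; split=> // [xy|zy]; first by apply: nIy; rewrite -xy.
  by apply: (tR x) => //; split=> //; rewrite -zy.
apply: (@uncross _ _ _ _ o I (fun t => T t /\ t <> w) n wv mx).
- move=> b [Erb br bw']; have [|Ib|Tb] := c1 b; [|by left|by right].
  by split=> // by_; apply: nSy; rewrite -by_.
- move=> x z Ix Rx exz; have [|Iz|Tz] := c2 x z Ix; [exact: RE|by left|right].
  by split=> //; case: exz.
- by move=> x /c3 nT [].
- split=> [t Tt|t /nP []//|t t' z Tt Tt' zt zt'].
    by have [bt _ _ _ _] := nP _ Tt; apply: bw_eq bt _.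
  have [_ _ _ _ [y1 [Y1 t1 s1]]] := nP _ Tt; have [_ _ _ _ [y2 [Y2 t2 s2]]] := nP _ Tt'.
  have yy : y1 = y2 by apply: (pd _ _ z) => //; [apply: s1|apply: s2].
  by subst y2; case: Tt => Tt _; case: Tt' => Tt' _; apply: (orth_inj (cut_disj ct) oT Y1).
- exact: tn.
- by move=> t /nP [].
- by move=> t z /nP [_ _ _ h _] zn zt; have [nI nT] := h _ zn zt; split=> // -[].
Qed.

(** The paths lie in [L] while the cut separates in [E]; this combination yields both the flame
    property and largeness at [v]. *)
Definition frozen L v P (I S : V -> Prop) :=
  [/\ linkage (inside L v) (sources v) (tails L v) P, cut (inside E v) (sources v) I S,
      orth I S (tails L v) P & ~ I v /\ forall x, tails E v x -> ~ I x].

(** Augmenting a linkage of the blocking list towards [x] would make the blocked list linkable, so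
    [augment] has to return a cut. *)
Lemma blocked_cut L unf x y : between L -> all_linked L unf -> blocked L unf ->
  unf y -> y <> r -> E x y -> ~ L x y ->
  exists Y' p T, [/\ forall z, Y' z -> tails L y z, linkage (inside L y) (sources y) Y' p,
    orth (reach (inside L y) (sources y) T) T Y' p & ~ reach (inside L y) (sources y) T x].
Proof.
move=> [FL LE] lk bl uy yr Exy nL; have [C [Ct nf]] := bl _ _ uy Exy nL.
have [q [s [lq qs]]] := lk _ uy C Ct.
have sub z : tails F y z \/ z \in C -> tails L y z.
  by case=> [[/FL ? ?]|/Ct].
have [z <- /sub [] //|[z [q' [a0 [s' [<- lq' q's _]]]]]|[T [nr oT]]] := @augment _ _ _ _ (eq x) _ lq.
  case: nf; exists q', (s ++ s'); split.
    apply: (linkage_sub _ lq') => z1; rewrite inE => -[Fz|/orP[/eqP|zC]]; by [right; left|left|right; right].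
  move=> z1 Fz; rewrite mem_cat negb_or => /andP[zs zs']; rewrite q's ?qs //; by left.
by exists (fun z => tails F y z \/ z \in C), q, T; split=> //; apply: nr.
Qed.

(* A missing edge out of the reachable set [R] into [y] is ruled out by the cut
   stored with [y] if [y] is frozen, and by the cut from [blocked_cut] otherwise. *)
Lemma dsep L (fz unf : V -> Prop) P I S w o : between L -> all_linked L unf -> blocked L unf ->
  (forall y, y <> r -> fz y \/ unf y) -> (forall y, unf y -> y <> r) ->
  (forall y, fz y -> y <> r -> frozen L y (P y) (I y) (S y)) ->
  unf w -> wave (op (inside L w)) (tails L w) (sources w) o ->
  (forall o2, wave (op (inside L w)) (tails L w) (sources w) o2 -> forall x, inner o2 x -> inner o x) ->
  cut (inside E w) (sources w) (reach (inside L w) (sources w) (front o)) (front o) /\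
  forall x, tails E w x -> ~ reach (inside L w) (sources w) (front o) x.
Proof.
move=> [FL LE] lk bl cover unr fzP uw wv mx; set R := reach _ _ _.
have [R1 R2 R3] := reach_cut (inside L w) (sources w) (front o).
have RJ x : R x -> ~ inner o x /\ ~ front o x := @wave_unreachable _ _ _ _ _ x wv.
have Rne x : R x -> x <> r /\ x <> w := @reach_ne L w (front o) x.
have Yw x : tails L w x -> ~ R x.
  by move=> /[swap] /RJ [nJ nS] tx; have [[cY _ _] _ _ _] := wave_elim wv; case: (cY _ tx).
split; last first.
  move=> x [Exw xr] Rx; have [Lxw|nL] := pselect (L x w); first by apply: (Yw x).
  have [Y' [p [T [Yt lp oT nr]]]] := blocked_cut (conj FL LE) lk bl uw (unr _ uw) Exw nL.
  apply: nr; apply: (sep_step wv mx Yw _ Yt lp _ oT _ Rx); first by case.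
    exact: reach_cut.
  by move=> /reach_ne [].
split=> // x y Rx [Exy xr xw yr yw]; apply: contrapT => nRS.
have nL : ~ L x y by move=> Lxy; apply: nRS; apply: R2 Rx _.
have tR z : tails L y z -> ~ R z.
  by move=> [Lzy zr] Rz; have [_ zw] := Rne _ Rz; apply: nRS; apply: R2 Rz _.
have nSy : ~ sources w y by move=> /R1.
have [fy|uy] := cover _ yr.
  have [lp ct oS [nIy nIx]] := fzP _ fy yr.
  apply: (nIx x) => //; apply: (sep_step wv mx tR nSy _ lp _ oS nIy Rx) => //.
  have [c1 c2 c3] := ct; split=> // a b Ia Lab; apply: c2 Ia _; apply: inside_mono Lab; exact: LE.
have [Y' [p [T [Yt lp oT nr]]]] := blocked_cut (conj FL LE) lk bl uy yr Exy nL.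
apply: nr; apply: (sep_step wv mx tR nSy Yt lp _ oT _ Rx); first exact: reach_cut.
by move=> /reach_ne [].
Qed.

(** * Freezing a vertex *)

Section Deletion.
Variables (L : V -> V -> Prop) (unf : V -> Prop) (v : V).
Hypotheses (bL : between L) (lk : all_linked L unf) (unr : forall w, unf w -> w <> r) (uv : unf v).

(** An edge from [r] to [v] is never deleted, because [F] contains all edges of [E] at the root. *)
Definition restr (E' : V -> Prop) x y := L x y /\ (y = v -> x = r \/ E' x).

Lemma restr_mono (E1 E2 : V -> Prop) w C C' : (forall x, E1 x -> E2 x) -> {subset C' <= C} ->
  finlink (restr E1) w C -> finlink (restr E2) w C'.
Proof.
move=> E12; apply: finlink_mono => x y _ [Lxy h]; split=> // /h [|/E12]; by [left|right].
Qed.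

(** By [one_pred] a linkage at [w] uses at most one edge into [v], so a constraint is met without
    such edges or with a single one. *)
Lemma sat_split (E' : V -> Prop) w C : finlink (restr E') w C ->
  finlink (restr (fun _ => False)) w C \/
  exists u, [/\ E' u, tails L v u & finlink (restr (eq u)) w C].
Proof.
move=> [q [s [lq qs]]]; have [c [sc cv lc]] := one_pred v lq.
case: c sc cv lc => [|u [|//]] _ cv lc; [left|right].
  exists q, s; split=> //; apply: linkage_mono lc => // _ _ x y _ _ [[[Lxy _] h1 h2 h3 h4] h].
  by split=> //; split=> // /h.
have [[Luv h] ur uw vr vw] := cv u (mem_head _ _).
exists u; split; [by have [|//] := h erefl|by split|].
exists q, s; split=> //; apply: linkage_mono lc => // _ _ x y _ _ [[[Lxy _] h1 h2 h3 h4] h5].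
by split=> //; split=> // /h5; rewrite inE => /eqP ->; right.
Qed.

Definition hits w C u := tails L v u /\ finlink (restr (eq u)) w C.

Lemma hits_ex w C : unf w -> (forall x, x \in C -> tails L w x) ->
  ~ finlink (restr (fun _ => False)) w C -> exists u, hits w C u.
Proof.
move=> uw CL nf; have : finlink (restr (tails L v)) w C.
  apply: finlink_mono (lk uw CL) => // x y _ Lxy; split=> // yv.
  by have [|] := pselect (x = r); [left|right; split=> //; rewrite -yv].
by case/sat_split => // -[u [_ tu fu]]; exists u.
Qed.

Lemma fix_infinite C0 : (forall x, x \in C0 -> tails L v x) -> exists EA q,
  [/\ forall x, tails F v x -> EA x, forall x, x \in C0 -> EA x, forall x, EA x -> tails L v x,
     linkage (inside L v) (sources v) EA q
   & forall w C, unf w -> (forall x, x \in C -> tails L w x) ->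
       (forall l : seq V, exists u, hits w C u /\ u \notin l) -> exists2 u, EA u & hits w C u].
Proof.
move=> C0L; have [FL LE] := bL.
pose tgt (J : seq V) z := tails F v z \/ z \in J.
pose inv (st : seq V * (V -> seq V) * seq V) := let: (J, p, K) := st in
  [/\ forall x, x \in J -> tails L v x, linkage (inside L v) (sources v) (tgt J) p,
      exists s : seq V, forall y, tails F v y -> y \notin s -> p y = N v y & forall y, y \in K -> tgt J y].
pose S := {st | inv st}.
have [q0 [s0 [lq0 q0s]]] := lk uv C0L.
have i0 : inv (C0, q0, [::]) by split=> //; exists s0.
pose J (s : S) := (sval s).1.1; pose p (s : S) := (sval s).1.2; pose K (s : S) := (sval s).2.
have invP (s : S) : inv (J s, p s, K s) by move: (svalP s); rewrite /J /p /K; case: (sval s) => -[].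
have /choice[next nextP] (ns : nat * S) : exists s' : S, [/\ {subset J ns.2 <= J s'}, {subset K ns.2 <= K s'},
    {subset J ns.2 <= K s'}, forall y, y \in K ns.2 -> p s' y = p ns.2 y
    & (forall z, unpickle ns.1 = Some z -> tails F v z -> z \in K s') /\
      (forall w C, unpickle ns.1 = Some (w, C) -> (forall l : seq V, exists u, hits w C u /\ u \notin l) ->
         exists2 u, u \in J s' & hits w C u)].
  case: ns => n s /=; have [JL lp [sp ps] Kt] := invP s.
  (* The code [n] is read in two ways: as an in-neighbour in [F] whose path is to become final, and
     as a constraint to be served. *)
  pose zs := if unpickle n is Some z then if `[< tails F v z >] then [:: z] else [::] else [::].
  have zsP z : z \in zs -> tails F v z.
    by rewrite /zs; case: (unpickle n) => // z'; case: asboolP => // Fz; rewrite inE => /eqP ->.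
  pose K1 := K s ++ J s ++ zs.
  have K1t y : y \in K1 -> tgt (J s) y.
    by rewrite !mem_cat => /or3P[/Kt //|yJ|/zsP]; [right|left].
  have K1z z : unpickle n = Some z -> tails F v z -> z \in K1.
    by move=> nz Fz; rewrite !mem_cat /zs nz; case: asboolP => // _; rewrite mem_head !orbT.
  have [[w [C [nwC inf]]]|nwC] := pselect (exists w C, unpickle n = Some (w, C) /\
      forall l : seq V, exists u, hits w C u /\ u \notin l); last first.
    have i1 : inv (J s, p s, K1) by split=> //; exists sp.
    exists (exist _ _ i1); split=> //; rewrite /K /J /=; [| |split=> // w C nwC' inf].
    - by move=> y yK; rewrite mem_cat yK.
    - by move=> y yJ; rewrite !mem_cat yJ orbT.
    - by case: nwC; exists w, C.
  have [|u [q [s1 [[tu fu] lq qK qs]]]] := augment_fixing lp K1t inf.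
    move=> c cU; have [|q [s1 [lq qs]]] := lk uv (_ : forall x, x \in J s ++ c -> tails L v x).
      by move=> x; rewrite mem_cat => /orP[/JL //|/cU []].
    exists q, (s1 ++ sp ++ J s); split.
      by apply: (linkage_sub _ lq) => z [[Fz|zJ]|zc]; rewrite ?mem_cat; [left|right; rewrite zJ|right; rewrite zc orbT].
    move=> y [Fy|yJ]; rewrite !mem_cat !negb_or => /and3P[h1 h2 h3]; last by rewrite yJ in h3.
    by rewrite qs // ps.
  have i1 : inv (u :: J s, q, K1).
    split.
    - by move=> x; rewrite inE => /orP[/eqP -> //|/JL].
    - by apply: (linkage_sub _ lq) => z [Fz|]; [left; left|rewrite inE => /orP[/eqP ->|zJ]; [right|left; right]].
    - by exists (s1 ++ sp) => y Fy; rewrite mem_cat negb_or => /andP[h1 h2]; rewrite qs ?ps //; left.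
    - by move=> y /K1t [Fy|yJ]; [left|right; rewrite inE yJ orbT].
  exists (exist _ _ i1); split; rewrite /K /J /p /=.
  - by move=> y yJ; rewrite inE yJ orbT.
  - by move=> y yK; rewrite mem_cat yK.
  - by move=> y yJ; rewrite !mem_cat yJ orbT.
  - by move=> y yK; apply: qK; rewrite mem_cat yK.
  - split=> // w' C'; rewrite nwC => -[<- <-] _; by exists u; rewrite ?mem_head.
pose f := fix f n : S := if n is n'.+1 then next (n', f n') else exist _ _ i0.
have mono n m : n <= m -> [/\ {subset J (f n) <= J (f m)}, {subset K (f n) <= K (f m)}
    & forall y, y \in K (f n) -> p (f m) y = p (f n) y].
  move=> /subnK <-; elim: (m - n) => [|k [h1 h2 h3]]; first by split.
  have [g1 g2 _ g3 _] := nextP (k + n, f (k + n)); split.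
  - by move=> x /h1 /g1.
  - by move=> x /h2 /g2.
  - by move=> x xK; rewrite -h3 //; apply: g3; apply: h2.
pose EA z := exists n, tgt (J (f n)) z.
have EK z : EA z -> exists n, z \in K (f n).
  case=> n [Fz|zJ].
    have [_ _ _ _ [h _]] := nextP (pickle z, f (pickle z)).
    by exists (pickle z).+1; apply: h => //=; rewrite pickleK.
  by have [_ _ h _ _] := nextP (n, f n); exists n.+1; apply: h.
have /choice[nz nzP] z : exists n, EA z -> z \in K (f n).
  by have [/EK [n zn]|] := pselect (EA z); [exists n|exists 0].
pose q z := p (f (nz z)) z.
have qE z n : EA z -> nz z <= n -> q z = p (f n) z /\ tgt (J (f n)) z.
  move=> Ez /mono [_ h1 h2]; rewrite /q h2; last exact: nzP.
  by split=> //; have [_ _ _ h] := invP (f n); apply: h; apply: h1; apply: nzP.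
have lkn n : linkage (inside L v) (sources v) (tgt (J (f n))) (p (f n)) by have [] := invP (f n).
exists EA, q; split.
- by move=> x Fx; exists 0; left.
- by move=> x xC; exists 0; right.
- move=> x [n [[Fx xr]|xJ]]; first by split=> //; apply: FL.
  by have [h _ _ _] := invP (f n); apply: h.
- split=> [|y Ey]; last by have [-> tg] := qE _ _ Ey (leqnn _); apply: (lkn _).2.
  split=> [y Ey|y Ey|y y' z Ey Ey'].
  + by have [-> tg] := qE _ _ Ey (leqnn _); have [[h _ _] _] := lkn (nz y); apply: h.
  + by have [-> tg] := qE _ _ Ey (leqnn _); have [[_ h _] _] := lkn (nz y); apply: h.
  + have [-> tg] := qE _ _ Ey (leq_maxl _ (nz y')); have [-> tg'] := qE _ _ Ey' (leq_maxr (nz y) _).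
    by have [[_ _ h] _] := lkn (maxn (nz y) (nz y')); apply: h.
- move=> w C uw CL inf; have [_ _ _ _ [_ h]] := nextP (pickle (w, C), f (pickle (w, C))).
  have [|u uJ hu] := h w C _ inf; first by rewrite /= pickleK.
  by exists u => //; exists (pickle (w, C)).+1; right.
Qed.

Section Private.
Variables (EA H : V -> Prop) (w u : V) (C : seq V).
Hypotheses (FA : forall x, tails F v x -> EA x) (EAL : forall x, EA x -> tails L v x).
Hypotheses (HL : forall x, H x -> tails L v x) (Hu : H u) (uEA : ~ EA u).
Hypotheses (uw : unf w) (wv : w <> v) (CL : forall x, x \in C -> tails L w x).
Let E' x := (EA x \/ H x) /\ x <> u.
Hypotheses (sat_u : finlink (restr (eq u)) w C) (unsat : ~ finlink (restr E') w C).
Hypothesis sat_more : forall x, tails L w x -> finlink (restr (eq u)) w (x :: C).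

Lemma max_finlink L' : finlink L' w [::] -> exists C', [/\ finlink L' w C', {subset C' <= C}
  & forall x, x \in C -> x \in C' \/ ~ finlink L' w (x :: C')].
Proof.
move=> f0; elim: (C) => [|a l [C' [f' sub mx]]]; first by exists [::].
have [fa|nfa] := pselect (finlink L' w (a :: C')); [exists (a :: C')|exists C']; split=> // x.
- by rewrite !inE => /orP[->//|/sub ->]; rewrite orbT.
- rewrite inE => /orP[/eqP ->|/mx [xC|nf]]; rewrite ?mem_head; [by left|by left; rewrite inE xC orbT|right].
  apply: contra_not nf; apply: finlink_mono => // z; rewrite !inE => /orP[->//|->]; by rewrite !orbT.
- by move=> /sub xl; rewrite inE xl orbT.
- by rewrite inE => /orP[/eqP ->|/mx //]; right.
Qed.

(* The failure of [finlink (restr E') w C] yields a cut at [w] that the edge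
   [u -> v] must leave.  It becomes a region for [v] once [w], which is not a
   vertex of the graph for [w] but is one of the graph for [v], is added to the
   front if it can be reached. *)
Lemma private_barrier : exists o, [/\ good (inside L v) (sources v) (fun x => EA x \/ H x) H o,
  core o u & forall u', core o u' -> u' = u].
Proof.
have [FL LE] := bL; pose L' := restr E'; have vr := unr uv; have wr := unr uw.
have FL' x y : F x y -> L' x y.
  move=> Fxy; split; first exact: FL.
  move=> yv; have [|xr] := pselect (x = r); [by left|right].
  have EAx : EA x by apply: FA; split=> //; rewrite -yv.
  by split; [left|move=> xu; apply: uEA; rewrite -xu].
have [C' [[p [s [lp ps]]] C'C mx]] := max_finlink (finlink_nil wr FL').
pose Y' z := tails F w z \/ z \in C'.
have [x0 [x0C nYx0]] : exists x0, x0 \in C /\ ~ Y' x0.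
  apply: contrapT => nex; apply: unsat; exists p, s; split=> //.
  apply: (linkage_sub _ lp) => z [Fz|zC]; [by left|apply: contrapT => nY; apply: nex; by exists z].
have [z <- //|[z [q' [a0 [s' [<- lq' q's _]]]]]|[T0 [nr oT]]] := @augment _ _ _ _ (eq x0) _ lp.
  case: (mx _ x0C) => [xC|[]]; first by case: nYx0; right.
  exists q', (s ++ s'); split.
    apply: (linkage_sub _ lq') => z1; rewrite inE => -[Fz|/orP[/eqP|zC]]; by [right; left|left|right; right].
  move=> z1 Fz; rewrite mem_cat negb_or => /andP[zs zs']; rewrite q's ?ps //; by left.
set I0 := reach (inside L' w) (sources w) T0 in nr oT.
have nIx0 : ~ I0 x0 by apply: nr.
have ct := reach_cut (inside L' w) (sources w) T0; have [c1 c2 c3] := ct; have IT := cut_disj ct.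
have Ine x : I0 x -> x <> r /\ x <> w := @reach_ne L' w T0 x.
have ext X2 D : {subset X2 <= D} -> {subset C' <= D} -> finlink (restr (eq u)) w D ->
    extends (inside L' w) (sources w) Y' p u v X2.
  move=> XD CD [q [s2 [lq qs]]]; exists q, (s ++ s2 ++ C'); split.
    apply: linkage_mono (linkage_sub _ lq) => [z _ x y _ _|//|z [[Fz|/CD zC]|/XD zX]]; try by [left|right].
    move=> [[Lxy h] xr xw yr yw]; have [yv|yv] := pselect (y = v); last by left; split=> //; split.
    by right; split=> //; have [//|] := h yv.
  move=> y [Fy|yC]; rewrite !mem_cat !negb_or => /and3P[h1 h2 h3]; last by rewrite yC in h3.
  by rewrite qs // ps.
have ext0 : extends (inside L' w) (sources w) Y' p u v [:: x0].
  by apply: (ext _ C) => // x; rewrite inE => /eqP ->.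
have [Iu nIv nTv] := barrier_edge lp oT nYx0 nIx0 ext0.
(* Any other kept vertex inside would send its edge into [v] within [L'], which would put [v] into
   [I0] or [T0]. *)
have E'I x : EA x \/ H x -> I0 x -> x = u.
  move=> EHx Ix; apply: contrapT => xu; have [xr xw] := Ine _ Ix.
  have [Lxv _] : tails L v x by case: EHx => [/EAL|/HL].
  have [||] // := c2 x v Ix; split=> //; last by move=> vw; apply: wv.
  by split=> // _; right; split.
have [q0 [lq0 q0I q0p]] := orth_trunc IT oT lp.
have /choice[ysel yP] t : exists y, T0 t -> Y' y /\ {subset q0 t <= p y}.
  have [Tt|] := pselect (T0 t); last by exists t.
  by have [y [s1 [Yy pE]]] := q0p _ Tt; exists y => _; split=> // z zq; rewrite pE mem_cat zq orbT.
pose e1 x y := inside L' w x y /\ I0 x.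
have lq01 : linkage e1 (sources w) (fun z => z \in [::] \/ T0 z) q0.
  have [[b0 u0 d0] h0] : linkage (inside L' w) (sources w) (fun z => z \in [::] \/ T0 z) q0.
    by apply: (linkage_sub _ lq0) => z [].
  split=> //; split=> // t Tt; have [l qE] := h0 _ Tt; have := b0 _ Tt; rewrite qE => bt.
  apply: bw_restrict bt _ => z zl; case: Tt => // Tt; apply: (q0I t) => //; by rewrite qE.
have q0h t : T0 t -> t \in q0 t by move=> Tt; apply: linkage_mem lq0 Tt.
have [|||||||q1 [s1 [lq1 q1s]]] := barrier_extend lp oT yP q0h lq01 (s := [::]) (x := u) _ Iu _ _ _ ext0 => //.
- by left.
- by move=> y; rewrite inE => /eqP ->; split=> //; left.
have conv Y1 q : linkage e1 (sources w) Y1 q -> (forall y, Y1 y -> T0 y \/ I0 y) ->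
    [/\ linkage (inside L v) (sources v) Y1 q, forall y z, Y1 y -> z \in behead (q y) -> I0 z
      & forall y, Y1 y -> w \notin q y].
  move=> [[qb qu qd] qh] YT.
  have beh y z : Y1 y -> z \in behead (q y) -> I0 z.
    by move=> Yy; have := qb _ Yy; have [l ->] := qh _ Yy; move=> /bw_restrict_in; apply.
  have vtx y z : Y1 y -> z \in q y -> z <> v /\ z <> w.
    move=> Yy zq; have [l qE] := qh _ Yy; have := zq; rewrite qE inE => /orP[/eqP zy|zl]; last first.
      have Iz : I0 z by apply: (beh y) => //; rewrite qE.
      by split; [move=> zv; apply: nIv; rewrite -zv|case: (Ine _ Iz)].
    have := qb _ Yy; rewrite qE zy; split.
      by move=> yv; case: (YT _ Yy) => h; [apply: nTv|apply: nIv]; rewrite -yv.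
    by move=> yw; have := qb _ Yy; rewrite qE yw; case: (l) => [[]//|a l' [[[]]]].
  split=> //; last by move=> y Yy; apply/negP => /(vtx _ _ Yy) [].
  apply: linkage_mono (conj (And3 qb qu qd) qh) => y Yy.
    move=> x z xq zq [[[Lxz _] xr xw zr zw] _]; have [xv _] := vtx _ _ Yy xq; have [zv _] := vtx _ _ Yy zq.
    by split.
  by move=> x xq [Erx xr xw]; have [xv _] := vtx _ _ Yy xq.
(* In the graph for [v] the vertex [w] reappears. It becomes a boundary vertex if it is a source or
   has an in-neighbour inside, and then it needs a path disjoint from the others. *)
pose needed := sources v w \/ exists x1, I0 x1 /\ tails L w x1.
pose U z := T0 z \/ z = u.
have UTI y : U y -> T0 y \/ I0 y by case=> [|->]; [left|right].
have lqU : linkage e1 (sources w) U q1.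
  by apply: (linkage_sub _ lq1) => z [Tz|->]; [right; right|left].
have nTw : ~ T0 w.
  move=> Tw; have [_ _ h] := conv _ _ lqU UTI; have := h w (or_introl Tw).
  by rewrite (linkage_mem lqU) //; left.
have [p3 [lp3 p3I]] : exists p3, linkage (inside L v) (sources v) (fun z => (T0 z \/ needed /\ z = w) \/ z = u) p3 /\
    forall y z, (T0 y \/ needed /\ y = w) \/ y = u -> z \in behead (p3 y) -> I0 z.
  have [nd|nnd] := pselect needed; last first.
    have [h1 h2 _] := conv _ _ lqU UTI.
    have sub z : (T0 z \/ needed /\ z = w) \/ z = u -> U z by case=> [[|[]]|]; [left| |right].
    by exists q1; split=> [|y z /sub]; [apply: (linkage_sub sub h1)|apply: h2].
  have [q [l [lq [bl ul lI lqd]]]] : exists q l, linkage e1 (sources w) U q /\ [/\ bw (inside L v) (sources v) (w :: l),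
      uniq (w :: l), forall z, z \in l -> I0 z & forall y z, U y -> z \in l -> z \notin q y].
    case: nd => [Sw|[x1 [I1 t1]]]; first by exists q1, [::].
    have nY1 : ~ Y' x1 by move=> Y1; apply: (orth_end IT oT Y1 _ I1); apply: lp.2.
    have n10 : x1 <> x0 by move=> E1; apply: nIx0; rewrite -E1.
    (* By [sat_more] the list can be enlarged by [x1]. This gives two additional endpoints, enough
       to link both [u] and [x1] besides [T0]. *)
    have ext1 : extends (inside L' w) (sources w) Y' p u v [:: x1; x0].
      apply: (ext _ (x1 :: C)) (sat_more t1) => z; rewrite !inE; last by move=> /C'C ->; rewrite orbT.
      by case/orP=> [->//|/eqP ->]; rewrite x0C orbT.
    have n1u : x1 <> u := barrier_neq lp oT nYx0 nIx0 ext1 nY1 n10.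
    have lq1u : linkage e1 (sources w) (fun z => z \in [:: u] \/ T0 z) q1.
      by apply: (linkage_sub _ lqU) => z []; [rewrite inE => /eqP; right|left].
    have [||||||q2 [s2 [lq2 _]]] := barrier_extend lp oT yP q0h lq1u q1s I1 _ _ _ ext1.
    - by rewrite inE; apply/eqP.
    - by move=> z; rewrite inE => /eqP ->.
    - by right; rewrite mem_head.
    - by rewrite /= inE andbT; apply/eqP.
    - by [].
    - by move=> y; rewrite !inE => /orP[] /eqP ->; split=> //; [right|left].
    have nU1 : ~ U x1 by case=> [/c3|//]; apply.
    have UTI2 y : y = x1 \/ y \in [:: u] \/ T0 y -> T0 y \/ I0 y.
      by case=> [->|[|Ty]]; [right|rewrite inE => /eqP ->; right|left].
    have [[[b2 u2 d2] h2] i2 w2] := conv _ _ lq2 UTI2.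
    have lqU2 : linkage e1 (sources w) U q2.
      by apply: (linkage_sub _ lq2) => z [Tz|->]; [right; right|right; left; rewrite mem_head].
    have X1 : x1 = x1 \/ x1 \in [:: u] \/ T0 x1 by left.
    have [l qE] := h2 _ X1; exists q2, (q2 x1); split=> //; split.
    - have := b2 _ X1; rewrite qE; split=> //; case: t1 => Lx1 x1r; have [_ x1w] := Ine _ I1; split=> //.
        by move=> xv; apply: nIv; rewrite -xv.
    - by rewrite /= w2 // u2.
    - by move=> z; rewrite qE inE => /orP[/eqP -> //|zl]; apply: (i2 x1) => //; rewrite qE.
    - move=> y z Uy zq; apply/negP => zq'; apply: nU1.
      suff <- : y = x1 by [].
      apply: (d2 _ _ z) => //; case: Uy => [Ty|->]; [right; right|right; left; rewrite mem_head] => //.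
  have [lqv qI qw] := conv _ _ lq UTI; have [fq hq] := lqv.
  have nUw : ~ U w by move=> Uw; have := qw _ Uw; rewrite (linkage_mem lqv).
  have Uw y : U y -> y <> w by move=> Uy yw; apply: nUw; rewrite -yw.
  have sub z : (T0 z \/ needed /\ z = w) \/ z = u -> z = w \/ U z.
    by case=> [[|[]]|]; [right; left|left|right; right].
  exists (upd q w (w :: l)); split.
    apply: (linkage_sub sub); split.
      apply: fam_add => // y Uy z; rewrite inE => /orP[/eqP ->|zl]; [exact: qw|exact: lqd].
    by move=> y [->|Uy]; [rewrite updE; exists l|rewrite updN; [apply: hq|apply: Uw]].
  move=> y z /sub [->|Uy]; first by rewrite updE; apply: lI.
  by rewrite updN; [apply: qI|apply: Uw].
exists (Region I0 (fun z => T0 z \/ needed /\ z = w) (eq^~ u) p3); split=> //; split=> //=.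
- split.
  + move=> a [Era ar av]; have [aw|aw] := eqVneq a w.
      by right; right; split=> //; left; rewrite -aw.
    by have [|Ia|Ta] := c1 a; [split=> //; apply/eqP|left|right; left].
  + move=> x y Ix [Lxy xr xv yr yv]; have [yw|yw] := eqVneq y w.
      by right; right; split=> //; right; exists x; split=> //; split=> //; rewrite -yw.
    have [_ xw] := Ine _ Ix; have exy : inside L' w x y.
      by split=> //; apply/eqP.
    by have [Iy|Ty] := c2 _ _ Ix exy; [left|right; left].
  + by move=> x Ix [/(c3 _ Ix)|[_ xw]] //; case: (Ine _ Ix).
- by move=> t z Tt; apply: p3I; left.
- move=> u' z -> zp; have [l pE] := lp3.2 u (or_intror erefl).
  move: zp; rewrite pE inE => /orP[/eqP -> //|zl]; apply: (p3I u); [by right|by rewrite pE].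
- by split=> [u' ->|x Ix /E'I]; [|apply].
Qed.

End Private.

(** The set [EA] serves the constraints with infinitely many hits, and the minimal hitting set [H]
    serves the others. A private constraint gives each element of [H] a region with this element as
    its only core vertex, and a maximal region therefore has all of [H] in its core. The paths to
    [EA] are followed back to the front of that region and continued by its front paths, which are
    disjoint from its core paths. *)
Lemma deletion C0 : (forall x, x \in C0 -> tails L v x) -> exists E1 q,
  [/\ forall x, tails F v x -> E1 x, forall x, x \in C0 -> E1 x, forall x, E1 x -> tails L v x,
     linkage (inside L v) (sources v) E1 q
   & forall w C, unf w -> w <> v -> (forall x, x \in C -> tails L w x) -> finlink (restr E1) w C].
Proof.
move=> C0L; have [EA [qA [FA CA EAL lA inf]]] := fix_infinite C0L.
pose bad (m : V * seq V) := [/\ unf m.1, m.1 <> v, forall x, x \in m.2 -> tails L m.1 x,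
  ~ finlink (restr (fun _ => False)) m.1 m.2 & forall u, EA u -> ~ hits m.1 m.2 u].
have [m bm|m [h1 _ h2 h3 _]|H [hH mH]] := @minimal_hitting V (V * seq V) bad (fun m => hits m.1 m.2).
- apply: contrapT => nfin; case: bm => h1 h2 h3 h4 h5.
  have [l|u EAu Uu] := inf _ _ h1 h3; last by apply: (h5 u).
  apply: contrapT => nex; apply: nfin; exists l => u Uu; apply: contrapT => ul.
  by apply: nex; exists u; split=> //; apply/negP.
- exact: hits_ex.
have HL x : H x -> tails L v x by move=> /mH [m _ [[]]].
have HEA x : H x -> ~ EA x by move=> /mH [m [_ _ _ _ h] [Ux _]] /h.
have barrier u : H u -> exists o, [/\ good (inside L v) (sources v) (fun x => EA x \/ H x) H o,
    core o u & forall u', core o u' -> u' = u].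
  move=> Hu; have [[w C] [/= h1 h2 h3 h4 h5] [[tu fu] h6]] := mH _ Hu.
  apply: (@private_barrier EA H w u C) => // [|/sat_split|x tx].
  - exact: HEA.
  - case=> // -[u' [[[EAu'|Hu'] nu] tu' fu']]; first by apply: (h5 u').
    by apply: nu; apply: h6.
  (* The constraint with [x] added is bad too. An element of [H] that hits it also hits [(w, C)], so
     it is [u]. *)
  - have h3' z : z \in x :: C -> tails L w z by rewrite inE => /orP[/eqP ->|/h3].
    have drop E' : finlink (restr E') w (x :: C) -> finlink (restr E') w C.
      by apply: restr_mono => // z zC; rewrite inE zC orbT.
    have [|u' Hu' [tu' fu']] := hH (w, x :: C).
      by split=> //= [/drop //|u' EAu' [tu' /drop fu']]; apply: (h5 u').
    by rewrite -(h6 u' Hu') //; split=> //; apply: drop.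
pose W x := EA x \/ H x.
have g0 : good (inside L v) (sources v) W H (trivial_wave (sources v)).
  by have [ct lp pt pU [h1 h2]] := trivial_waveP (inside L v) (sources v) W; split=> //; split=> // u [].
have [o [g _ mx]] := good_max g0.
have Hcore u : H u -> core o u.
  move=> Hu; apply: contrapT => nc; have [o2 [g2 c2 u2]] := barrier _ Hu.
  have [|h _] := mx _ g2; last exact: h c2.
  by move=> u' /u2 -> Iu; apply: nc; have [_ _ _ _ [_ h]] := g; apply: h Iu _; right.
have [ct lo po pU [UH IW]] := g; have [[ob ou od] oh] := lo; have [[ab au ad] ah] := lA.
have EAout x : EA x -> ~ inner o x.
  by move=> EAx Ix; apply: (HEA x) => //; apply: UH; apply: IW Ix _; left.
have /choice[f fP] x : exists f : seq V * V * seq V, W x ->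
    (H x -> f.1.1 = [::] /\ f.1.2 = x) /\ (EA x -> [/\ qA x = f.1.1 ++ f.1.2 :: f.2, front o f.1.2
      & forall z, z \in f.1.1 -> ~ inner o z /\ ~ front o z]).
  have [Hx|nH] := pselect (H x); first by exists ([::], x, [::]) => _; split=> // EAx; case: (HEA x).
  have [EAx|] := pselect (EA x); last by exists ([::], x, [::]); case.
  have [l qE] := ah _ EAx; have bq := ab _ EAx; rewrite qE in bq.
  have [s [t [l' [def Tt sP]]]] := split_cross ct bq (EAout _ EAx).
  by exists (s, t, l') => _; split=> // _; rewrite qE.
pose s x := (f x).1.1; pose b x := (f x).1.2.
have sH x : H x -> s x = [::] /\ b x = x by move=> Hx; have [h _] := fP x (or_intror Hx); apply: h.
have sA x : EA x -> [/\ qA x = s x ++ b x :: (f x).2, front o (b x) & forall z, z \in s x -> ~ inner o z /\ ~ front o z].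
  by move=> EAx; have [_ h] := fP x (or_introl EAx); apply: h.
have sq x z : W x -> z \in s x -> EA x /\ z \in qA x.
  case=> [EAx|Hx] zs; last by move: zs; rewrite (sH _ Hx).1.
  by have [-> _ _] := sA _ EAx; split=> //; rewrite mem_cat zs.
have bA x : EA x -> b x \in qA x by move=> EAx; have [-> _ _] := sA _ EAx; rewrite mem_cat mem_head orbT.
have IT : forall x, inner o x -> ~ front o x by case: ct.
exists W, (fun x => s x ++ paths o (b x)); split.
- by move=> x /FA; left.
- by move=> x /CA; left.
- by move=> x [/EAL|/HL].
- split; last first.
    move=> x [EAx|Hx]; last by have [-> ->] := sH _ Hx; apply: oh; right; apply: Hcore.
    have [qE Tb _] := sA _ EAx; have [l bE] := oh _ (or_introl Tb); have [l' qE'] := ah _ EAx.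
    by move: qE; rewrite qE' bE; case: (s x) => [|a s'] [xE _] /=; rewrite -xE; [exists l|exists (s' ++ b x :: l)].
  apply: (fam_glue (And3 ob ou od)).
  + by move=> x [EAx|Hx]; [left; case: (sA _ EAx)|right; rewrite (sH _ Hx).2; apply: Hcore].
  + have dif x y : EA x -> H y -> b x <> b y.
      move=> EAx Hy E1; have [_ Tb _] := sA _ EAx; apply: IT Tb; rewrite E1 (sH _ Hy).2.
      by apply: good_core g _; apply: Hcore.
    move=> x x' [EAx|Hx] [EAx'|Hx'].
    * by move=> bb; apply: (ad _ _ (b x)) => //; [exact: bA|rewrite bb; exact: bA].
    * by move/dif; case.
    * by move/esym/dif; case.
    * by rewrite (sH _ Hx).2 (sH _ Hx').2.
  + move=> x [EAx|Hx]; last by rewrite (sH _ Hx).1.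
    by have := au _ EAx; have [-> _ _] := sA _ EAx; rewrite cat_uniq => /andP[].
  + by move=> x x' z Wx Wx' /(sq _ _ Wx) [EAx zq] /(sq _ _ Wx') [EAx' zq']; apply: (ad _ _ z).
  + move=> x y z Wx TUy zs; have [EAx _] := sq _ _ Wx zs; have [_ _ h] := sA _ EAx; have [nI nT] := h _ zs.
    apply/negP => zp; case: TUy => [Ty|Uy]; last by apply: nI; apply: pU zp.
    have [l pE] := oh _ (or_introl Ty); move: zp; rewrite pE inE => /orP[/eqP zy|zl]; first by apply: nT; rewrite zy.
    by apply: nI; apply: (po y) => //; rewrite pE.
  + move=> x [EAx|Hx]; last by have [-> ->] := sH _ Hx; apply: ob; right; apply: Hcore.
    have [qE Tb _] := sA _ EAx; have := ab _ EAx; rewrite qE => bq; have [l bE] := oh _ (or_introl Tb).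
    by rewrite bE; apply: bw_swap bq _; rewrite -bE; apply: ob; left.
- move=> w C uw wv CL; have [f0|nf0] := pselect (finlink (restr (fun _ => False)) w C).
    exact: restr_mono f0.
  have [[u [EAu [_ fu]]]|nh] := pselect (exists u, EA u /\ hits w C u).
    by apply: restr_mono fu => // x <-; left.
  have [|u Hu [_ fu]] := hH (w, C); last by apply: restr_mono fu => // x <-; right.
  by split=> // u EAu hu; apply: nh; exists u.
Qed.

End Deletion.

(** * Stages of the freezing process and their intersection *)

Notation data := (V -> (V -> seq V) * (V -> Prop) * (V -> Prop))%type.
Implicit Types (X : data).

(** [D] lists the vertices frozen so far; for each of them [X] stores the linkage, the inner side
    and the boundary of its cut. *)
Definition stage (st : (V -> V -> Prop) * seq V * data) := let: (L, D, X) := st in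
  [/\ between L, forall y, y \in D -> y <> r -> frozen L y (X y).1.1 (X y).1.2 (X y).2,
      all_linked L (fun w => w <> r /\ w \notin D) & blocked L (fun w => w <> r /\ w \notin D)].

(** Each earlier frozen linkage uses at most one edge into [v]; the tails of these edges form the
    finite list [C0] and are protected. The set [E1] given by [deletion] is enlarged by [em_paths]
    to one that is linked orthogonally to a Menger cut, which is a cut of [E] by [dsep]. Keeping
    more edges than [E1] is harmless, as [finlink] is monotone. *)
Lemma freeze L D X v : stage (L, D, X) -> exists L' X', [/\ stage (L', v :: D, X'),
  forall x y, L' x y -> L x y, forall x y, y \in D -> L x y -> L' x y
  & forall y, y \in D -> X' y = X y].
Proof.
move=> [bL fz lk bl].
have [vD|vD] := pselect (v = r \/ v \in D).
  exists L, X; split=> //; split=> //.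
  - move=> y; rewrite inE => /orP[/eqP -> vr|/fz //]; by case: vD => // /fz; apply.
  - by move=> w [wr]; rewrite inE negb_or => /andP[_ wD]; apply: lk.
  - by move=> x y [yr]; rewrite inE negb_or => /andP[_ yD]; apply: bl.
have vr : v <> r by move=> h; apply: vD; left.
have nvD : v \notin D by apply/negP => h; apply: vD; right.
pose unf w := w <> r /\ w \notin D; have uv : unf v by [].
have unr w : unf w -> w <> r by case.
have [C0 [C0L C0P]] : exists C0, (forall x, x \in C0 -> tails L v x) /\ forall y, y \in D -> y <> r ->
    linkage (fun x z => inside L y x z /\ (z = v -> x \in C0)) (sources y) (tails L y) (X y).1.1.
  elim: (D) fz => [|y D' IH] fz; first by exists [::].
  have [|C [CL CP]] := IH; first by move=> z zD; apply: fz; rewrite inE zD orbT.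
  have [yr|yr] := pselect (y = r).
    by exists C; split=> // z; rewrite inE => /orP[/eqP -> //|/CP].
  have [lp _ _ _] := fz y (mem_head _ _) yr; have [c [_ cv lc]] := one_pred v lp.
  exists (c ++ C); split; first by move=> x; rewrite mem_cat => /orP[/cv [? ? _ _ _]|/CL].
  move=> z; rewrite inE => /orP[/eqP -> _|zD zr].
    by apply: linkage_mono lc => // _ _ a b _ _ [h1 h2]; split=> // /h2 ac; rewrite mem_cat ac.
  by apply: linkage_mono (CP _ zD zr) => // _ _ a b _ _ [h1 h2]; split=> // /h2 ac; rewrite mem_cat ac orbT.
have [E1 [q [FE1 C0E1 E1L lq dl]]] := deletion bL lk unr uv C0L.
have [o [E2 [P [wv mx E12 E2L [lP oP]]]]] := em_paths E1L lq.
have cover y : y <> r -> y \in D \/ unf y.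
  by move=> yr; have [yD|yD] := boolP (y \in D); [left|right].
have [ctE tE] := dsep bL lk bl cover unr fz uv wv mx.
set R := reach _ _ _ in oP ctE tE; set S := front o in oP ctE.
pose L' := restr L v E2.
pose X' : data := fun y => if y == v then (P, R, S) else X y.
have Dv y : y \in D -> y <> v by move=> yD yv; move: nvD; rewrite -yv yD.
have L'L x y : L' x y -> L x y by case.
have LL' x y : y <> v -> L x y -> L' x y by move=> yv Lxy; split.
have tv : tails L' v = E2.
  apply: funext => x; apply: propext; split=> [[[Lxv h] xr]|E2x]; first by have [|] := h erefl.
  by have [Lxv xr] := E2L _ E2x; split=> //; split=> // _; right.
have tw w : w <> v -> tails L' w = tails L w.
  move=> wv'; apply: funext => x; apply: propext; split=> [[h xr]|[h xr]].
    exact: conj (L'L _ _ h) xr.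
  exact: conj (LL' _ _ wv' h) xr.
exists L', X'; split=> //; last 2 first.
- by move=> x y /Dv yv; apply: LL'.
- by move=> y /Dv /eqP yv; rewrite /X' (negPf yv).
have [FL LE] := bL; split.
- split=> x y; last by move=> /L'L /LE.
  move=> Fxy; split; first exact: FL.
  move=> yv; have [|xr] := pselect (x = r); [by left|right].
  by apply: E12; apply: FE1; split=> //; rewrite -yv.
- move=> y; rewrite inE => /orP[/eqP ->|yD] yr; rewrite /X'.
    rewrite eqxx /=; split=> //; last by split=> //; move/reach_ne => [].
      rewrite tv; apply: linkage_mono lP => // _ _ a b _ _; move=> [h1 h2 h3 h4 h5]; split=> //.
    by rewrite tv.
  have yv := Dv _ yD; rewrite (negPf (introN eqP yv)); have [lp ct oS nI] := fz _ yD yr.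
  split=> //; last by rewrite tw.
  rewrite tw //; apply: linkage_mono (C0P _ yD yr) => // _ _ a b _ _ [[h1 h2 h3 h4 h5] h6]; split=> //.
  by split=> // /h6 aC; right; apply: E12; apply: C0E1.
- move=> w [wr]; rewrite inE negb_or => /andP[/eqP wv' wD] C CL.
  have : finlink (restr L v E1) w C by apply: dl => // x /CL; rewrite tw.
  exact: restr_mono.
- move=> x y [yr]; rewrite inE negb_or => /andP[/eqP yv yD] Exy nL.
  have nLxy : ~ L x y by move=> Lxy; apply: nL; apply: LL'.
  have [C [CL nf]] := bl x y (conj yr yD) Exy nLxy.
  exists C; split; first by move=> c /CL; rewrite tw.
  by apply: contra_not nf; apply: finlink_mono => // a b _ /L'L.
Qed.

Lemma bw_inter (e : nat -> V -> V -> Prop) A l : (forall n, bw (e n) A l) ->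
  bw (fun x y => forall n, e n x y) A l.
Proof.
elim: l => [/(_ 0)//|y [|x l] IH h] /=; first exact: (h 0).
by split=> [n|]; [case: (h n)|apply: IH => n; case: (h n)].
Qed.

(** Once [v] is frozen, its in-edges are kept at all later stages and its linkage lies in each of
    them, so both pass to the intersection. The vertex with code [n] is frozen in step [n]. *)
Lemma final_sub : exists L, between L /\ forall v, v <> r -> exists P I S, frozen L v P I S.
Proof.
have [L0 [b0 lk0 bl0]] := max_sub.
pose X0 : data := fun _ => (fun _ => [::], fun _ => False, fun _ => False).
have s0 : stage (L0, [::], X0).
  by split=> // [w []|x y []]; [move=> wr _; apply: lk0|move=> yr _; apply: bl0].
pose S := {st | stage st}; pose Lf (s : S) := (sval s).1.1; pose Df (s : S) := (sval s).1.2; pose Xf (s : S) := (sval s).2.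
have sP (s : S) : stage (Lf s, Df s, Xf s) by move: (svalP s); rewrite /Lf /Df /Xf; case: (sval s) => -[].
have /choice[next nextP] (ns : nat * S) : exists s' : S, [/\ forall x y, Lf s' x y -> Lf ns.2 x y,
    forall x y, y \in Df ns.2 -> Lf ns.2 x y -> Lf s' x y, forall y, y \in Df ns.2 -> Xf s' y = Xf ns.2 y,
    {subset Df ns.2 <= Df s'} & forall v, unpickle ns.1 = Some v -> v \in Df s'].
  case: ns => n s /=; have [L' [X' [st' h1 h2 h3]]] := freeze (odflt r (unpickle n)) (sP s).
  exists (exist _ _ st'); split=> //; rewrite /Df /=; first by move=> y yD; rewrite inE yD orbT.
  by move=> v ->; rewrite mem_head.
pose f := fix f n : S := if n is n'.+1 then next (n', f n') else exist _ _ s0.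
have mono n m : n <= m -> [/\ forall x y, Lf (f m) x y -> Lf (f n) x y,
    forall x y, y \in Df (f n) -> Lf (f n) x y -> Lf (f m) x y, forall y, y \in Df (f n) -> Xf (f m) y = Xf (f n) y
    & {subset Df (f n) <= Df (f m)}].
  move=> /subnK <-; elim: (m - n) => [|k [h1 h2 h3 h4]]; first by split.
  have [g1 g2 g3 g4 _] := nextP (k + n, f (k + n)); split.
  - by move=> x y /g1 /h1.
  - by move=> x y yD Lxy; apply: g2; [apply: h4|apply: h2].
  - by move=> y yD; rewrite -h3 //; apply: g3; apply: h4.
  - by move=> y /h4 /g4.
pose L x y := forall n, Lf (f n) x y.
exists L; split.
  split=> x y; first by move=> Fxy n; have [[h _] _ _ _] := sP (f n); apply: h.
  by move=> /(_ 0); have [[_ h] _ _ _] := sP (f 0); apply: h.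
move=> v vr; pose M := (pickle v).+1.
have vM : v \in Df (f M).
  by have [_ _ _ _ h] := nextP (pickle v, f (pickle v)); apply: h; rewrite /= pickleK.
have fr m : M <= m -> frozen (Lf (f m)) v (Xf (f M) v).1.1 (Xf (f M) v).1.2 (Xf (f M) v).2.
  by move=> /mono [_ _ <- // vm]; have [_ h _ _] := sP (f m); apply: h => //; apply: vm.
have LM x y : (forall m, M <= m -> Lf (f m) x y) -> L x y.
  move=> h n; have [/h //|/ltnW /mono [g _ _ _]] := leqP M n; apply: g; exact: h.
have tE m : M <= m -> tails L v = tails (Lf (f m)) v.
  move=> Mm; apply: funext => x; apply: propext; split=> -[h xr]; split=> //.
  apply: LM => m' Mm'; have [g1 _ _ _] := mono _ _ Mm; have [_ g2 _ _] := mono _ _ Mm'.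
  by apply: g2 => //; apply: g1.
exists (Xf (f M) v).1.1, (Xf (f M) v).1.2, (Xf (f M) v).2.
have [[[pb pu pd] ph] ct oS nI] := fr _ (leqnn M).
rewrite /frozen (tE _ (leqnn M)); split=> //; split=> //; split=> // y ty.
have bn n : bw (inside (Lf (f (M + n))) v) (sources v) ((Xf (f M) v).1.1 y).
  have [[[b _ _] _] _ _ _] := fr _ (leq_addr n M); apply: b.
  by rewrite -tE ?leq_addr // (tE _ (leqnn M)).
apply: bw_mono (bw_inter bn) => // x z _ _ h; have [_ h1 h2 h3 h4] := h 0; split=> //.
by apply: LM => m /subnKC <-; case: (h (m - M)).
Qed.

End Main.

(** * Path systems *)

Section Conversion.
Variables (V : countType) (r : V).
Implicit Types (x y z v : V) (e : V -> V -> Prop) (l m : seq V).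

Lemma chain_rcons e x s z : chain e x (rcons s z) <-> chain e x s /\ e (last x s) z.
Proof.
elim: s x => [|y s IH] x /=; first by split=> [[]|[]].
by split=> [[exy /IH []]|[[exy h] h2]]; split=> //; apply/IH.
Qed.

Lemma chain_bw e x l : chain e r (rev (x :: l)) <-> bw e (e r) (x :: l).
Proof.
elim: l x => [|y l IH] x; first by split=> [[]|].
rewrite rev_cons; split=> [/chain_rcons [/IH h]|[eyx /IH h]].
  by rewrite rev_cons last_rcons.
by apply/chain_rcons; rewrite {2}rev_cons last_rcons.
Qed.

Lemma xy_path_bw e v x l : v <> r -> bw e (e r) (x :: l) -> e x v -> uniq (x :: l) ->
  r \notin x :: l -> v \notin x :: l -> xy_path (@allV V) e r v (r :: rcons (rev (x :: l)) v).
Proof.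
move=> vr bl exv ul rl vl; exists (rcons (rev (x :: l)) v); split=> //.
- by rewrite last_rcons.
- rewrite /= rcons_uniq mem_rcons inE !mem_rev negb_or rl vl rev_uniq ul !andbT.
  by apply/eqP => h; apply: vr.
- by apply/chain_rcons; split; [apply/chain_bw|rewrite rev_cons last_rcons].
Qed.

Lemma bw_xy_path VS e v p : v <> r -> xy_path VS e r v p -> ~ e r v \/ p <> [:: r; v] ->
  exists x l, [/\ p = r :: rcons (rev (x :: l)) v, bw e (e r) (x :: l), e x v, uniq (x :: l)
    & forall z, z \in x :: l -> z <> r /\ z <> v].
Proof.
move=> vr [q [-> + uq _ cq]]; case/lastP: q uq cq => [|q v'] uq cq; first by move=> /= /esym.
rewrite last_rcons => ?; subst v'; have [cq' eq] := (chain_rcons _ _ _ _).1 cq.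
case/lastP: q uq cq cq' eq => [|m x] uq cq cq' eq; first by case=> // nerv; case: cq.
move=> _; exists x, (rev m); have mE : rev (x :: rev m) = rcons m x by rewrite rev_cons revK.
move: uq; rewrite /= mem_rcons inE negb_or rcons_uniq => /and3P[/andP[_ rm] vm um].
split.
- by rewrite mE.
- by apply/chain_bw; rewrite mE.
- by move: eq; rewrite last_rcons.
- by move: um; rewrite -mE rev_uniq.
- move=> z; rewrite -mem_rev mE => zm; by split=> zE; [move: rm|move: vm]; rewrite -zE zm.
Qed.

(** The tail of the terminal edge serves as index of a path. The path that is just the edge from [r]
    drops out, since [tails] excludes [r]. *)
Lemma flame_linkage (E EF : V -> V -> Prop) VF v : (forall x y, EF x y -> E x y) -> v <> r ->
  in_G VF EF r v (in_edges EF v) -> exists q,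
  linkage (inside r EF v) (sources E r v) (tails r EF v) q.
Proof.
move=> EE vr [_ [PS [[Pp Pd] PT]]].
have /choice[q qP] x : exists l, tails r EF v x -> [/\ PS (r :: rcons (rev (x :: l)) v),
    bw EF (EF r) (x :: l), uniq (x :: l) & forall z, z \in x :: l -> z <> r /\ z <> v].
  have [[EFxv xr]|] := pselect (tails r EF v x); last by exists [::].
  have [p [pre [PSp pE]]] := (PT (x, v)).1 (conj EFxv erefl).
  have [|x' [l [pE' bl ex' ul ne]]] := bw_xy_path vr (Pp _ PSp).
    right=> pE'; move: pE; rewrite pE' -[[:: r; v]]/(rcons [:: r] v) => /rcons_inj [/= h].
    by apply: xr; case: pre h => [[<-]|a [|b pre]].
  exists l => _; move: pE; rewrite pE' -rcons_cons => /rcons_inj [/=].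
  by rewrite rev_cons -rcons_cons => /rcons_inj [_ xx]; rewrite xx in pE' bl ul ne; split=> //; rewrite -pE'.
exists (fun x => x :: q x); split; last by move=> x; exists (q x).
split=> [x /qP [_ bx _ ne]|x /qP []//|x x' z /qP [P1 b1 u1 n1] /qP [P2 b2 u2 n2] z1 z2].
- apply: bw_mono bx => [a b /ne [ar av] /ne [br bv] eab|a /ne [ar av] era]; split=> //; exact: EE.
- have [zr zv] := n1 _ z1; have [E12|n12] := pselect (r :: rcons (rev (x :: q x)) v = r :: rcons (rev (x' :: q x')) v).
    by case: E12 => /rcons_inj [/(congr1 rev)]; rewrite !revK => -[].
  by case: (Pd _ _ P1 P2 n12 z) => //; rewrite inE mem_rcons inE mem_rev ?z1 ?z2 !orbT.
Qed.

Section Final.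
Variables (E L : V -> V -> Prop) (v : V) (P : V -> seq V) (I S : V -> Prop).
Hypotheses (LE : forall x y, L x y -> E x y) (rL : forall x, E r x -> L r x).
Hypotheses (vr : v <> r) (fr : frozen E r L v P I S).

Let lift x := r :: rcons (rev (P x)) v.

Let PP x : tails r L v x -> exists l, [/\ P x = x :: l, bw L (L r) (x :: l), uniq (x :: l)
  & r \notin x :: l /\ v \notin x :: l].
Proof.
have [[[pb pu pd] ph] _ _ _] := fr; move=> tx; have [l pE] := ph _ tx; exists l.
have bx := pb _ tx; have ux := pu _ tx; rewrite pE in bx ux.
have ne z : z \in x :: l -> z <> r /\ z <> v.
  by case/(bw_edge_in bx) => [[]|[y [_ []]]].
split=> //; last by split; apply/negP => /ne [].
by apply: bw_mono bx => [a b _ _ []|a _ [era _ _]] //; apply: rL.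
Qed.

Let lift_path x : tails r L v x -> xy_path (@allV V) L r v (lift x).
Proof.
move=> tx; have [l [pE bx ux [rx vx]]] := PP tx; rewrite /lift pE.
by apply: xy_path_bw => //; case: tx.
Qed.

Let lift_mem x z : z \in lift x -> [\/ z = r, z = v | z \in P x].
Proof.
rewrite inE mem_rcons inE mem_rev => /or3P[/eqP|/eqP|]; by [constructor 1|constructor 2|constructor 3].
Qed.

Let lift_disj x x' z : tails r L v x -> tails r L v x' -> lift x <> lift x' ->
  z \in lift x -> z \in lift x' -> z = r \/ z = v.
Proof.
have [[[_ _ pd] _] _ _ _] := fr; move=> tx tx' ne.
case/lift_mem => [->|->|zx]; [by left|by right|].
case/lift_mem => [->|->|zx']; [by left|by right|].
by case: ne; rewrite (pd _ _ z tx tx' zx zx').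
Qed.

Let lift_last x pre y z : tails r L v x -> lift x = rcons (rcons pre y) z -> y = x /\ z = v.
Proof.
move=> tx; have [l [pE _ _ _]] := PP tx; rewrite /lift pE rev_cons -!rcons_cons.
by move=> /rcons_inj [h <-]; move: h; rewrite -rcons_cons => /rcons_inj [_ <-].
Qed.

(** The linkage accounts for all in-edges except one from [r], which is a path by itself. *)
Lemma frozen_flame : in_G (@allV V) L r v (in_edges L v).
Proof.
split=> //; exists (fun p => (L r v /\ p = [:: r; v]) \/ exists2 x, tails r L v x & p = lift x).
split; first split.
- move=> p [[Lrv ->]|[x tx ->]]; last exact: lift_path.
  by exists [:: v]; split=> //=; rewrite inE andbT; apply/eqP => rv; apply: vr.
- have two z : z \in [:: r; v] -> z = r \/ z = v.
    by rewrite !inE => /orP[] /eqP; [left|right].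
  move=> p q [[_ ->]|[x tx ->]] [[_ ->]|[x' tx' ->]] ne z.
  + by move/two.
  + by move/two.
  + by move=> _ /two.
  + exact: lift_disj.
case=> x y; split=> [[/= Lxv yv]|[p [pre [[[Lrv ->]|[x' tx' ->]] /= pE]]]].
- subst y; have [xr|xr] := pselect (x = r).
    by subst x; exists [:: r; v], [::]; split=> //; left.
  have tx : tails r L v x by [].
  have [l [pE _ _ _]] := PP tx; exists (lift x), (r :: rev l); split; first by right; exists x.
  by rewrite /lift pE rev_cons.
- move: pE; rewrite -[[:: r; v]]/(rcons [:: r] v) => /rcons_inj [h <-]; split=> //=.
  by case: pre h => [[<-]|a [|b pre]].
- by have [-> ->] := lift_last tx' pE; split=> //=; case: tx'.
Qed.

(** A path of [E] that avoids the edge from [r] to [v] enters [v] from an in-neighbour outside [I],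
    so its interior has to cross [S]. *)
Lemma frozen_large : v_large E L r v.
Proof.
have [lp ct oS [nIv nI]] := fr; split; last exact: rL.
have nS z : S z -> z <> r /\ z <> v.
  have [_ /(_ z)] := oS; move=> + Sz => /(_ Sz) [y ty zy]; have [l [pE _ _ [rl vl]]] := PP ty.
  by rewrite pE in zy; split=> zE; [move: rl|move: vl]; rewrite -zE zy.
exists (fun p => exists2 x, tails r L v x & p = lift x); split; last by move=> _ [x tx ->]; apply: lift_path.
split; first split.
- move=> _ [x tx ->]; have [l [pE bx ux [rx vx]]] := PP tx; rewrite /lift pE.
  have nz z : z \in x :: l -> z <> r /\ z <> v.
    by move=> zl; split=> zE; [move: rx|move: vx]; rewrite -zE zl.
  apply: xy_path_bw => //.
    apply: bw_mono bx => [a b /nz [ar _] _ Lab|a /nz [_ av] Lra]; split; try exact: LE; by case.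
  by case: tx => Lxv xr; split; [apply: LE|case].
- by move=> _ _ [x tx ->] [x' tx' ->] ne z; apply: lift_disj.
exists S; split.
  split; first by move/nS => [].
  split; first by move/nS => [].
  move=> p pp; have [|x [l [-> bx [exv nxr] ux nz]]] := bw_xy_path vr pp.
    by left; case=> _; apply.
  have bx' : bw (inside r E v) (sources E r v) (x :: l).
    apply: bw_mono bx => [a b /nz [ar av] /nz [br bv] [eab _]|a /nz [ar av] [era _]]; by split.
  have [|t tl St] := cut_cross ct bx'.
    by apply: nI; split=> // xr; apply: nxr.
  by exists t => //; rewrite inE mem_rcons inE mem_rev tl !orbT.
split=> [_ [x tx ->]|s Ss].
  have [oS1 _] := oS; have [s1 [t [s2 [pE St _ _]]]] := oS1 _ tx.
  have tp : t \in P x by rewrite pE mem_cat mem_head orbT.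
  exists t; split; first by split=> //; rewrite inE mem_rcons inE mem_rev tp !orbT.
  move=> t' [/lift_mem + St']; have [nr nv] := nS _ St'; case=> // tp'.
  exact: (orth_inj (cut_disj ct) oS tx).
have [_ /(_ _ Ss) [x tx sx]] := oS; exists (lift x); split; first by exists x.
by rewrite inE mem_rcons inE mem_rev sx !orbT.
Qed.

End Final.
End Conversion.

Theorem theorem1p4 (V : countType) (E : V -> V -> Prop) (r : V)
  (E_irr : forall x, ~ E x x)
  (VF : V -> Prop) (EF : V -> V -> Prop)
  (VF_r : VF r)
  (F_sub : forall a b, EF a b -> [/\ E a b, VF a & VF b])
  (F_flame : vertex_flame VF EF r) :
  exists Fs : V -> V -> Prop,
    [/\ (forall a b, Fs a b -> E a b),
        vertex_flame (@allV V) Fs r,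
        D_large E Fs r &
        (forall a b, EF a b -> Fs a b)].
Proof.
have EE x y : EF x y -> E x y by move/F_sub => [].
(* Edges at the root can be added for free: [tails] excludes [r], so the in-edges to be linked at
   each vertex are still those of the flame. *)
pose F x y := EF x y \/ E x y /\ x = r.
have FE x y : F x y -> E x y by case=> [/EE|[]].
have rF x : E r x -> F r x by right.
have /choice[N FN] w : exists q, w <> r -> linkage (inside r F w) (sources E r w) (tails r F w) q.
  have [wr|wr] := pselect (w = r); first by exists (fun _ => [::]).
  have tF x : tails r F w x -> tails r EF w x by case=> -[h xr|[_ ->]].
  have [VFw|nVFw] := pselect (VF w); last first.
    exists (fun _ => [::]) => _; have tn x : ~ tails r F w x.
      by move/tF => [/F_sub [_ _]].
    by split; [split=> [y /tn|y /tn|y y' z /tn]|move=> y /tn].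
  have [q lq] := flame_linkage EE wr (F_flame _ VFw wr); exists q => _.
  apply: linkage_mono (linkage_sub tF lq) => // _ _ x y _ _; apply: inside_mono; by left.
have [L [[FL LE] fr]] := final_sub FE rF FN.
have rL x : E r x -> L r x by move/rF/FL.
exists L; split=> //.
- by move=> v _ vr; have [P [I [S h]]] := fr _ vr; apply: frozen_flame h.
- by move=> v vr; have [P [I [S h]]] := fr _ vr; apply: frozen_large h.
- by move=> a b h; apply: FL; left.
Qed.
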